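(* Let $k>0$ and let $a_1,a_2,a_3$ be real constants satisfying $a_1^2+a_2^2=a_1+a_2$, $|a_3|<1$ and $(a_1-1)a_3=(a_2-1)a_3=0$. Let $s\ge 3$ be an integer and let $\phi,\psi\in H^s_p(0,1)$. Let $(u,v)$ be the solution, with periodic boundary conditions on $0\le x\le 1$, of $$\begin{cases}u'+uu_x+u_{xxx}+a_3v_{xxx}+a_1vv_x+a_2(uv)_x+k(u-[u])=0,\\ v'+vv_x+v_{xxx}+a_3u_{xxx}+a_2uu_x+a_1(uv)_x+k(v-[v])=0,\\ u(0,x)=\phi(x),\quad v(0,x)=\psi(x),\end{cases}\qquad t\ge 0.$$ Then for each $k'<k$, $$\|u(t)-[u(t)]\|_{H^s_p(0,1)}+\|v(t)-[v(t)]\|_{H^s_p(0,1)}=o\left(e^{-k't}\right)\quad\text{as } t\to\infty.$$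
   Context: All functions are real-valued; the prime denotes $\partial/\partial t$ and the subscript $x$ denotes $\partial/\partial x$. $[f]:=\int_0^1 f(x)\,dx$ is the mean value of $f$. For an integer $s\ge 0$, $H^s_p(0,1):=\{w\in H^s(0,1): \partial_x^n w(0)=\partial_x^n w(1),\ n=0,\ldots,s-1\}$ with the norm of $H^s(0,1)$ (so $H^0_p(0,1)=L^2(0,1)$). Under the stated conditions on the coefficients it is known that for $\phi,\psi\in H^s_p(0,1)$ with integer $s\ge3$ the system has a unique solution with $u,v\in C([0,\infty);H^s_p(0,1))\cap C^1([0,\infty);H^{s-3}_p(0,1))$, and the map $(\phi,\psi)\mapsto(u,v)$ is continuous from $(H^s_p(0,1))^2$ into $\big(C([0,\infty);H^s_p(0,1))\cap C^1([0,\infty);H^{s-3}_p(0,1))\big)^2$; ''the solution'' refers to this one. *)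

(* Defs.v *)
From HB Require Import structures.
From mathcomp Require Import all_boot all_order all_algebra.
From mathcomp Require Import all_classical all_reals all_analysis.
Set Implicit Arguments.
Unset Strict Implicit.
Unset Printing Implicit Defensive.
Import Order.TTheory GRing.Theory Num.Theory.
Import numFieldNormedType.Exports.
Local Open Scope classical_set_scope.
Local Open Scope ring_scope.

(* Elements of L^2(0,1) and H^s(0,1) are represented by functions R -> R of
   which only the restriction to ]0, 1[, modulo equality almost everywhere,
   matters. *)

(* Needed by the =o_ notation, which takes a packed filter. *)
Canonical pinfty_filter_on (R : realType) := FilterType (pinfty_nbhs R) _.

Section periodic_sobolev.
Variable R : realType.
Implicit Types (w g h p : R -> R) (n s : nat).

Local Notation mu := (@lebesgue_measure R).
Local Notation I := (`]0, 1[%classic : set R).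

Definition mean w : R := \int[mu]_(x in I) w x.

Definition L2 w : Prop :=
  measurable_fun I w /\ mu.-integrable I (EFin \o (fun x => w x ^+ 2)).

Definition test_function p : Prop :=
  (forall n x, derivable (derive1n n p) x 1) /\
  (exists K : set R, [/\ compact K, K `<=` I & forall x, ~ K x -> p x = 0]).

Definition is_wderiv n w g : Prop :=
  [/\ locally_integrable I w, locally_integrable I g &
      forall p, test_function p ->
        \int[mu]_(x in I) (w x * derive1n n p x) =
        (-1) ^+ n * \int[mu]_(x in I) (g x * p x)].

(* A representative of the weak derivative of order n, which is unique almost
   everywhere; the value 0 is a dummy, taken if there is no weak derivative. *)
Definition wderiv n w : R -> R :=
  xget (fun _ : R => 0 : R) [set g | is_wderiv n w g].

Definition in_Hs s w : Prop :=
  forall n, (n <= s)%N -> exists2 g, is_wderiv n w g & L2 g.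

(* The boundary values of the weak derivative of order n < s are those of its
   representative that is continuous on [0, 1]. *)
Definition in_Hsp s w : Prop :=
  in_Hs s w /\
  (forall n, (n < s)%N -> exists h,
     [/\ is_wderiv n w h, {within `[0, 1], continuous h} & h 0 = h 1]).

Definition Hnorm s w : R :=
  Num.sqrt (\sum_(n < s.+1) \int[mu]_(x in I) (wderiv n w x) ^+ 2).

(* In u t x, the first variable is the time. *)
Definition C0_Hsp s (u : R -> R -> R) : Prop :=
  forall t : R, 0 <= t ->
    in_Hsp s (u t) /\
    Hnorm s (u r \- u t) @[r --> within `[0, +oo[ (nbhs t)] --> (0 : R).

Definition C1_Hsp s (u u' : R -> R -> R) : Prop :=
  [/\ C0_Hsp s u, C0_Hsp s u' &
      forall t : R, 0 <= t ->
        Hnorm s (fun x => (u r x - u t x) / (r - t) - u' t x)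
          @[r --> within `[0, +oo[ t^'] --> (0 : R)].

Definition kdv_solution (k a1 a2 a3 : R) s (phi psi : R -> R)
    (u v : R -> R -> R) : Prop :=
  [/\ C0_Hsp s u, C0_Hsp s v,
      {ae mu, forall x, I x -> u 0 x = phi x},
      {ae mu, forall x, I x -> v 0 x = psi x} &
      exists u' v' : R -> R -> R,
      [/\ C1_Hsp (s - 3) u u', C1_Hsp (s - 3) v v' &
      forall t : R, 0 <= t ->
        {ae mu, forall x, I x ->
          u' t x + u t x * wderiv 1 (u t) x + wderiv 3 (u t) x
          + a3 * wderiv 3 (v t) x + a1 * (v t x * wderiv 1 (v t) x)
          + a2 * wderiv 1 (u t \* v t) x + k * (u t x - mean (u t)) = 0}
        /\
        {ae mu, forall x, I x ->
          v' t x + v t x * wderiv 1 (v t) x + wderiv 3 (v t) x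
          + a3 * wderiv 3 (u t) x + a2 * (u t x * wderiv 1 (u t) x)
          + a1 * wderiv 1 (u t \* v t) x + k * (v t x - mean (v t)) = 0}]].

End periodic_sobolev.

(* Main.v *)
(* The hypotheses on a1, a2, a3 say that a rotation of the pair (u, v) splits the
   system into two scalar equations p' + c p p_x + d p_xxx + k (p - [p]) = 0 with
   d > 0. In each of them the mean is conserved, and z = p - [p] decays in norm
   like e^(-lt) for every l < k, one level of regularity after the other.

   The L^2 norm of z satisfies an exact balance and the Hamiltonian gives the
   H^1 norm with some exponential rate, so z tends to 0 uniformly. As solutions
   need not be regular enough to differentiate the equation in time, consider
   the increment w = z(t + h) - z(t), which solves the linearised equation with
   coefficient q = (z(t + h) + z(t)) / 2. The functional
   \int w^2 - (2c / 3d) \int q W^2, with W_x = w (here c is half of the coefficient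
   above), decays at the rate 2k - o(1), uniformly in h; after division by h^2
   and h -> 0, so does the L^2 norm of z', and the equation bounds the H^3 norm
   of z. From there on the coefficients of the linearised equation are small
   together with the derivatives that matter, and the energy of the n-th
   derivative of w gives z' in H^n and then z in H^(n+3), up to n = s - 3. *)
Require Import Defs.
From HB Require Import structures.
From mathcomp Require Import all_boot all_order all_algebra.
From mathcomp Require Import all_classical all_reals all_analysis.
From mathcomp Require Import measurable_realfun ring lra.
Set Implicit Arguments.
Unset Strict Implicit.
Unset Printing Implicit Defensive.
Import Order.TTheory GRing.Theory Num.Theory.
Import numFieldNormedType.Exports.
Local Open Scope classical_set_scope.
Local Open Scope ring_scope.

(** * Square-integrable functions on ]0, 1[ *)

(** For [s = 3] the derivative z' lies only in L^2, whereas the increments of z keep the full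
    regularity of z; this is what makes their energies accessible. With q the average of the two
    values of z, the difference of the squares is exactly 2 q w, so the equation of w has no
    remainder.

    A poor rate for the H^1 norm is harmless: only the smallness of sup |z| is drawn from it. The
    final rate comes from the damping in the equation of w, all other terms being small multiples of
    the same L^2 norm. The resulting loss in the rate is permitted by the strict inequality k' < k,
    whose slack also turns a bound into a little-o.

    Every integration by parts has one shape ([Int_total]): an integrand equals another one plus the
    derivative of an explicit periodic function, so that each energy identity reduces to an
    algebraic identity almost everywhere. *)

Section L2_theory.
Variable R : realType.
Implicit Types (f g h F G : R -> R).

Local Notation mu := (@lebesgue_measure R).
Local Notation I := (`]0, 1[%classic : set R).
Local Notation Int f := (Rintegral mu I f).

Definition intg f := mu.-integrable I (EFin \o f).

Lemma mI : measurable (I : set (measurableTypeR R)). Proof. exact: measurable_itv. Qed.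

Lemma muI : mu I = 1%E.
Proof. by rewrite lebesgue_measure_itv/= lte_fin ltr01 oppr0 adde0. Qed.

Lemma muI_fin : (mu I < +oo)%E. Proof. by rewrite muI ltry. Qed.

Lemma in_I x : I x -> 0 < x /\ x < 1.
Proof. by rewrite /= in_itv/= => /andP. Qed.

Lemma intg_measurable f : intg f -> measurable_fun I f.
Proof. by move=> /integrableP[/measurable_EFinP]. Qed.

Lemma intg_ext f g : (forall x, I x -> f x = g x) -> intg f -> intg g.
Proof.
move=> fg; apply: eq_integrable; first exact: mI.
by move=> x /set_mem Ix /=; rewrite fg.
Qed.

Lemma intg_dom f g : measurable_fun I f -> intg g ->
  (forall x, I x -> `|f x| <= g x) -> intg f.
Proof.
move=> mf ig fg; apply: (@le_integrable _ _ _ mu I mI (EFin \o f) _ _ _ ig).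
  exact/measurable_EFinP.
by move=> x Ix; rewrite /= lee_fin (le_trans (fg x Ix))// ler_norm.
Qed.

Lemma intgD f g : intg f -> intg g -> intg (fun x => f x + g x).
Proof. by move=> i j; have := integrableD mI i j. Qed.

Lemma intgN f : intg f -> intg (fun x => - f x).
Proof. by move=> i; have := integrableN i. Qed.

Lemma intgB f g : intg f -> intg g -> intg (fun x => f x - g x).
Proof. by move=> i j; apply: intgD => //; exact: intgN. Qed.

Lemma intgZ (c : R) f : intg f -> intg (fun x => c * f x).
Proof. by move=> i; have := integrableZl mI c i. Qed.

Lemma intg_bounded f (M : R) : measurable_fun I f ->
  (forall x, I x -> `|f x| <= M) -> intg f.
Proof.
move=> mf fM; apply: measurable_bounded_integrable => //.
  exact: muI_fin.
exists M; split; first exact: num_real.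
by move=> y My x Ix /=; rewrite (le_trans (fM x Ix))// ltW.
Qed.

Lemma intg_cst (c : R) : intg (fun=> c).
Proof. by apply: (@intg_bounded _ `|c|) => //; exact: measurable_cst. Qed.

Lemma Int_ext f g : (forall x, I x -> f x = g x) -> Int f = Int g.
Proof. by move=> fg; apply: eq_Rintegral => x /set_mem; exact: fg. Qed.

Lemma IntD f g : intg f -> intg g ->
  Int (fun x => f x + g x) = Int f + Int g.
Proof. by move=> i j; rewrite RintegralD//; exact: mI. Qed.

Lemma IntZ (c : R) f : intg f -> Int (fun x => c * f x) = c * Int f.
Proof. by move=> i; rewrite RintegralZl//; exact: mI. Qed.

Lemma IntN f : intg f -> Int (fun x => - f x) = - Int f.
Proof.
by move=> i; rewrite -mulN1r -IntZ//; apply: Int_ext => x _; rewrite mulN1r.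
Qed.

Lemma IntB f g : intg f -> intg g ->
  Int (fun x => f x - g x) = Int f - Int g.
Proof. by move=> i j; rewrite IntD ?IntN//; exact: intgN. Qed.

Lemma Int_cst (c : R) : Int (fun=> c) = c.
Proof.
rewrite Rintegral_cst; last exact: mI.
by have /= -> := muI; rewrite mulr1.
Qed.

Lemma Int_le f g : intg f -> intg g -> (forall x, I x -> f x <= g x) ->
  Int f <= Int g.
Proof. by move=> i j fg; apply: le_Rintegral => //; exact: mI. Qed.

Lemma Int_ge0 f : (forall x, I x -> 0 <= f x) -> 0 <= Int f.
Proof. by move=> f0; apply: Rintegral_ge0. Qed.

Lemma Int_norm f : intg f -> `|Int f| <= Int (fun x => `|f x|).
Proof. by move=> i; apply: le_normr_Rintegral => //; exact: mI. Qed.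

#[local] Instance ae_filter : Filter (nbhs (almost_everywhere mu)).
Proof. exact: (ae_filter_ringOfSetsType mu). Qed.

Definition aeq f g := {ae mu, forall x, I x -> f x = g x}.

Lemma aeq_ext f g : (forall x, I x -> f x = g x) -> aeq f g.
Proof. by move=> fg; apply: aeW => x; exact: fg. Qed.

Lemma aeq_sym f g : aeq f g -> aeq g f.
Proof. by apply: filterS => x fg Ix; rewrite fg. Qed.

Lemma aeq_comp (op : R -> R) f g :
  aeq f g -> aeq (fun x => op (f x)) (fun x => op (g x)).
Proof. by apply: filterS => x + Ix => ->. Qed.

Lemma aeq_comp2 (op : R -> R -> R) f g f' g' : aeq f f' -> aeq g g' ->
  aeq (fun x => op (f x) (g x)) (fun x => op (f' x) (g' x)).
Proof. by apply: filterS2 => x + + Ix => -> // ->. Qed.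

Lemma Int_aeq f g : measurable_fun I f -> measurable_fun I g ->
  aeq f g -> Int f = Int g.
Proof.
move=> mf mg fg; congr fine; apply: ae_eq_integral; first exact: mI.
- exact/measurable_EFinP.
- exact/measurable_EFinP.
- by apply: filterS fg => x + Ix => ->.
Qed.

(** The interval has length one, so this is the nonnegativity of the variance of [f]. *)
Lemma sqr_Int_le f : intg f -> intg (fun x => f x ^+ 2) ->
  Int f ^+ 2 <= Int (fun x => f x ^+ 2).
Proof.
move=> i i2; set m := Int f.
have : 0 <= Int (fun x => (f x ^+ 2 - (2 * m) * f x) + m ^+ 2).
  apply: Int_ge0 => x _.
  suff -> : f x ^+ 2 - 2 * m * f x + m ^+ 2 = (f x - m) ^+ 2 by exact: sqr_ge0.
  by ring.
rewrite IntD; [|by apply: intgB => //; exact: intgZ|exact: intg_cst].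
by rewrite IntB//; [rewrite IntZ// Int_cst -/m; lra|exact: intgZ].
Qed.

Lemma L2_measurable f : L2 f -> measurable_fun I f. Proof. by case. Qed.

Lemma L2_sqr f : L2 f -> intg (fun x => f x ^+ 2). Proof. by case. Qed.

Lemma L2_intgM f g : L2 f -> L2 g -> intg (fun x => f x * g x).
Proof.
move=> [mf f2] [mg g2]; apply: (@intg_dom _ (fun x => f x ^+ 2 + g x ^+ 2)).
- exact: measurable_funM.
- exact: intgD.
- move=> x _; rewrite normrM -(real_normK (num_real (f x))).
  rewrite -(real_normK (num_real (g x))).
  by have := sqr_ge0 (`|f x| - `|g x|); have := sqr_ge0 (`|f x| + `|g x|); nra.
Qed.

Lemma L2_bounded f (M : R) : measurable_fun I f ->
  (forall x, I x -> `|f x| <= M) -> L2 f.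
Proof.
move=> mf fM; split => //; apply: (@intg_bounded _ (M ^+ 2)).
  exact: measurable_funX.
by move=> x Ix; rewrite normrX lerXn2r ?nnegrE ?fM// (le_trans _ (fM x Ix)).
Qed.

Lemma L2_cst (c : R) : L2 (fun=> c).
Proof. by apply: (@L2_bounded _ `|c|) => //; exact: measurable_cst. Qed.

Lemma L2_intg f : L2 f -> intg f.
Proof.
move=> hf; have := L2_intgM hf (L2_cst 1).
by apply: intg_ext => x _; rewrite mulr1.
Qed.

Lemma L2_ext f g : (forall x, I x -> f x = g x) -> L2 f -> L2 g.
Proof.
move=> fg [mf f2]; split; last by apply: intg_ext f2 => x Ix; rewrite fg.
by apply: eq_measurable_fun mf => x /set_mem; exact: fg.
Qed.

Lemma L2D f g : L2 f -> L2 g -> L2 (fun x => f x + g x).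
Proof.
move=> hf hg; split; first by apply: measurable_funD; [case: hf|case: hg].
have := intgD (intgD (L2_sqr hf) (L2_sqr hg)) (intgZ 2 (L2_intgM hf hg)).
by apply: intg_ext => x _; ring.
Qed.

Lemma L2Z (c : R) f : L2 f -> L2 (fun x => c * f x).
Proof.
move=> hf; split; first by apply: measurable_funM => //; case: hf.
have := intgZ (c ^+ 2) (L2_sqr hf).
by apply: intg_ext => x _; ring.
Qed.

Lemma L2N f : L2 f -> L2 (fun x => - f x).
Proof. by move=> /(L2Z (-1)); apply: L2_ext => x _; rewrite mulN1r. Qed.

Lemma L2B f g : L2 f -> L2 g -> L2 (fun x => f x - g x).
Proof. by move=> hf hg; apply: L2D => //; exact: L2N. Qed.

Lemma L2_boundedM f g (M : R) : measurable_fun I f ->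
  (forall x, I x -> `|f x| <= M) -> L2 g -> L2 (fun x => f x * g x).
Proof.
move=> mf fM hg; split; first by apply: measurable_funM => //; case: hg.
apply: (@intg_dom _ (fun x => M ^+ 2 * g x ^+ 2)).
- by apply: measurable_funX; apply: measurable_funM => //; case: hg.
- by apply: intgZ; exact: L2_sqr.
- move=> x Ix; rewrite ger0_norm ?sqr_ge0// exprMn ler_wpM2r ?sqr_ge0//.
  rewrite -(real_normK (num_real (f x))) lerXn2r ?nnegrE ?fM//.
  by rewrite (le_trans _ (fM x Ix)).
Qed.

(** The cut is in the integrand, not in the domain: all integrals run over the same interval, and
    linearity, monotonicity and Fubini apply without a change of domain. *)
Definition prim F (x : R) := Int (fun y => (y < x)%R%:R * F y).

Lemma measurable_ltx (x : R) : measurable_fun I (fun y : R => (y < x)%R%:R : R).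
Proof.
apply/measurable_funTS.
rewrite (_ : (fun _ => _) = \1_(`]-oo, x[ : set R)); first exact: measurable_indic.
by apply/funext => y; rewrite indicE mem_setE/= in_itv.
Qed.

Lemma normr_bool (b : bool) : `|b%:R| <= 1 :> R.
Proof. by case: b; rewrite ?normr1// normr0. Qed.

Lemma intg_cut (x : R) F : intg F -> intg (fun y => (y < x)%R%:R * F y).
Proof.
move=> iF; have iFn : intg (fun y => `|F y|) by have := integrable_norm iF.
apply: (intg_dom _ iFn).
  by apply: measurable_funM; [exact: measurable_ltx|exact: intg_measurable].
by move=> y _; rewrite normrM ler_piMl// normr_bool.
Qed.

Lemma prim0 F : prim F 0 = 0.
Proof.
rewrite /prim -[RHS]Int_cst; apply: Int_ext => y /in_I[y0 _].
by rewrite (lt_gtF y0) mul0r.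
Qed.

Lemma prim1 F : prim F 1 = Int F.
Proof. by apply: Int_ext => y /in_I[_ y1]; rewrite y1 mul1r. Qed.

Lemma primD F G x : intg F -> intg G ->
  prim (fun y => F y + G y) x = prim F x + prim G x.
Proof.
move=> iF iG; rewrite -IntD; [|exact: intg_cut..].
by apply: Int_ext => y _; rewrite mulrDr.
Qed.

Lemma primZ (c : R) F x : intg F ->
  prim (fun y => c * F y) x = c * prim F x.
Proof.
move=> iF; rewrite -IntZ; last exact: intg_cut.
by apply: Int_ext => y _; rewrite mulrCA.
Qed.

Lemma prim_aeq F G x : measurable_fun I F -> measurable_fun I G ->
  aeq F G -> prim F x = prim G x.
Proof.
move=> mF mG FG; apply: Int_aeq.
- by apply: measurable_funM => //; exact: measurable_ltx.
- by apply: measurable_funM => //; exact: measurable_ltx.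
- by apply: filterS FG => y + Iy => ->.
Qed.

Lemma Int_itv (x y : R) : 0 <= x -> x <= y -> y <= 1 ->
  Int (fun z => (z < y)%R%:R - (z < x)%R%:R) = y - x.
Proof.
move=> x0 xy y1.
have Elt t : 0 <= t -> t <= 1 -> Int (fun z => (z < t)%R%:R) = t.
  move=> t0 t1.
  have -> : Int (fun z => (z < t)%R%:R) = \int[mu]_(z in I) (\1_(`]0, t[ : set R) z).
    apply: Int_ext => z /in_I[z0 z1]; rewrite indicE mem_setE/= in_itv/= z0//.
  rewrite /Rintegral integral_indic//=.
  rewrite (_ : _ `&` _ = (`]0, t[%classic : set R)).
    rewrite lebesgue_measure_itv/= lte_fin.
    case: ltP => [_|]; first by rewrite /= oppr0 addr0.
    by move=> t0'; apply/esym/eqP; rewrite eq_le t0 t0'.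
  apply/seteqP; split => z /=; first by case.
  move=> zt; split => //; move: zt; rewrite !in_itv/= => /andP[-> zt].
  exact: lt_le_trans t1.
have i t : intg (fun z => (z < t)%R%:R).
  by apply: (@intg_bounded _ 1); [exact: measurable_ltx|move=> ? _; exact: normr_bool].
have y0 := le_trans x0 xy; have x1 := le_trans xy y1.
by rewrite IntB// !Elt.
Qed.

(** The difference is the integral of [F] against a function with values in -1, 0, 1, and
    [sqr_Int_le] applies. The bound does not shrink with [x - y]; it serves the sup and Poincare
    estimates. *)
Lemma prim_diff_le F x y : L2 F -> (prim F x - prim F y) ^+ 2 <= Int (fun z => F z ^+ 2).
Proof.
move=> hF; have iF := L2_intg hF; rewrite -IntB; [|exact: intg_cut..].
set h := (fun z : R => (z < x)%R%:R * F z - (z < y)%R%:R * F z).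
have m b : measurable_fun I (fun z => (z < b)%R%:R * F z).
  by apply: measurable_funM; [exact: measurable_ltx|case: hF].
have hle z : h z ^+ 2 <= F z ^+ 2.
  rewrite /h; case: (z < x)%R; case: (z < y)%R;
    by rewrite ?mul0r ?mul1r ?subrr ?subr0 ?sub0r ?sqrrN ?expr0n//= ?sqr_ge0.
have ih2 : intg (fun z => h z ^+ 2).
  apply: (intg_dom _ (L2_sqr hF)).
    by apply: measurable_funX; apply: measurable_funB; exact: m.
  by move=> z _; rewrite ger0_norm ?sqr_ge0.
apply: (@le_trans _ _ (Int (fun z => h z ^+ 2))).
  by apply: sqr_Int_le => //; apply: intgB; exact: intg_cut.
by apply: Int_le => //; exact: L2_sqr.
Qed.

(* Elementary Cauchy-Schwarz: |1_A F| <= l 1_A / 2 + F^2 / (2 l). *)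
Lemma prim_modulus F x y l : L2 F -> 0 <= x -> x <= y -> y <= 1 -> 0 < l ->
  `|prim F y - prim F x| <= l * (y - x) + l^-1 * Int (fun z => F z ^+ 2).
Proof.
move=> hF x0 xy y1 l0; have iF := L2_intg hF.
rewrite -IntB; [|exact: intg_cut..].
set A := (fun z : R => (z < y)%R%:R - (z < x)%R%:R : R).
have iA : intg A.
  by apply: intgB; apply: (@intg_bounded _ 1);
    [exact: measurable_ltx|move=> ? _; exact: normr_bool
    |exact: measurable_ltx|move=> ? _; exact: normr_bool].
have iAF := intgB (intg_cut y iF) (intg_cut x iF).
apply: (le_trans (Int_norm iAF)).
rewrite -(Int_itv x0 xy y1) -/A -IntZ// -IntZ; last exact: L2_sqr.
rewrite -IntD; [|exact: intgZ|by apply: intgZ; exact: L2_sqr].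
apply: Int_le.
- by have := integrable_norm iAF.
- by apply: intgD; [exact: intgZ|by apply: intgZ; exact: L2_sqr].
- move=> z _; rewrite -mulrBl normrM -/(A z).
  have [-> | ->] : A z = 0 \/ A z = 1.
    rewrite /A; case: (ltP z x) => zx.
      by rewrite (lt_le_trans zx xy) subrr; left.
    by case: (z < y)%R; rewrite subr0; [right|left].
    rewrite normr0 mul0r mulr0 add0r mulr_ge0 ?invr_ge0 ?sqr_ge0//; exact: ltW.
  rewrite normr1 mul1r mulr1 -(real_normK (num_real (F z))).
  have := normr_ge0 (F z); set n := `|F z| => n0.
  rewrite -(ler_pM2l l0) mulrDr mulrA divff ?gt_eqF// mul1r.
  by have := sqr_ge0 (n - l); have := sqr_ge0 (n + l); nra.
Qed.

End L2_theory.

(** * Absolutely continuous functions *)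

Section AC_theory.
Variable R : realType.
Implicit Types (f g h F G : R -> R).

Local Notation mu := (@lebesgue_measure R).
Local Notation I := (`]0, 1[%classic : set R).
Local Notation Int f := (Rintegral mu I f).

#[local] Existing Instance ae_filter.

Let mI := @mI R.

Lemma measurable_b2R d (T : measurableType d) (b : T -> bool) :
  measurable_fun setT b -> measurable_fun setT (fun z => (b z)%:R : R).
Proof.
move=> mb; rewrite (_ : (fun _ => _) = \1_[set z | b z]).
  apply: measurable_indic; have := mb measurableT [set true] Logic.I.
  by rewrite setTI; congr (measurable _); apply/seteqP; split.
by apply/funext => z; rewrite indicE mem_setE.
Qed.

Let EFin_restrict f : (fun x => (f x)%:E) \_ I = (fun x => ((f \_ I) x)%:E).
Proof. by apply/funext => x; rewrite /patch; case: ifP. Qed.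

Let IntE f : intg f -> (Int f)%:E = (\int[mu]_(x in I) (f x)%:E)%E.
Proof. by move=> i; rewrite fineK//; exact: integrable_fin_num. Qed.

Let measurable_patchI f : measurable_fun I f -> measurable_fun setT (f \_ I).
Proof. by move=> mf; apply/(measurable_restrictT _ _).1 => //; exact: mI. Qed.

(** The kernel [K] carries the shape of the domain: [primM] takes the indicator of a triangle.
    Extending [F] and [G] by zero reduces the claim to Fubini on the plane. *)
Lemma Int_Fubini (K : R -> R -> R) F G : intg F -> intg G ->
  measurable_fun setT (fun z : R * R => K z.1 z.2) ->
  (forall y z, `|K y z| <= 1) ->
  Int (fun y => Int (fun z => K y z * (F y * G z))) =
  Int (fun z => Int (fun y => K y z * (F y * G z))).
Proof.
move=> iF iG mK K1.
pose F' := F \_ I; pose G' := G \_ I.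
have mF' : measurable_fun setT F' by apply: measurable_patchI; exact: intg_measurable.
have mG' : measurable_fun setT G' by apply: measurable_patchI; exact: intg_measurable.
pose phi (p : R * R) := (K p.1 p.2 * (F' p.1 * G' p.2))%:E.
have mphi : measurable_fun setT phi.
  apply/measurable_EFinP; apply: measurable_funM => //; apply: measurable_funM.
    by apply: measurableT_comp => //; exact: measurable_fst.
  by apply: measurableT_comp => //; exact: measurable_snd.
have iFn : mu.-integrable setT (fun y => `|F' y|%:E).
  have : mu.-integrable I (EFin \o F) by [].
  move/(integrable_mkcond _ mI); rewrite EFin_restrict.
  by move/integrable_abse; apply: eq_integrable.
have iGn : mu.-integrable setT (fun y => `|G' y|%:E).
  have : mu.-integrable I (EFin \o G) by [].
  move/(integrable_mkcond _ mI); rewrite EFin_restrict.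
  by move/integrable_abse; apply: eq_integrable.
have iphi : ((mu \x mu).-integrable setT phi)%E.
  apply/integrable12ltyP => //.
  apply: (@le_lt_trans _ _ (\int[mu]_x (`|F' x|%:E * \int[mu]_y (`|G' y|%:E)))%E).
    apply: ge0_le_integral => //.
    - by move=> x _; apply: integral_ge0.
    - have mn : measurable_fun setT (abse \o phi) by exact: measurableT_comp.
      exact: (@measurable_fun_fubini_tonelli_F _ _ _ _ R mu _ mn (fun _ => abse_ge0 _)).
    - apply: emeasurable_funM => //; apply/measurable_EFinP.
      exact: measurableT_comp.
    - move=> x _; rewrite -ge0_integralZl//; last first.
        by apply/measurable_EFinP; exact: measurableT_comp.
      apply: ge0_le_integral => //.
      + apply: measurableT_comp => //.
        by apply: measurableT_comp => //; exact: measurable_pair1.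
      + apply: emeasurable_funM => //; apply/measurable_EFinP.
        exact: measurableT_comp.
      + move=> y _ /=; rewrite lee_fin -normrM [leLHS]normrM ler_piMl//.
  rewrite ge0_integralZr//; first last.
  - by apply: integral_ge0.
  - by apply/measurable_EFinP; exact: measurableT_comp.
  move: iFn iGn => /integrableP[_ iFn] /integrableP[_ iGn].
  rewrite lte_mul_pinfty//.
  - exact: integral_ge0.
  - rewrite ge0_fin_numE; last exact: integral_ge0.
    by under eq_integral do rewrite -[`|_|]normr_id.
  - by under eq_integral do rewrite -[`|_|]normr_id.
have mK1 y : measurable_fun I (fun z => K y z).
  by apply/measurable_funTS; have := measurableT_comp mK (measurable_pair1 y).
have mK2 z : measurable_fun I (fun y => K y z).
  by apply/measurable_funTS; have := measurableT_comp mK (measurable_pair2 z).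
have := Fubini iphi.
have E1 y : (\int[mu]_z phi (y, z))%E =
    (((fun y => (Int (fun z => K y z * (F y * G z)))%:E) \_ I) y).
  rewrite {1}/patch; case: ifPn => yI; last first.
    rewrite -[RHS](integral0 mu setT); apply: eq_integral => z _.
    by rewrite /phi/= /F' patchE (negbTE yI) mul0r mulr0.
  rewrite IntE.
    rewrite [RHS]integral_mkcond; apply: eq_integral => z _.
    rewrite /phi/= /F' /G' !patchE yI; case: ifP => //.
    by rewrite !mulr0.
  apply: (@intg_dom _ _ (fun z => `|F y * G z|)).
  - apply: measurable_funM; first exact: mK1.
    by apply: measurable_funM => //; exact: intg_measurable.
  - by have := integrable_norm (intgZ (F y) iG).
  - by move=> z _; rewrite normrM ler_piMl.
have E2 z : (\int[mu]_y phi (y, z))%E =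
    (((fun z => (Int (fun y => K y z * (F y * G z)))%:E) \_ I) z).
  rewrite {1}/patch; case: ifPn => yI; last first.
    rewrite -[RHS](integral0 mu setT); apply: eq_integral => y _.
    by rewrite /phi/= /G' !patchE (negbTE yI) !mulr0.
  rewrite IntE.
    rewrite [RHS]integral_mkcond; apply: eq_integral => y _.
    rewrite /phi/= /F' /G' !patchE yI; case: ifP => //.
    by rewrite mul0r mulr0.
  apply: (@intg_dom _ _ (fun y => `|G z * F y|)).
  - apply: measurable_funM; first exact: mK2.
    by apply: measurable_funM => //; exact: intg_measurable.
  - by have := integrable_norm (intgZ (G z) iF).
  - by move=> y _; rewrite [F y * _]mulrC [leLHS]normrM ler_piMl.
under eq_integral do rewrite E1.
under [in X in _ = X -> _]eq_integral do rewrite E2.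
by rewrite -!integral_mkcond /Rintegral => ->.
Qed.

Lemma aeq_neq (a : R) : {ae mu, forall x, I x -> x <> a}.
Proof.
exists [set a]; split; first exact: measurable_set1.
  exact: lebesgue_measure_set1.
by move=> x /= xa; apply: contrapT => xna; exact: xa.
Qed.

Lemma prim_ucont F : L2 F -> forall e, 0 < e -> exists2 d, 0 < d &
  forall x y, 0 <= x <= 1 -> 0 <= y <= 1 -> `|x - y| < d ->
  `|prim F x - prim F y| < e.
Proof.
move=> hF e e0; set N := Int (fun z => F z ^+ 2).
have N0 : 0 <= N by apply: Int_ge0 => z _; exact: sqr_ge0.
(* With this [l] the term [l^-1 * N] of [prim_modulus] stays below [e / 2]; the added 1 keeps [l]
   positive when [F] vanishes. *)
pose l := 2 * (N + 1) / e.
have l0 : 0 < l by rewrite divr_gt0// mulr_gt0// ltr_wpDl.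
exists (e / 2 / l); first by rewrite divr_gt0// divr_gt0.
have le x y : 0 <= x -> x <= y -> y <= 1 -> `|x - y| < e / 2 / l ->
    `|prim F y - prim F x| < e.
  move=> x0 xy y1 d1; have d : l * (y - x) < e / 2.
    by move: d1; rewrite distrC ger0_norm ?subr_ge0// ltr_pdivlMr// mulrC.
  apply: (le_lt_trans (prim_modulus hF x0 xy y1 l0)).
  rewrite [ltRHS](splitr e); apply: ltr_leD; first exact: d.
  rewrite -/N mulrC ler_pdivrMr//.
  by have -> : e / 2 * l = N + 1; [rewrite /l; field; rewrite gt_eqF|rewrite lerDl].
move=> x y /andP[x0 x1] /andP[y0 y1] d.
case: (leP x y) => xy; first by rewrite distrC; exact: le.
by apply: le => //; [exact: ltW|rewrite distrC].
Qed.

Lemma prim_continuous F x : L2 F -> I x -> {for x, continuous (prim F)}.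
Proof.
move=> hF /in_I[x0 x1]; apply/cvgrPdist_lt => e e0.
have [d d0 H] := prim_ucont hF e0.
near=> y; apply: H.
- by rewrite !ltW.
- apply/andP; split; apply: ltW; near: y; [exact: lt_nbhsr|exact: lt_nbhsl].
- by near: y; exact: (@cvgr_dist_lt _ _ _ _ _ id x (@cvg_id _ _) d d0).
Unshelve. all: by end_near. Qed.

Lemma measurable_prim F : L2 F -> measurable_fun I (prim F).
Proof.
move=> hF; apply: open_continuous_measurable_fun => //. by move=> x /set_mem Ix; exact: prim_continuous.
Qed.

Lemma prim_bound F x : L2 F -> `|prim F x| <= Int (fun y => `|F y|).
Proof.
move=> hF; have iF := L2_intg hF; apply: (le_trans (Int_norm (intg_cut x iF))).
apply: Int_le; [by have := integrable_norm (intg_cut x iF)|by have := integrable_norm iF|].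
by move=> y _; rewrite normrM ler_piMl// normr_bool.
Qed.

(** Integration by parts for primitives: the square below [x] is cut along its diagonal, each
    triangle gives one of the two terms, and Fubini exchanges the order of integration in one of
    them. *)
Lemma primM F G x : L2 F -> L2 G ->
  prim F x * prim G x = prim (fun y => F y * prim G y + prim F y * G y) x.
Proof.
move=> hF hG; have iF := L2_intg hF; have iG := L2_intg hG.
have iFx := intg_cut x iF; have iGx := intg_cut x iG.
have iFP : intg (fun y => F y * prim G y).
  apply: L2_intg; apply: L2_ext (L2_boundedM (measurable_prim hG) (fun y _ => prim_bound y hG) hF).
  by move=> y _; rewrite mulrC.
have iPG : intg (fun y => prim F y * G y).
  by apply: L2_intg; exact: (L2_boundedM (measurable_prim hF) (fun y _ => prim_bound y hF) hG).
rewrite primD//.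
set Fx := fun y => (y < x)%R%:R * F y.
set Gx := fun y => (y < x)%R%:R * G y.
have E1 y : (y < x)%R%:R * (F y * prim G y) =
    Int (fun z => (z < y)%R%:R * (Fx y * Gx z)).
  rewrite /Fx; case: ltP => yx; last first.
    rewrite !mul0r -[LHS]Int_cst; by apply: Int_ext => z _; rewrite !(mul0r, mulr0).
  rewrite mul1r -IntZ; last exact: intg_cut.
  apply: Int_ext => z _; rewrite mul1r /Gx; case: ltP => zy; last by rewrite !mul0r mulr0.
  by rewrite (lt_trans zy yx) !mul1r.
rewrite [X in _ = X + _](Int_ext (fun y _ => E1 y)).
have -> : prim (fun z => prim F z * G z) x =
    Int (fun z => Int (fun y => (y < z)%R%:R * (Fx y * Gx z))).
  apply: Int_ext => z _; rewrite /Gx; case: ltP => zx; last first.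
    rewrite !mul0r -[LHS]Int_cst; by apply: Int_ext => y _; rewrite !(mul0r, mulr0).
  rewrite mul1r mulrC -IntZ; last exact: intg_cut.
  apply: Int_ext => y _; rewrite mul1r /Fx; case: ltP => yz; last by rewrite !mul0r mulr0.
  by rewrite (lt_trans yz zx) !mul1r mulrC.
rewrite -(@Int_Fubini (fun y z => (y < z)%R%:R)) => //; last 2 first.
- have : measurable_fun [set: R * R] (fun z : R * R => (z.1 < z.2)%R).
    by apply: measurable_fun_ltr; [exact: measurable_fst|exact: measurable_snd].
  exact: measurable_b2R.
- by move=> y z; exact: normr_bool.
have ib (b : R -> bool) y : measurable_fun I (fun z => (b z)%:R : R) ->
    intg (fun z => (b z)%:R * (Fx y * Gx z)).
  move=> mb; apply: (@intg_dom _ _ (fun z => `|Fx y * Gx z|)).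
  - by apply: measurable_funM => //; apply: intg_measurable; exact: intgZ.
  - by have := integrable_norm (intgZ (Fx y) iGx).
  - by move=> z _; rewrite normrM ler_piMl// normr_bool.
have mgt y : measurable_fun I (fun z : R => (y < z)%R%:R : R).
  apply/measurable_funTS.
  rewrite (_ : (fun _ => _) = \1_(`]y, +oo[ : set R)); first exact: measurable_indic.
  by apply/funext => z; rewrite indicE mem_setE/= in_itv/= andbT.
have -> : prim F x * prim G x = Int (fun y => Fx y * prim G x).
  rewrite mulrC -IntZ//; apply: Int_ext => y _; by rewrite mulrC.
have key y : Fx y * prim G x = Int (fun z => (z < y)%R%:R * (Fx y * Gx z)) +
    Int (fun z => (y < z)%R%:R * (Fx y * Gx z)).
  rewrite -IntD; [|exact: (ib (fun z => z < y)%R y (measurable_ltx y))|exact: (ib (fun z => y < z)%R y (mgt y))].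
  rewrite -IntZ//; apply: Int_aeq.
  - by apply: intg_measurable; exact: intgZ.
  - by apply: intg_measurable; apply: intgD; [exact: (ib (fun z => z < y)%R y (measurable_ltx y))|exact: (ib (fun z => y < z)%R y (mgt y))].
  (* The two triangles miss only the diagonal point [z = y], which is null. *)
  - apply: filterS (aeq_neq y) => z + Iz => /(_ Iz) /eqP zy.
    rewrite -mulrDl.
    have -> : (z < y)%R%:R + (y < z)%R%:R = 1 :> R; last by rewrite mul1r.
    by case: ltgtP zy; rewrite ?addr0 ?add0r.
have i1 : intg (fun y => Int (fun z => (z < y)%R%:R * (Fx y * Gx z))).
  by apply: intg_ext (intg_cut x iFP) => y _; exact: E1.
rewrite (Int_ext (fun y _ => key y)) IntD//.
apply: intg_ext (intgB (intgZ (prim G x) iFx) i1) => y _.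
by rewrite mulrC key addrC addKr.
Qed.

(** Membership in H^1(0,1) with the continuous representative chosen: [f] is fixed at every point of
    [0, 1], endpoints included, [F] only almost everywhere. *)
Definition ac f F := L2 F /\ forall x, 0 <= x <= 1 -> f x = f 0 + prim F x.

Let in_I' x : I x -> 0 <= x <= 1.
Proof. by move=> /in_I[x0 x1]; rewrite !ltW. Qed.

Lemma ac_bounded f F : ac f F ->
  exists M, forall x, 0 <= x <= 1 -> `|f x| <= M.
Proof.
move=> [hF fE]; exists (`|f 0| + Int (fun y => `|F y|)) => x x01.
by rewrite fE// (le_trans (ler_normD _ _))// lerD2l prim_bound.
Qed.

Lemma ac_measurable f F : ac f F -> measurable_fun I f.
Proof.
move=> [hF fE]; apply: (@eq_measurable_fun _ _ _ _ _ (fun x => f 0 + prim F x)).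
  by move=> x /set_mem Ix; rewrite [RHS]fE// in_I'.
by apply: measurable_funD => //; exact: measurable_prim.
Qed.

Lemma ac_L2 f F : ac f F -> L2 f.
Proof.
move=> h; have [M fM] := ac_bounded h; apply: (@L2_bounded _ _ M).
  exact: ac_measurable h.
by move=> x Ix; rewrite fM// in_I'.
Qed.

Lemma ac_L2M f F g : ac f F -> L2 g -> L2 (fun x => f x * g x).
Proof.
move=> h hg; have [M fM] := ac_bounded h.
by apply: (L2_boundedM (ac_measurable h) (M := M)) => // x Ix; rewrite fM// in_I'.
Qed.

Lemma ac_cst (c : R) : ac (fun=> c) (fun=> 0).
Proof.
split; first exact: L2_cst.
move=> x _; rewrite /prim -[LHS]addr0; congr (_ + _).
by rewrite -[LHS]Int_cst; apply: Int_ext => y _; rewrite mulr0.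
Qed.

Lemma acD f F g G : ac f F -> ac g G ->
  ac (fun x => f x + g x) (fun x => F x + G x).
Proof.
move=> [hF fE] [hG gE]; split; first exact: L2D.
move=> x x01; rewrite primD; [|exact: L2_intg..].
by rewrite fE// gE// addrACA.
Qed.

Lemma acZ (c : R) f F : ac f F -> ac (fun x => c * f x) (fun x => c * F x).
Proof.
move=> [hF fE]; split; first exact: L2Z.
by move=> x x01; rewrite primZ; [rewrite (fE x)// mulrDr|exact: L2_intg].
Qed.

(** Expanding [f] and [g] around their values at 0 leaves the product of two primitives, which is
    [primM]. *)
Lemma acM f F g G : ac f F -> ac g G ->
  ac (fun x => f x * g x) (fun x => F x * g x + f x * G x).
Proof.
move=> hf hg; have [hF fE] := hf; have [hG gE] := hg.
have hFg : L2 (fun x => F x * g x).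
  by apply: L2_ext (ac_L2M hg hF) => x _; rewrite mulrC.
have hfG := ac_L2M hf hG.
split; first exact: L2D.
move=> x x01; rewrite (fE x)// (gE x)//.
rewrite primD; [|exact: L2_intg..].
have -> : prim (fun y => F y * g y) x = g 0 * prim F x + prim (fun y => F y * prim G y) x.
  rewrite -primZ; last exact: L2_intg.
  rewrite -primD; first last.
  - apply: L2_intg; apply: L2_ext (L2_boundedM (measurable_prim hG) (fun y _ => prim_bound y hG) hF).
    by move=> y _; rewrite mulrC.
  - by apply: L2_intg; exact: L2Z.
  apply: Int_ext => y Iy; rewrite (gE y) ?in_I'//; ring.
have -> : prim (fun y => f y * G y) x = f 0 * prim G x + prim (fun y => prim F y * G y) x.
  rewrite -primZ; last exact: L2_intg.
  rewrite -primD; first last.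
  - by apply: L2_intg; exact: (L2_boundedM (measurable_prim hF) (fun y _ => prim_bound y hF) hG).
  - by apply: L2_intg; exact: L2Z.
  apply: Int_ext => y Iy; rewrite (fE y) ?in_I'//; ring.
have := primM x hF hG; rewrite primD; first last.
- by apply: L2_intg; exact: (L2_boundedM (measurable_prim hF) (fun y _ => prim_bound y hF) hG).
- apply: L2_intg; apply: L2_ext (L2_boundedM (measurable_prim hG) (fun y _ => prim_bound y hG) hF).
  by move=> y _; rewrite mulrC.
by move=> e; rewrite mulrDl !mulrDr e; ring.
Qed.

Lemma ac_osc f F x y : ac f F -> 0 <= x <= 1 -> 0 <= y <= 1 ->
  (f x - f y) ^+ 2 <= Int (fun z => F z ^+ 2).
Proof.
move=> [hF fE] x01 y01; rewrite fE// [f y]fE// opprD addrACA subrr add0r.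
exact: prim_diff_le.
Qed.

(** A function of mean zero is at [x] the average over [y] of [f x - f y], and [ac_osc] bounds each
    of these differences. *)
Lemma ac_sup f F x : ac f F -> Int f = 0 -> 0 <= x <= 1 ->
  f x ^+ 2 <= Int (fun z => F z ^+ 2).
Proof.
move=> h f0 x01; have if_ := L2_intg (ac_L2 h).
have hd : L2 (fun y => f x - f y) by apply: L2B; [exact: L2_cst|exact: ac_L2 h].
have {1}-> : f x = Int (fun y => f x - f y).
  by rewrite IntB ?f0 ?Int_cst ?subr0//; exact: intg_cst.
apply: (le_trans (sqr_Int_le (L2_intg hd) (L2_sqr hd))).
rewrite -[leRHS]Int_cst; apply: Int_le; [exact: L2_sqr|exact: intg_cst|].
by move=> y Iy; apply: ac_osc h _ _ => //; exact: in_I'.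
Qed.

Lemma ac_poincare f F : ac f F -> Int f = 0 ->
  Int (fun z => f z ^+ 2) <= Int (fun z => F z ^+ 2).
Proof.
move=> h f0; rewrite -[leRHS]Int_cst.
apply: Int_le; [exact: L2_sqr (ac_L2 h)|exact: intg_cst|].
by move=> y Iy; apply: ac_sup h _ _ => //; exact: in_I'.
Qed.

(** The part of ]0, 1[ within distance [d] of [x] has positive measure, even if [x] is an endpoint,
    so it is not contained in a null set. *)
Lemma aeq_dense (f g : R -> R) x d : aeq f g -> 0 <= x <= 1 -> 0 < d ->
  exists2 y, I y /\ `|x - y| < d & f y = g y.
Proof.
move=> [N [mN N0 NI]] /andP[x0 x1] d0.
pose a := Num.max 0 (x - d); pose b := Num.min 1 (x + d).
have ab : a < b by rewrite /a /b gt_max !lt_min; apply/andP; split; apply/andP; split; lra.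
apply: contrapT => H.
have sub : `]a, b[%classic `<=` N.
  move=> y; rewrite /= in_itv/= /a /b gt_max lt_min => /andP[/andP[y0 xy] /andP[y1 yx]].
  apply: NI => /= fg; apply: H; exists y; last by apply: fg; rewrite in_itv/= y0.
  split; first by rewrite /= in_itv/= y0.
  by rewrite ltr_norml; apply/andP; split; lra.
have : (mu (`]a, b[%classic : set R) <= mu N)%E.
  by apply: le_measure => //; rewrite inE//; exact: measurable_itv.
by move=> le; move: le; rewrite N0 lebesgue_measure_itv/= lte_fin ab -EFinB lee_fin subr_le0 leNgt ab.
Qed.

(** By Lebesgue differentiation [F] is almost everywhere the derivative of its primitive, here taken
    from minus infinity after extension by zero. *)
Lemma prim_eq0 F : intg F -> (forall x, 0 <= x <= 1 -> prim F x = 0) ->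
  aeq F (fun=> 0).
Proof.
move=> hF F0; pose f := F \_ I.
have iF : mu.-integrable I (EFin \o F) := hF.
have iT : mu.-integrable setT (EFin \o f).
  by move/(integrable_mkcond _ mI): iF; rewrite EFin_restrict.
have loc : locally_integrable [set: R] f.
  by apply: integrable_locally_restrict.
have iy y : mu.-integrable `]-oo, y] (EFin \o f).
  by apply: integrableS iT.
have E y : I y -> \int[mu]_(t in `]-oo, y]) f t = 0.
  move=> Iy; rewrite -[RHS](F0 y); last exact: in_I'.
  rewrite -Rintegral_itv_bndo_bndc; last by apply: integrableS iT.
  rewrite /prim [LHS]Rintegral_mkcond [RHS]Rintegral_mkcond.
  apply: eq_Rintegral => t _; rewrite !patchE /f patchE.
  rewrite mem_setE in_itv/=.
  by case: (t < y)%R; case: ifP; rewrite ?mul1r ?mul0r.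
have := FTC1Ny iy loc; apply: filterS => x + Ix => -[_].
rewrite {2}/f patchE mem_set// => <-; rewrite derive1E.
rewrite (@near_eq_derive _ _ _ _ (fun=> 0)) ?derive_cst//.
have : nbhs x I by apply: open_nbhs_nbhs; split => //; exact: itv_open.
by apply: filterS => y; exact: E.
Qed.

End AC_theory.

(** * Smooth functions *)

Section smooth_functions.
Variable R : realType.
Implicit Types (f g p q : R -> R) (P Q : {poly R}) (x a b c : R).

Definition smooth f := forall n x, derivable (derive1n n f) x 1.

Lemma is_deriveMf f g x a b : is_derive x (1 : R) f a -> is_derive x (1 : R) g b ->
  is_derive x (1 : R) (fun y => f y * g y) (a * g x + f x * b).
Proof.
move=> fa gb; have := is_deriveM fa gb; rewrite /GRing.scale/= => h.
by apply: is_derive_eq h _; rewrite addrC mulrC.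
Qed.

Lemma is_deriveDf f g x a b : is_derive x (1 : R) f a -> is_derive x (1 : R) g b ->
  is_derive x (1 : R) (fun y => f y + g y) (a + b).
Proof. by move=> fa gb; have := is_deriveD fa gb. Qed.

Lemma is_deriveZf (c : R) f x a : is_derive x (1 : R) f a ->
  is_derive x (1 : R) (fun y => c * f y) (c * a).
Proof. by move=> fa; have := is_deriveZ c fa. Qed.

(** Coinduction: a class of functions closed under differentiation consists of smooth functions. No
    formula for the higher derivatives is required. *)
Lemma smooth_coind (S : (R -> R) -> Prop) :
  (forall f, S f -> exists2 f', S f' & forall x : R, is_derive x (1 : R) f (f' x)) ->
  forall f, S f -> smooth f.
Proof.
move=> H f Sf n.
have [f' Sf' df'] : exists2 f', S f' & forall x : R, is_derive x (1 : R) (derive1n n f) (f' x).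
  elim: n => [|n [g Sg dg]]; first exact: H.
  have [g' Sg' dg'] := H _ Sg; exists g' => // x.
  suff -> : derive1n n.+1 f = g by exact: dg'.
  by apply/funext => y; rewrite derive1nS derive1E; exact: derive_val.
by move=> x; exact: ex_derive.
Qed.

Lemma smooth_derive f x : smooth f -> is_derive x (1 : R) f ((derive1 f) x).
Proof. by move=> /(_ 0 x) h; rewrite derive1E; exact: derivableP. Qed.

Lemma smooth_derive1 f : smooth f -> smooth (derive1 f).
Proof. by move=> h n x; have := h n.+1 x; rewrite /derive1n -iterSr. Qed.

Lemma smooth_cst (c : R) : smooth (fun=> c).
Proof.
apply: (@smooth_coind (fun f => exists c, f = fun=> c)); last by exists c.
by move=> _ [a ->]; exists (fun=> 0); [exists 0|move=> x; exact: is_derive_cst].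
Qed.

(** The algebra generated by the smooth functions. The product rule stays inside it, so
    [smooth_coind] shows that products are smooth without the Leibniz formula. *)
Inductive smooth_alg : (R -> R) -> Prop :=
| smooth_alg_base f : smooth f -> smooth_alg f
| smooth_algD f g : smooth_alg f -> smooth_alg g ->
    smooth_alg (fun x => f x + g x)
| smooth_algM f g : smooth_alg f -> smooth_alg g ->
    smooth_alg (fun x => f x * g x).

Lemma smooth_alg_smooth f : smooth_alg f -> smooth f.
Proof.
apply: smooth_coind => {}f; elim => {f}.
- move=> f sf; exists (derive1 f); first exact/smooth_alg_base/smooth_derive1.
  by move=> x; exact: smooth_derive.
- move=> f g _ [f' Sf' df] _ [g' Sg' dg].
  by exists (fun x => f' x + g' x); [exact: smooth_algD|move=> x; exact: is_deriveDf].
- move=> f g Sf [f' Sf' df] Sg [g' Sg' dg].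
  exists (fun x => f' x * g x + f x * g' x); last by move=> x; exact: is_deriveMf.
  by apply: smooth_algD; exact: smooth_algM.
Qed.

Lemma smoothM f g : smooth f -> smooth g -> smooth (fun x => f x * g x).
Proof.
by move=> sf sg; apply: smooth_alg_smooth; apply: smooth_algM; exact: smooth_alg_base.
Qed.

Lemma smoothD f g : smooth f -> smooth g -> smooth (fun x => f x + g x).
Proof.
by move=> sf sg; apply: smooth_alg_smooth; apply: smooth_algD; exact: smooth_alg_base.
Qed.

Lemma smooth_continuous f : smooth f -> continuous f.
Proof.
move=> sf x; apply: differentiable_continuous; apply/derivable1_diffP.
exact: (sf 0).
Qed.

(** The polynomial factor makes this family closed under differentiation; [P = 1] is the usual flat
    function. *)
Definition flat P (x : R) : R := if 0 < x then P.[x^-1] * expR (- x^-1) else 0.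

(** Induction on [P]: each factor [x^-1] costs one power of [x]. For a constant, exp(-1/x) is the
    n-th power of exp(-1/(n x)), which is at most n x because exp(y) >= y. *)
Lemma flat_bound P n : exists2 C, 0 <= C & forall x, 0 < x ->
  `|P.[x^-1] * expR (- x^-1)| <= C * x ^+ n.
Proof.
elim/poly_ind: P n => [|P c IH] n.
  by exists 0 => // x _; rewrite horner0 !mul0r normr0.
have [C C0 HC] := IH n.+1.
exists (C + `|c| * n%:R ^+ n); first by rewrite addr_ge0// mulr_ge0// exprn_ge0.
move=> x x0; rewrite hornerMXaddC mulrDl (le_trans (ler_normD _ _))// mulrDl.
apply: lerD.
  have xn : `|x^-1| = x^-1 by rewrite ger0_norm// invr_ge0 ltW.
  rewrite mulrAC normrM xn ler_pdivrMr//.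
  by rewrite -mulrA -exprSr; exact: HC.
rewrite normrM -mulrA ler_wpM2l// [leLHS]ger0_norm ?expR_ge0//.
rewrite -exprMn; case: n {IH HC} => [|n].
  by rewrite expr0 expR_le1 oppr_le0 invr_ge0 ltW.
have nx : 0 < n.+1%:R * x by rewrite mulr_gt0.
have -> : - x^-1 = n.+1%:R * - (n.+1%:R * x)^-1.
  by rewrite invfM mulrN mulrA divff ?mul1r// pnatr_eq0.
rewrite expRM_natl lerXn2r ?nnegrE ?expR_ge0 ?(ltW nx)//.
rewrite expRN -lef_pV2 ?posrE ?invr_gt0 ?expR_gt0// invrK.
by apply: le_trans (expR_ge1Dx _); rewrite lerDr.
Qed.

(** For [0 < x] this is the chain rule; at 0 the difference quotient is O(h) by [flat_bound] with
    exponent 2. *)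
Lemma flat_derive P x : is_derive x (1 : R) (flat P) (flat ((P - P^`()) * 'X^2) x).
Proof.
have [x0|x0|->] := ltgtP x 0.
- rewrite {2}/flat ltNge (ltW x0)/=.
  apply: (near_eq_is_derive (f := cst (0 : R))).
  by near=> y; rewrite /flat ltNge ltW//; near: y; exact: lt_nbhsl.
- rewrite {2}/flat x0.
  apply: (near_eq_is_derive (f := (fun y : R => P.[y^-1] * expR (- y^-1)) : R -> R)).
    by near=> y; rewrite /flat ifT//; near: y; exact: lt_nbhsr.
  have dV : is_derive x (1 : R) (fun y : R => y^-1) (- x ^- 2).
    have xn0 : id x != 0 by rewrite gt_eqF.
    have := is_deriveV xn0 (is_derive_id x (1 : R)).
    by rewrite /GRing.scale/= mulr1.
  have dP : is_derive x (1 : R) (fun y : R => P.[y^-1]) (P^`().[x^-1] * - x ^- 2).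
    exact: (@is_derive1_comp _ (horner P) (fun y : R => y^-1) x _ _ (is_derive_poly P _) dV).
  have dN : is_derive x (1 : R) (fun y : R => - y^-1) (x ^- 2).
    by have := is_deriveN dV; rewrite opprK.
  have dE : is_derive x (1 : R) (fun y : R => expR (- y^-1)) (expR (- x^-1) * x ^- 2).
    exact: (@is_derive1_comp _ expR (fun y : R => - y^-1) x _ _ (is_derive_expR _) dN).
  apply: is_derive_eq (is_deriveMf dP dE) _.
  rewrite hornerM hornerXn hornerD hornerN exprVn; ring.
- rewrite {2}/flat ltxx.
  have [C C0 HC] := flat_bound P 2.
  have lim0 : (fun h => h^-1 *: ((flat P \o shift 0) (h *: 1) - flat P 0)) @ 0^' --> (0 : R).
    apply/cvgrPdist_le => e e0.
    have C1 : 0 < C + 1 by rewrite ltr_wpDl.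
    near=> h; rewrite sub0r normrN /= addr0 {2}/flat ltxx subr0.
    rewrite /flat /GRing.scale/= mulr1.
    case: ifPn => [h0|_]; last by rewrite mulr0 normr0 ltW.
    rewrite normrM [`|h^-1|]ger0_norm ?invr_ge0 ?(ltW h0)// mulrC ler_pdivrMr//.
    apply: (le_trans (HC h h0)); rewrite expr2 mulrA ler_wpM2r ?(ltW h0)//.
    apply: (@le_trans _ _ ((C + 1) * h)); first by rewrite ler_wpM2r ?lerDl ?(ltW h0).
    rewrite -ler_pdivlMl// mulrC.
    apply: le_trans (ler_norm h) _; near: h.
    by apply: dnbhs0_le; rewrite divr_gt0.
  apply: DeriveDef; first by apply/cvg_ex; exists 0.
  by apply/cvg_lim => //.
Unshelve. all: by end_near. Qed.

Lemma smooth_flat P a b : smooth (fun x => flat P (a * x + b)).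
Proof.
apply: (@smooth_coind (fun f => exists P, f = fun x => flat P (a * x + b))); last by exists P.
move=> _ [{}P ->]; exists (fun x => flat (a *: ((P - P^`()) * 'X^2)) (a * x + b)).
  by eexists.
move=> x.
have dl : is_derive x (1 : R) (fun y => a * y + b) a.
  have := is_deriveDf (is_deriveZf a (is_derive_id x 1)) (is_derive_cst b x 1).
  by rewrite mulr1 addr0.
apply: is_derive_eq (@is_derive1_comp _ (flat P) _ x _ _ (flat_derive P _) dl) _.
by rewrite /flat; case: ifP; rewrite ?mul0r// hornerZ => _; ring.
Qed.

End smooth_functions.

(** * Test functions and the lemma of du Bois-Reymond *)

Section test_functions.
Variable R : realType.
Implicit Types (f g h p q : R -> R) (x a b c : R).

Local Notation mu := (@lebesgue_measure R).
Local Notation I := (`]0, 1[%classic : set R).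
Local Notation Int f := (Rintegral mu I f).

#[local] Existing Instance ae_filter.

Let mI := @mI R.

(** The complement of the compact support contains neighbourhoods of 0 and 1. The bounds [a] and [b]
    need not be ordered; [b < a] forces [p] to vanish. *)
Lemma test_functionP p : test_function p <->
  smooth p /\ exists a b, [/\ 0 < a, b < 1 & forall x, x < a \/ b < x -> p x = 0].
Proof.
split=> [[sp [K [cK KI pK]]]|[sp [a [b [a0 b1 pab]]]]].
  split => //.
  have oK : open (~` K).
    by apply: closed_openC; apply: compact_closed => //; exact: Rhausdorff.
  have nK x : ~ I x -> nbhs x (~` K).
    by move=> nI; apply: open_nbhs_nbhs; split => // /KI.
  have n0 : ~ I 0 by rewrite /= in_itv/= ltxx.
  have n1 : ~ I 1 by rewrite /= in_itv/= ltxx andbF.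
  have /nbhs_ballP[/= d d0 Kd] := nK 0 n0.
  have /nbhs_ballP[/= e e0 Ke] := nK 1 n1.
  exists d, (1 - e); split => //; first by rewrite ltrBlDr ltrDl.
  move=> x H; apply: pK => /[dup] Kx /KI /in_I[x0 x1].
  case: H => H; [apply: (Kd x)|apply: (Ke x)] => //; rewrite /ball/=.
    by rewrite sub0r normrN gtr0_norm.
  by rewrite gtr0_norm ?subr_gt0//; lra.
split => //; exists `[a, b]%classic; split.
- exact: segment_compact.
- move=> x; rewrite /= !in_itv/= => /andP[ax xb].
  by rewrite (lt_le_trans a0 ax) (le_lt_trans xb b1).
- move=> x; rewrite /= in_itv/= => /negP; rewrite negb_and -!ltNge => /orP H.
  exact: pab.
Qed.

Lemma test_bounded p : test_function p -> exists M, forall x, `|p x| <= M.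
Proof.
move=> /test_functionP[sp [a [b [a0 b1 pab]]]].
have cp : {within `[a, b], continuous p}.
  by apply: continuous_subspaceT; exact: smooth_continuous.
have /compact_bounded[M [_ mrt]] := continuous_compact cp (@segment_compact _ a b).
exists (`|M| + 1) => x; case: (boolP (a <= x <= b)) => [xab|].
  by apply: mrt; [rewrite (le_lt_trans (ler_norm M))// ltrDl|exists x].
rewrite negb_and -!ltNge => /orP H; rewrite pab// normr0 addr_ge0//.
Qed.

Lemma test_measurable p : test_function p -> measurable_fun I p.
Proof.
move=> [sp _]; apply/measurable_funTS; apply: continuous_measurable_fun.
exact: smooth_continuous.
Qed.

Lemma test_intg p : test_function p -> intg p.
Proof.
move=> tp; have [M pM] := test_bounded tp.
by apply: (@intg_bounded _ _ M) => //; exact: test_measurable.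
Qed.

Lemma locint_test h p : locally_integrable I h -> test_function p ->
  intg (fun x => h x * p x).
Proof.
move=> [mh oI ih] tp; have [M pM] := test_bounded tp.
have /test_functionP[sp [a [b [a0 b1 pab]]]] := tp.
pose K := (`[a, b]%classic : set R).
have KI : K `<=` I.
  move=> x; rewrite /K /= !in_itv/= => /andP[ax xb].
  by rewrite (lt_le_trans a0 ax) (le_lt_trans xb b1).
have mK : measurable (K : set (measurableTypeR R)) by exact: measurable_itv.
have iK : mu.-integrable K (EFin \o h).
  apply/integrableP; split; last by apply: ih => //; exact: segment_compact.
  by apply/measurable_EFinP; apply: measurable_funS mh.
have iIK : intg (fun x => `|(h \_ K) x|).
  have : mu.-integrable I ((EFin \o h) \_ K).
    by apply/integrable_restrict => //; rewrite setIidr.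
  move/integrable_abse; apply: eq_integrable => // x _ /=.
  by rewrite !patchE; case: ifP.
apply: (intg_dom _ (intgZ M iIK)).
  by apply: measurable_funM => //; exact: test_measurable.
move=> x Ix; rewrite normrM mulrC patchE; case: ifPn => xK.
  by rewrite ler_wpM2r.
rewrite pab ?normr0 ?mul0r ?mulr0//.
move: xK; rewrite /K mem_setE in_itv/= negb_and -!ltNge => /orP//.
Qed.

(** Positive exactly for 1/n < y < x - 1/n when n > 0, and convergent on ]0, 1[ to the indicator of
    [y < x], the cut used in [prim]. *)
Definition bump (n : nat) x y :=
  flat 1 (n%:R * y + -1) * flat 1 (- n%:R * y + (n%:R * x - 1)).

Lemma flat1_itv x : 0 <= flat 1 x <= 1.
Proof.
rewrite /flat; case: ifPn => [x0|_]; last by rewrite lexx ler01.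
by rewrite hornerC mul1r expR_ge0 expR_le1 oppr_le0 invr_ge0 ltW.
Qed.

Lemma flat1_gt0 x : 0 < x -> 0 < flat 1 x.
Proof. by move=> x0; rewrite /flat x0 hornerC mul1r expR_gt0. Qed.

Lemma bump_itv n x y : 0 <= bump n x y <= 1.
Proof.
have /andP[a0 a1] := flat1_itv (n%:R * y + -1).
have /andP[b0 b1] := flat1_itv (- n%:R * y + (n%:R * x - 1)).
by rewrite /bump mulr_ge0// mulr_ile1.
Qed.

Lemma bump_test n x : x <= 1 -> test_function (bump n x).
Proof.
move=> x1; apply/test_functionP; split; first by apply: smoothM; exact: smooth_flat.
case: n => [|n].
  (* For [n = 0] the bump is identically zero, and these bounds say that it vanishes everywhere. *)
  exists 1, 0; split => // y _; rewrite /bump /flat mul0r add0r.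
  by rewrite ltr0N1 mul0r.
have n0 : 0 < n.+1%:R :> R by [].
exists (n.+1%:R^-1), (x - n.+1%:R^-1); split => //.
- by rewrite ltrBlDr (le_lt_trans x1)// ltrDl invr_gt0.
- move=> y [H|H]; rewrite /bump /flat.
    rewrite ifF ?mul0r//; apply/negbTE; rewrite -leNgt.
    by rewrite subr_le0 -ler_pdivlMl// mulr1 ltW.
  rewrite [X in _ * X]ifF ?mulr0//; apply/negbTE; rewrite -leNgt.
  have : n.+1%:R * (x - n.+1%:R^-1) < n.+1%:R * y by rewrite ltr_pM2l.
  by rewrite mulrBr divff ?gt_eqF//; lra.
Qed.

Lemma flat1_cvg x : 0 < x ->
  (fun n => flat 1 (n%:R * x - 1)) @ \oo --> (1 : R).
Proof.
move=> x0; apply/cvgrPdist_le => e e0; near=> n.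
have H : e^-1 + 1 <= n%:R * x.
  by rewrite -ler_pdivrMr//; near: n; exact: nbhs_infty_ger.
have ei : 0 < e^-1 by rewrite invr_gt0.
have p : 0 < n%:R * x - 1 by lra.
rewrite /flat p hornerC mul1r ger0_norm ?subr_ge0 ?expR_le1 ?oppr_le0 ?invr_ge0 ?(ltW p)//.
have := expR_ge1Dx (- (n%:R * x - 1)^-1).
have : (n%:R * x - 1)^-1 <= e.
  by rewrite -[leRHS]invrK lef_pV2 ?posrE ?invr_gt0//; lra.
lra.
Unshelve. all: by end_near. Qed.

Lemma bump_cvg x y : I y -> (fun n => bump n x y) @ \oo --> ((y < x)%R%:R : R).
Proof.
move=> /in_I[y0 y1]; case: ltP => xy.
  rewrite -[(true)%:R]mulr1; apply: cvgM; first exact: flat1_cvg.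
  have := @flat1_cvg (x - y); rewrite subr_gt0 => /(_ xy).
  by apply: cvg_trans; apply: near_eq_cvg; near=> n; congr flat; ring.
rewrite (_ : (fun n => bump n x y) = (fun=> 0)); first exact: cvg_cst.
apply/funext => n; rewrite /bump /flat [X in _ * X]ifF ?mulr0//.
apply/negbTE; rewrite -leNgt mulNr.
have : n%:R * x <= n%:R * y by rewrite ler_wpM2l.
lra.
Unshelve. all: by end_near. Qed.

Lemma testM p q : test_function p -> test_function q ->
  test_function (fun x => p x * q x).
Proof.
move=> /test_functionP[sp [a [b [a0 b1 pab]]]] [sq _].
apply/test_functionP; split; first exact: smoothM.
by exists a, b; split => // x /pab ->; rewrite mul0r.
Qed.

Lemma testD p q : test_function p -> test_function q ->
  test_function (fun x => p x + q x).
Proof.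
move=> /test_functionP[sp [a [b [a0 b1 pab]]]] /test_functionP[sq [c [d [c0 d1 qcd]]]].
apply/test_functionP; split; first exact: smoothD.
exists (Num.min a c), (Num.max b d); split.
- by rewrite lt_min a0.
- by rewrite gt_max b1.
- by move=> x; rewrite lt_min gt_max => -[/andP[h1 h2]|/andP[h1 h2]];
    rewrite pab ?qcd ?addr0//; [left|left|right|right].
Qed.

Lemma testZ c p : test_function p -> test_function (fun x => c * p x).
Proof.
move=> /test_functionP[sp [a [b [a0 b1 pab]]]].
apply/test_functionP; split; first by apply: smoothM => //; exact: smooth_cst.
by exists a, b; split => // x /pab ->; rewrite mulr0.
Qed.

Lemma test_derive p : test_function p -> test_function (derive1 p).
Proof.
move=> /test_functionP[sp [a [b [a0 b1 pab]]]].
apply/test_functionP; split; first exact: smooth_derive1.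
exists a, b; split => // x H; rewrite derive1E.
rewrite (@near_eq_derive _ _ _ _ (cst 0)) ?derive_cst//.
case: H => H; near=> y; apply: pab; [left|right]; near: y.
  exact: lt_nbhsl.
exact: lt_nbhsr.
Unshelve. all: by end_near. Qed.

(** As [g] is only locally integrable, it is first multiplied by a test function [q]. Dominated
    convergence along the bumps shows that all primitives of [g * q] vanish, so [g * q] does; the
    choice [q = bump n 1] with [n] large then frees [g] at each point. *)
Lemma fundamental_lemma g : locally_integrable I g ->
  (forall p, test_function p -> Int (fun x => g x * p x) = 0) ->
  aeq g (fun=> 0).
Proof.
move=> lg g0.
have step q : test_function q -> aeq (fun x => g x * q x) (fun=> 0).
  move=> tq; have iG := locint_test lg tq; set G := (fun x => g x * q x) in iG *.
  apply: prim_eq0 => // x /andP[x0 x1].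
  pose f_ n y := (G y * bump n x y)%:E.
  have [|||||_ _] := @dominated_convergence _ _ _ mu I mI f_
      (fun y => ((y < x)%R%:R * G y)%:E) (fun y => `|G y|%:E).
  - move=> n; apply/measurable_EFinP; apply: measurable_funM.
      exact: intg_measurable.
    by apply: test_measurable; exact: bump_test.
  - by apply/measurable_EFinP; exact: (intg_measurable (intg_cut x iG)).
  - apply: aeW => y Iy; apply: cvg_EFin; first by apply: nearW.
    rewrite mulrC; apply: cvgM; first exact: cvg_cst.
    exact: bump_cvg.
  - by have := integrable_norm iG.
  - apply: aeW => y n Iy; rewrite /f_ lee_fin normrM ler_piMr//.
    by have /andP[b0 b1] := bump_itv n x y; rewrite ger0_norm.
  rewrite (_ : (fun n => _) = (fun=> 0%E)).
    move=> /cvg_lim => /(_ (@ereal_hausdorff R)); rewrite lim_cst//.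
    by rewrite /prim /Rintegral => <-.
  apply/funext => n.
  have iGp : intg (fun y => G y * bump n x y).
    apply: intg_ext (locint_test lg (testM tq (bump_test n x1))) => y _.
    by rewrite /G mulrA.
  rewrite -(fineK (integrable_fin_num mI iGp)); congr EFin.
  rewrite -[RHS](g0 _ (testM tq (bump_test n x1))).
  by apply: Int_ext => y _; rewrite /G mulrA.
have {}step n := step _ (bump_test n (lexx 1)).
have := ae_foralln step; apply: filterS => x H Ix.
have /in_I[x0 x1] := Ix.
have x1' : 0 < 1 - x by rewrite subr_gt0.
near \oo => n.
have n1 : 1 < n%:R * x.
  by rewrite -ltr_pdivrMr//; near: n; exact: nbhs_infty_gtr.
have n2 : 1 < n%:R * (1 - x).
  by rewrite -ltr_pdivrMr//; near: n; exact: nbhs_infty_gtr.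
have /eqP := H n Ix; rewrite mulf_eq0 => /orP[/eqP//|].
by rewrite gt_eqF// mulr_gt0// flat1_gt0//; lra.
Unshelve. all: by end_near. Qed.

(** The primitive from minus infinity vanishes to the left of the support of [q], and to the right
    of it equals the total integral, which is 0. *)
Lemma test_primitive q : test_function q -> Int q = 0 ->
  exists2 p, test_function p & derive1 p = q.
Proof.
move=> tq q0; have iq := test_intg tq.
have /test_functionP[sq [a [b [a0 b1 qab]]]] := tq.
pose p x := \int[mu]_(y in `]-oo, x]) q y.
have iT : mu.-integrable setT (EFin \o q).
  have : mu.-integrable I (EFin \o q) by exact: iq.
  move/(integrable_mkcond _ mI); apply: eq_integrable => // x _.
  rewrite patchE; case: ifPn => //; rewrite mem_setE in_itv/= negb_and -!leNgt => H.
  rewrite /= qab//; case/orP: H => H; [left|right].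
    exact: le_lt_trans a0.
  exact: lt_le_trans H.
have dp x : derivable p x 1 /\ derive1 p x = q x.
  apply: (@continuous_FTC1 _ q -oo%O x (x + 1)); rewrite ?ltrDl//.
    by apply: integrableS iT.
    by rewrite ltNyr.
  exact: (smooth_continuous sq).
have dp1 : derive1 p = q by apply/funext => x; case: (dp x).
have sp : smooth p.
  apply: (@smooth_coind _ (fun f => smooth f \/ f = p)); last by right.
  move=> f [sf|->].
    by exists (derive1 f); [left; exact: smooth_derive1|move=> x; exact: smooth_derive].
  exists q; first by left.
  by move=> x; have [d <-] := dp x; rewrite derive1E; exact: derivableP.
exists p => //; apply/test_functionP; split => //; exists a, b; split => // x H.
rewrite /p Rintegral_mkcond; case: H => H.
  rewrite (@eq_Rintegral _ _ _ _ _ (fun=> 0)) ?Rintegral_cst ?mul0r// => y _.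
  rewrite patchE; case: ifPn => //; rewrite mem_setE in_itv/= => yx.
  by rewrite qab//; left; exact: le_lt_trans H.
rewrite -q0 [RHS]Rintegral_mkcond; apply: eq_Rintegral => y _.
rewrite !patchE !mem_setE !in_itv/=.
case: ifPn => [yx|]; case: ifPn => //.
- rewrite negb_and -!leNgt => H'; rewrite qab//; case/orP: H' => H'; [left|right].
    exact: le_lt_trans a0.
  exact: lt_le_trans H'.
- by move=> _; rewrite -ltNge => xy; rewrite qab//; right; exact: lt_trans xy.
Qed.

(** With [eta] a test function of integral one, each test function is a multiple of [eta] plus the
    derivative of a test function. Hence [h] minus its pairing with [eta] annihilates all test
    functions. *)
Lemma du_Bois_Reymond h : locally_integrable I h ->
  (forall p, test_function p -> Int (fun x => h x * derive1 p x) = 0) ->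
  exists c, aeq h (fun=> c).
Proof.
move=> lh h0.
have tb := bump_test 4 (lexx (1 : R)).
have ib : intg (bump 4 1) := test_intg tb.
pose c0 := Int (bump 4 1).
have c0_gt0 : 0 < c0.
  rewrite lt_neqAle Int_ge0 ?andbT; last first.
    by move=> x _; have /andP[] := bump_itv 4 1 x.
  (* A zero integral would make every primitive vanish, hence the bump itself almost everywhere,
     although it is positive near 1/2. *)
  apply/negP => /eqP b0.
  have p0 x : 0 <= x <= 1 -> prim (bump 4 1) x = 0.
    move=> _; apply/eqP; rewrite eq_le; apply/andP; split.
      rewrite b0; apply: Int_le => //; first exact: intg_cut.
      move=> y _; have /andP[b1 _] := bump_itv 4 1 y.
      by rewrite ler_piMl//; case: (y < x)%R.
    apply: Int_ge0 => y _; have /andP[b1 _] := bump_itv 4 1 y.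
    by rewrite mulr_ge0.
  have h2 : (0 : R) <= 2^-1 <= (1 : R) by rewrite invr_ge0 ler0n invf_le1 ?ler1n.
  have d8 : (0 : R) < 8^-1 by [].
  have [y [_ ]] := aeq_dense (prim_eq0 ib p0) h2 d8.
  rewrite ltr_norml => /andP[y1 y2] /eqP; apply/negP; rewrite gt_eqF//.
  by rewrite mulr_gt0// flat1_gt0//; lra.
pose eta x := c0^-1 * bump 4 1 x.
have teta : test_function eta by exact: testZ.
have Ieta : Int eta = 1 by rewrite IntZ// mulVf// gt_eqF.
pose C := Int (fun x => h x * eta x); exists C.
have lhC : locally_integrable I (fun x => h x - C).
  apply: locally_integrableB => //; apply: open_integrable_locally.
    exact: interval_open.
  exact: intg_cst.
suff : aeq (fun x => h x - C) (fun=> 0).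
  by apply: filterS => x + Ix => /(_ Ix) /eqP; rewrite subr_eq0 => /eqP.
apply: fundamental_lemma => // q tq.
pose m := Int q; pose psi x := q x + (- m) * eta x.
have tpsi : test_function psi by apply: testD => //; exact: testZ.
have psi0 : Int psi = 0.
  rewrite IntD; [|exact: test_intg|exact/test_intg/testZ].
  by rewrite IntZ ?Ieta ?mulr1 ?subrr//; exact: test_intg.
have [p tp dp] := test_primitive tpsi psi0.
have := h0 p tp; rewrite dp.
have -> : Int (fun x => h x * psi x) = Int (fun x => h x * q x + (- m) * (h x * eta x)).
  by apply: Int_ext => x _; rewrite /psi; ring.
rewrite IntD; [|exact: locint_test|by apply: intgZ; exact: locint_test].
rewrite IntZ; last exact: locint_test.
rewrite -/C => E.
have -> : Int (fun x => (h x - C) * q x) = Int (fun x => h x * q x + (- C) * q x).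
  by apply: Int_ext => x _; ring.
rewrite IntD; [|exact: locint_test|by apply: intgZ; exact: test_intg].
by rewrite IntZ; [rewrite -/m -[RHS]E; ring|exact: test_intg].
Qed.

End test_functions.

(** * Periodic Sobolev functions *)

Section periodic_chains.
Variable R : realType.
Implicit Types (w p : R -> R) (f g h F G : nat -> R -> R) (x a b c : R) (n m s : nat).

Local Notation mu := (@lebesgue_measure R).
Local Notation I := (`]0, 1[%classic : set R).
Local Notation Int f := (Rintegral mu I f).

#[local] Existing Instance ae_filter.

Let mI := @mI R.

Lemma intg_aeq (u v : R -> R) : measurable_fun I u -> aeq u v -> intg v -> intg u.
Proof.
move=> m_u uv iv; have mv := intg_measurable iv.
have /integrableP[_ fv] : mu.-integrable I (EFin \o v) by exact: iv.
apply/integrableP; split; first exact/measurable_EFinP.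
rewrite (@ge0_ae_eq_integral _ _ _ mu I _ (fun x => `|(v x)%:E|%E))//.
- by apply: measurableT_comp => //; exact/measurable_EFinP.
- by apply: measurableT_comp => //; exact/measurable_EFinP.
- by apply: filterS uv => x + Ix => /= ->.
Qed.

Lemma L2_aeq (u v : R -> R) : measurable_fun I u -> aeq u v -> L2 v -> L2 u.
Proof.
move=> m_u uv [mv v2]; split => //; apply: intg_aeq v2; first exact: measurable_funX.
exact: (aeq_comp (fun y => y ^+ 2)).
Qed.

Lemma L2_locint (u : R -> R) : L2 u -> locally_integrable I u.
Proof.
move=> hu; apply: open_integrable_locally; first exact: interval_open.
exact: L2_intg.
Qed.

Lemma test_ac p : test_function p -> ac p (derive1 p).
Proof.
move=> tp; have tp' := test_derive tp; have [sp _] := tp.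
split.
  have [M pM] := test_bounded tp'.
  by apply: (@L2_bounded _ _ M) => //; exact: test_measurable.
move=> x /andP[]; rewrite le_eqVlt => /predU1P[<- _|x0 x1].
  by rewrite prim0 addr0.
have cp' : continuous (derive1 p) by apply: smooth_continuous; case: tp'.
have cp : continuous p by apply: smooth_continuous.
have FTC : (\int[mu]_(y in `[0%R, x]) (derive1 p y)%:E = (p x)%:E - (p 0%R)%:E)%E.
  apply: continuous_FTC2 => //; first exact: continuous_subspaceT.
  split; first by move=> y _; exact: (sp 0%N).
    by apply: cvg_at_right_filter; exact: cp.
  by apply: cvg_at_left_filter; exact: cp.
have i01 : mu.-integrable `[0, x] (EFin \o derive1 p).
  apply: continuous_compact_integrable; first exact: segment_compact.
  exact: continuous_subspaceT.
suff -> : prim (derive1 p) x = \int[mu]_(y in `[0, x]) derive1 p y.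
  by rewrite /Rintegral FTC/=; ring.
rewrite -Rintegral_itv_obnd_cbnd; last by apply: integrableS i01 => //; exact: subset_itv_oc_cc.
rewrite -Rintegral_itv_bndo_bndc; last by apply: integrableS i01 => //; exact: subset_itv_oo_cc.
rewrite /prim [LHS]Rintegral_mkcond [RHS]Rintegral_mkcond.
apply: eq_Rintegral => y _; rewrite !patchE !mem_setE !in_itv/=.
case: (ltP 0 y) => //= y0; case: (ltP y x) => yx; last by case: ifP; rewrite ?mul0r.
by rewrite (lt_le_trans yx x1) mul1r.
Qed.

Lemma test_ac0 p : test_function p -> p 0 = 0 /\ p 1 = 0.
Proof.
by move=> /test_functionP[_ [a [b [a0 b1 pab]]]]; split; apply: pab; [left|right].
Qed.

Lemma ac_test (u U p : R -> R) : ac u U -> test_function p ->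
  Int (fun x => u x * derive1 p x) = - Int (fun x => U x * p x).
Proof.
move=> hu tp; have hp := test_ac tp; have [p0 p1] := test_ac0 tp.
have [_ /(_ 1)] := acM hu hp.
rewrite lexx ler01 => /(_ isT); rewrite p0 p1 !mulr0 add0r prim1.
rewrite IntD; first by move=> e; apply/eqP; rewrite -addr_eq0 addrC -e.
  apply: L2_intg; apply: L2_ext (ac_L2M hp (proj1 hu)) => x _; exact: mulrC.
by apply: L2_intg; exact: (ac_L2M hu (proj1 hp)).
Qed.

(** Equality of the boundary values is what makes the integral of the derivative vanish
    ([pderiv_Int0]), hence what removes the boundary terms in all energy identities. *)
Definition pderiv (u U : R -> R) := ac u U /\ u 0 = u 1.

(* A function of H^s_p(0,1) is handled through the sequence [g] of its weak
   derivatives; [g n] is the absolutely continuous representative if n < s. *)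
Definition chain s g := L2 (g 0%N) /\ forall n, (n < s)%N -> pderiv (g n) (g n.+1).

Lemma chain_L2 s g n : chain s g -> (n <= s)%N -> L2 (g n).
Proof. by move=> [h0 h]; case: n => // n ns; have [[]] := h n ns. Qed.

Lemma chain_le s s' g : (s <= s')%N -> chain s' g -> chain s g.
Proof. by move=> ss' [h0 h]; split => // n ns; apply: h; exact: leq_trans ss'. Qed.

Lemma chain_shift s g : chain s.+1 g -> chain s (fun n => g n.+1).
Proof.
move=> hg; split; first exact: (chain_L2 hg).
by case: hg => _ h n ns; exact: h.
Qed.

Lemma chain_shiftn s g j : chain (j + s) g -> chain s (fun n => g (j + n)%N).
Proof. by elim: j g => // j IH g /chain_shift /IH. Qed.

Lemma is_wderiv_unique n w (g g' : R -> R) : is_wderiv n w g -> is_wderiv n w g' -> aeq g g'.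
Proof.
move=> [lw lg Hg] [_ lg' Hg'].
have : aeq (fun x => g x - g' x) (fun=> 0).
  apply: fundamental_lemma; first exact: locally_integrableB.
  move=> p tp; have := Hg p tp; rewrite Hg'// => /(mulfI _) E.
  have -> : Int (fun x => (g x - g' x) * p x) = Int (fun x => g x * p x - g' x * p x).
    by apply: Int_ext => x _; rewrite mulrBl.
  rewrite IntB ?E ?subrr//; [|exact: locint_test..].
  by rewrite signr_eq0.
by apply: filterS => x + Ix => /(_ Ix)/eqP; rewrite subr_eq0 => /eqP.
Qed.

Lemma is_wderiv_aeq n w w' (g : R -> R) : locally_integrable I w' -> aeq w w' ->
  is_wderiv n w g -> is_wderiv n w' g.
Proof.
move=> lw' ww' [lw lg Hg]; split => // p tp; rewrite -Hg//.
have mp : measurable_fun I (derive1n n p).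
  apply: test_measurable; elim: n {Hg} => // n IH; exact: test_derive.
apply: Int_aeq.
- by apply: measurable_funM => //; case: lw'.
- by apply: measurable_funM => //; case: lw.
- by apply: filterS ww' => x + Ix => ->.
Qed.

Lemma chain_is_wderiv s g n : chain s g -> (n <= s)%N -> is_wderiv n (g 0%N) (g n).
Proof.
move=> hg ns; split; [exact/L2_locint/(chain_L2 hg)|exact/L2_locint/(chain_L2 hg)|].
elim: n ns => [|n IH] ns p tp.
  by rewrite expr0 mul1r.
have -> : derive1n n.+1 p = derive1n n (derive1 p) by rewrite /derive1n iterSr.
rewrite IH; [|exact: ltnW|exact: test_derive].
have [h _] := (proj2 hg) n ns.
by rewrite (ac_test h tp) exprS mulrN mulN1r mulNr.
Qed.

Lemma chain_unique s g h n : chain s g -> chain s h -> aeq (g 0%N) (h 0%N) ->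
  (n <= s)%N -> aeq (g n) (h n).
Proof.
move=> hg hh gh ns; apply: is_wderiv_unique (chain_is_wderiv hh ns).
apply: is_wderiv_aeq gh (chain_is_wderiv hg ns); exact/L2_locint/(chain_L2 hh).
Qed.

Lemma chain_wderiv s g w n : chain s g -> measurable_fun I w -> aeq w (g 0%N) ->
  (n <= s)%N -> L2 (wderiv n w) /\ aeq (wderiv n w) (g n).
Proof.
move=> hg mw wg ns.
have lw : locally_integrable I w.
  by apply: L2_locint; apply: L2_aeq wg _ => //; exact: chain_L2 hg _.
have hw : is_wderiv n w (g n).
  by apply: is_wderiv_aeq (chain_is_wderiv hg ns) => //; exact: aeq_sym.
have hx : is_wderiv n w (wderiv n w).
  by rewrite /wderiv; case: xgetP => [y -> //|/(_ (g n))]; exact.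
have e := is_wderiv_unique hx hw; split => //.
apply: L2_aeq e (chain_L2 hg ns); by case: hx => _ [].
Qed.

Lemma Hnorm_chain s g w : chain s g -> measurable_fun I w -> aeq w (g 0%N) ->
  Hnorm s w = Num.sqrt (\sum_(n < s.+1) Int (fun x => g n x ^+ 2)).
Proof.
move=> hg mw wg; congr Num.sqrt; apply: eq_bigr => n _.
have ns : (n <= s)%N by rewrite -ltnS.
have [[m1 _] e] := chain_wderiv hg mw wg ns.
apply: Int_aeq; [exact: measurable_funX|apply: measurable_funX|].
  exact: L2_measurable (chain_L2 hg ns).
exact: (aeq_comp (fun y => y ^+ 2)).
Qed.

Lemma within_L2 (u : R -> R) : {within `[0, 1], continuous u} -> L2 u.
Proof.
move=> cu; have c01 : compact (`[0, 1]%classic : set R) by exact: segment_compact.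
have /compact_bounded[M [_ mrt]] := continuous_compact cu c01.
apply: (@L2_bounded _ _ (`|M| + 1)).
  have : measurable_fun (`[0, 1]%classic : set R) u.
    by apply: subspace_continuous_measurable_fun => //; exact: measurable_itv.
  by apply: measurable_funS => //; exact: subset_itv_oo_cc.
move=> x Ix; apply: mrt; first by rewrite (le_lt_trans (ler_norm M))// ltrDl.
by exists x => //; exact: subset_itv_oo_cc Ix.
Qed.

Lemma within_aeq0 (u : R -> R) : {within `[0, 1], continuous u} ->
  aeq u (fun=> 0) -> forall x, 0 <= x <= 1 -> u x = 0.
Proof.
move=> cu u0 x x01; apply/eqP; rewrite -normr_le0; apply/ler_addgt0Pl => e e0.
have xI : `[0, 1]%classic x by rewrite /= in_itv/=.
have /subspace_continuousP/(_ x xI)/cvgrPdist_le/(_ _ e0) := cu.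
rewrite near_withinE => /nbhs_ballP[/= d d0 H].
have [y [Iy xy] uy] := aeq_dense u0 x01 d0.
have : `|u x - u y| <= e by exact: (H y xy (subset_itv_oo_cc Iy)).
by rewrite uy subr0 ?addr0 ?add0r.
Qed.

Lemma ac_within (u U : R -> R) : ac u U -> {within `[0, 1], continuous u}.
Proof.
move=> [hU uE]; apply/subspace_continuousP => x xI.
have x01 : 0 <= x <= 1 by move: xI; rewrite /= in_itv.
apply/cvgrPdist_lt => e e0.
have [d d0 H] := prim_ucont hU e0.
rewrite near_withinE; near=> y => yI.
have y01 : 0 <= y <= 1 by move: yI; rewrite /= in_itv.
have -> : `|u x - u y| = `|prim U x - prim U y|.
  by rewrite uE// [u y]uE// opprD addrACA subrr add0r.
exact: H.
Unshelve. all: by end_near. Qed.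

Lemma prim_ac (U : R -> R) : L2 U -> ac (prim U) U.
Proof. by move=> hU; split => // x _; rewrite prim0 add0r. Qed.

(** The difference of [u] and [prim U] has zero weak derivative, so it is constant almost everywhere
    by [du_Bois_Reymond], and everywhere on [0, 1] by continuity. *)
Lemma wderiv_pderiv n w (u U : R -> R) : is_wderiv n w u -> is_wderiv n.+1 w U ->
  {within `[0, 1], continuous u} -> u 0 = u 1 -> L2 U -> pderiv u U.
Proof.
move=> [lw lu Hu] [_ lU HU] cu u01 hU; split => //.
have hP := prim_ac hU.
have cP := ac_within hP.
have key p : test_function p -> Int (fun x => u x * derive1 p x) = - Int (fun x => U x * p x).
  move=> tp; have := HU p tp.
  have -> : derive1n n.+1 p = derive1n n (derive1 p) by rewrite /derive1n iterSr.
  rewrite Hu ?exprS ?mulN1r -?mulrN; last exact: test_derive.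
  rewrite mulNr -mulrN; apply: mulfI; by rewrite signr_eq0.
have lP : locally_integrable I (prim U) := L2_locint (ac_L2 hP).
have [C hC] : exists C, aeq (fun x => u x - prim U x) (fun=> C).
  apply: du_Bois_Reymond; first exact: locally_integrableB.
  move=> p tp; have tp' := test_derive tp.
  have -> : Int (fun x => (u x - prim U x) * derive1 p x) =
      Int (fun x => u x * derive1 p x - prim U x * derive1 p x).
    by apply: Int_ext => x _; rewrite mulrBl.
  rewrite IntB; [|exact: locint_test..].
  by rewrite key// (ac_test hP tp) subrr.
have E x : 0 <= x <= 1 -> u x - prim U x - C = 0.
  apply: (within_aeq0 (u := fun x => u x - prim U x - C)).
    apply/subspace_continuousP => y yI; apply: cvgB; last exact: cvg_cst.
    by apply: cvgB; [move/subspace_continuousP: cu|move/subspace_continuousP: cP]; exact.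
  by apply: filterS hC => y + Iy => /(_ Iy) ->; rewrite subrr.
split => // x x01; have := E x x01.
have := E 0; rewrite prim0 lexx ler01 => /(_ isT) /eqP.
by rewrite subr0 subr_eq0 => /eqP -> /eqP; rewrite subr_eq0 => /eqP <-; rewrite subrK.
Qed.

(** Orders below [s] take the continuous representatives of the boundary condition, the top order
    takes any L^2 one; [wderiv_pderiv] links consecutive orders. *)
Lemma in_Hsp_chain s w : in_Hsp s w ->
  L2 w /\ exists g, chain s g /\ aeq w (g 0%N).
Proof.
move=> [Hw Hb].
have [G HG] : exists G : nat -> R -> R, forall n, (n <= s)%N ->
    is_wderiv n w (G n) /\ L2 (G n).
  suff /choice : forall n, exists g : R -> R, (n <= s)%N -> is_wderiv n w g /\ L2 g.
    by move=> [G HG]; exists G.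
  move=> n; case: (leqP n s) => [/Hw[g h1 h2]|_]; first by exists g.
  by exists (fun=> 0).
have [H HH] : exists H : nat -> R -> R, forall n, (n < s)%N ->
    [/\ is_wderiv n w (H n), {within `[0, 1], continuous (H n)} & H n 0 = H n 1].
  suff /choice : forall n, exists h : R -> R, (n < s)%N ->
    [/\ is_wderiv n w h, {within `[0, 1], continuous h} & h 0 = h 1].
    by move=> [H HH]; exists H.
  move=> n; case: (ltnP n s) => [/Hb[g h1]|_]; first by exists g.
  by exists (fun=> 0).
pose g n := if (n < s)%N then H n else G n.
have gw n : (n <= s)%N -> is_wderiv n w (g n) /\ L2 (g n).
  rewrite /g => ns; case: ifP => ns'; last exact: HG.
  by have [h1 h2 _] := HH n ns'; split => //; exact: within_L2.
have wg : aeq w (g 0%N).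
  have [h1 _] := gw 0%N isT; have [lw _ _] := h1.
  apply: is_wderiv_unique h1.
  by split => // p tp; rewrite expr0 mul1r.
have [h0 h1] := gw 0%N isT.
split; first by apply: L2_aeq wg h1; case: h0 => [[]].
exists g; split => //; split => // n ns.
have [d1 _] := gw n (ltnW ns); have [d2 d3] := gw n.+1 ns.
have := HH n ns; rewrite -/(g n) => -[e1 e2 e3].
have eg : g n = H n by rewrite /g ns.
by rewrite eg in d1 *; apply: wderiv_pderiv d1 d2 e2 e3 d3.
Qed.

Lemma pderivD (u U v V : R -> R) : pderiv u U -> pderiv v V ->
  pderiv (fun x => u x + v x) (fun x => U x + V x).
Proof. by move=> [hu u1] [hv v1]; split; [exact: acD|rewrite u1 v1]. Qed.

Lemma pderivZ c (u U : R -> R) : pderiv u U -> pderiv (fun x => c * u x) (fun x => c * U x).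
Proof. by move=> [hu u1]; split; [exact: acZ|rewrite u1]. Qed.

Lemma pderivM (u U v V : R -> R) : pderiv u U -> pderiv v V ->
  pderiv (fun x => u x * v x) (fun x => U x * v x + u x * V x).
Proof. by move=> [hu u1] [hv v1]; split; [exact: acM|rewrite u1 v1]. Qed.

Lemma pderiv_cst c : pderiv (fun=> c) (fun=> 0).
Proof. by split => //; exact: ac_cst. Qed.

Lemma pderiv_Int0 (u U : R -> R) : pderiv u U -> Int U = 0.
Proof.
move=> [[hU uE] u1]; have := uE 1; rewrite lexx ler01 => /(_ isT).
by rewrite prim1 u1 => /eqP; rewrite -subr_eq0 opprD addNKr oppr_eq0 => /eqP.
Qed.

Lemma chainD s g h : chain s g -> chain s h -> chain s (fun n x => g n x + h n x).
Proof.
move=> [g0 hg] [h0 hh]; split; first exact: L2D.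
by move=> n ns; apply: pderivD; [exact: hg|exact: hh].
Qed.

Lemma chainZ s c g : chain s g -> chain s (fun n x => c * g n x).
Proof.
move=> [g0 hg]; split; first exact: L2Z.
by move=> n ns; apply: pderivZ; exact: hg.
Qed.

Definition chain_cst c n : R -> R := fun=> if n is 0%N then c else 0.

Lemma chain_cstP s c : chain s (chain_cst c).
Proof.
split; first exact: L2_cst.
by move=> [|n] _; exact: pderiv_cst.
Qed.

(** The n-th derivative of a product as a sum of 2^n products, without binomial coefficients, so
    that differentiation and the bounds go by plain induction. *)
Fixpoint leib n f g : R -> R := if n is m.+1
  then fun x => leib m (fun j => f j.+1) g x + leib m f (fun j => g j.+1) x
  else fun x => f 0%N x * g 0%N x.

Lemma leib_pderiv n f g : chain n.+1 f -> chain n.+1 g ->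
  pderiv (leib n f g) (leib n.+1 f g).
Proof.
elim: n f g => [|n IH] f g hf hg.
  by apply: pderivM; [exact: (proj2 hf)|exact: (proj2 hg)].
apply: pderivD; apply: IH; rewrite -?(addn1 n.+1).
- exact: chain_shift.
- exact: chain_le hg.
- exact: chain_le hf.
- exact: chain_shift.
Qed.

Lemma chain_leib s f g : (0 < s)%N -> chain s f -> chain s g ->
  chain s (fun n => leib n f g).
Proof.
move=> s0 hf hg; split => [|n ns].
  have [h1 _] := (proj2 hf) 0%N s0; exact: (ac_L2M h1 (proj1 hg)).
by apply: leib_pderiv; [exact: chain_le hf|exact: chain_le hg].
Qed.

Lemma leib_bound n f g x e : 0 <= e -> (forall j, (j <= n)%N -> `|f j x| <= e) ->
  `|leib n f g x| <= 2 ^+ n * (e * \sum_(j < n.+1) `|g j x|).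
Proof.
move=> e0; elim: n f g => [|n IH] f g fe.
  by rewrite expr0 mul1r big_ord1 normrM ler_wpM2r// fe.
rewrite [leLHS]/= (le_trans (ler_normD _ _))// exprS mulrDl mul1r mulrDl.
apply: lerD.
  apply: (le_trans (IH _ g _)) => [j jn|]; first exact: fe.
  rewrite ler_wpM2l ?exprn_ge0// ler_wpM2l// [leRHS]big_ord_recr/= lerDl//.
apply: (le_trans (IH f (fun j => g j.+1) _)) => [j jn|]; first exact/fe/ltnW.
rewrite ler_wpM2l ?exprn_ge0// ler_wpM2l// [leRHS]big_ord_recl/= lerDr//.
Qed.

(** Only the term [f 0 * g n] leaves [f] undifferentiated. In all others [f] carries a derivative,
    small by hypothesis, and [g] fewer than [n] of them. The isolated term is left to integration by
    parts. *)
Lemma leib_top n f g x e : 0 <= e ->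
  (forall j, (0 < j <= n)%N -> `|f j x| <= e) ->
  `|leib n f g x - f 0%N x * g n x| <= 2 ^+ n * (e * \sum_(j < n) `|g j x|).
Proof.
move=> e0; elim: n f g => [|n IH] f g fe.
  by rewrite subrr normr0 big_ord0 mulr0 mulr0.
rewrite [leib n.+1 f g x]/= -addrA (le_trans (ler_normD _ _))// exprS mulrDl mul1r mulrDl.
apply: lerD.
  by apply: leib_bound => // j jn; exact: fe.
apply: (le_trans (IH f (fun j => g j.+1) _)) => [j /andP[j0 jn]|].
  by apply: fe; rewrite j0 ltnW.
rewrite ler_wpM2l ?exprn_ge0// ler_wpM2l// [leRHS]big_ord_recl/= lerDr//.
Qed.

End periodic_chains.

(** * Calculus of L^2-valued functions *)

Section L2_calculus.
Variable R : realType.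
Implicit Types (f g : R -> R -> R) (u v : R -> R) (t x : R).

Local Notation mu := (@lebesgue_measure R).
Local Notation I := (`]0, 1[%classic : set R).
Local Notation Int f := (Rintegral mu I f).
Local Notation N2 f := (Int (fun x => f x ^+ 2)).

#[local] Existing Instance ae_filter.

Lemma N2_ge0 u : 0 <= N2 u. Proof. by apply: Int_ge0 => x _; exact: sqr_ge0. Qed.

Lemma Cauchy_Schwarz u v : L2 u -> L2 v ->
  Int (fun x => u x * v x) ^+ 2 <= N2 u * N2 v.
Proof.
move=> hu hv; set a := N2 u; set b := Int _; set c := N2 v.
have key l : 0 <= a - 2 * l * b + l ^+ 2 * c.
  have : 0 <= N2 (fun x => u x - l * v x) by exact: N2_ge0.
  have -> : N2 (fun x => u x - l * v x) =
      Int (fun x => u x ^+ 2 - (2 * l) * (u x * v x) + l ^+ 2 * v x ^+ 2).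
    by apply: Int_ext => x _; ring.
  have i1 := L2_sqr hu; have i2 := L2_sqr hv; have i3 := L2_intgM hu hv.
  rewrite IntD; [|by apply: intgB => //; exact: intgZ|exact: intgZ].
  by rewrite IntB//; [rewrite !IntZ|exact: intgZ].
have [c0|c0] := eqVneq c 0.
  rewrite c0 mulr0; have [->|b0] := eqVneq b 0; first by rewrite expr0n.
  (* With [c = 0] the inequality is affine in [l]; this [l] turns its right-hand side into -1. *)
  have := key ((a + 1) / (2 * b)); rewrite c0 mulr0 addr0.
  have -> : 2 * ((a + 1) / (2 * b)) * b = a + 1 by field.
  lra.
have cp : 0 < c by rewrite lt_neqAle eq_sym c0 N2_ge0.
have := key (b / c).
have -> : a - 2 * (b / c) * b + (b / c) ^+ 2 * c = (a * c - b ^+ 2) / c by field.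
by rewrite pmulr_lge0 ?invr_gt0// subr_ge0.
Qed.

Lemma Cauchy_Schwarz_sqrt u v : L2 u -> L2 v ->
  `|Int (fun x => u x * v x)| <= Num.sqrt (N2 u) * Num.sqrt (N2 v).
Proof.
move=> hu hv; rewrite -sqrtrM ?N2_ge0// -sqrtr_sqr.
by apply: ler_wsqrtr; exact: Cauchy_Schwarz.
Qed.

Lemma N2D_le u v : L2 u -> L2 v ->
  N2 (fun x => u x + v x) <= 2 * N2 u + 2 * N2 v.
Proof.
move=> hu hv; rewrite -!IntZ; [|exact: L2_sqr..].
rewrite -IntD; [|by apply: intgZ; exact: L2_sqr..].
apply: Int_le; [by apply: L2_sqr; exact: L2D|by apply: intgD; apply: intgZ; exact: L2_sqr|].
by move=> x _; have := sqr_ge0 (u x - v x); nra.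
Qed.

Lemma cvg_near_eq (F : set_system R) (FF : Filter F) (y z : R -> R) (l : R) :
  (\forall r \near F, y r = z r) -> y @ F --> l -> z @ F --> l.
Proof. by move=> yz; apply: cvg_trans; apply: near_eq_cvg. Qed.

Section cvg.
Context {F : set_system R} {FF : Filter F}.

(** Membership in L^2 must be stated: the real-valued integral of a square with infinite integral is
    0, so that [N2] alone would prove too little. *)
Definition L2cvg f u := [/\ \forall r \near F, L2 (f r), L2 u &
  (fun r => N2 (fun x => f r x - u x)) @ F --> (0 : R)].

Lemma L2cvg_cst u : L2 u -> L2cvg (fun=> u) u.
Proof.
move=> hu; split => //; first exact: nearW.
rewrite (_ : (fun r => _) = (fun=> 0)); first exact: cvg_cst.
apply/funext => r; rewrite -[RHS]Int_cst; apply: Int_ext => x _.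
by rewrite subrr expr0n.
Qed.

Lemma squeeze0 (y z : R -> R) : (\forall r \near F, `|y r| <= z r) ->
  z @ F --> (0 : R) -> y @ F --> (0 : R).
Proof.
move=> yz z0; apply/cvgrPdist_le => e e0.
have /cvgrPdist_le/(_ _ e0) z0' := z0.
near=> r; rewrite sub0r normrN.
apply: (@le_trans _ _ (z r)); first by near: r.
apply: le_trans (ler_norm _) _.
by rewrite -normrN -sub0r; near: r.
Unshelve. all: by end_near. Qed.

Lemma L2cvg_near f g u : (\forall r \near F, forall x, I x -> f r x = g r x) ->
  L2cvg f u -> L2cvg g u.
Proof.
move=> fg [hf hu fu]; split => //.
  by apply: filterS2 fg hf => r E; apply: L2_ext => x Ix; rewrite E.
apply: cvg_trans fu; apply: near_eq_cvg; apply: filterS fg => r E.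
by apply: Int_ext => x Ix; rewrite E.
Qed.

Lemma L2cvgD f g u v : L2cvg f u -> L2cvg g v ->
  L2cvg (fun r x => f r x + g r x) (fun x => u x + v x).
Proof.
move=> [hf hu fu] [hg hv gv]; split; [|exact: L2D|].
  by apply: filterS2 hf hg => r; exact: L2D.
apply: (@squeeze0 _ (fun r => 2 * N2 (fun x => f r x - u x) + 2 * N2 (fun x => g r x - v x))).
  apply: filterS2 hf hg => r hr gr; rewrite ger0_norm ?N2_ge0//.
  apply: le_trans (N2D_le (L2B hr hu) (L2B gr hv)).
  by rewrite le_eqVlt; apply/orP; left; apply/eqP/Int_ext => x _; congr (_ ^+ 2); ring.
have : (fun r => 2 * N2 (fun x => f r x - u x) + 2 * N2 (fun x => g r x - v x)) @ F --> (2 * 0 + 2 * 0 : R).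
  by apply: cvgD; apply: cvgMr.
by rewrite mulr0 addr0.
Qed.

Lemma L2cvgZ (c : R) f u : L2cvg f u -> L2cvg (fun r x => c * f r x) (fun x => c * u x).
Proof.
move=> [hf hu fu]; split; [by apply: filterS hf => r; exact: L2Z|exact: L2Z|].
apply: (@squeeze0 _ (fun r => c ^+ 2 * N2 (fun x => f r x - u x))).
  apply: filterS hf => r hr; rewrite ger0_norm ?N2_ge0//.
  rewrite -IntZ; last by apply: L2_sqr; exact: L2B.
  by rewrite le_eqVlt; apply/orP; left; apply/eqP/Int_ext => x _; ring.
have : (fun r => c ^+ 2 * N2 (fun x => f r x - u x)) @ F --> (c ^+ 2 * 0 : R) by apply: cvgMr.
by rewrite mulr0.
Qed.

Lemma L2cvg_ip f g u v : L2cvg f u -> L2cvg g v ->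
  (fun r => Int (fun x => f r x * g r x)) @ F --> Int (fun x => u x * v x).
Proof.
move=> [hf hu fu] [hg hv gv]; apply/subr_cvg0.
set A := fun r => N2 (fun x => f r x - u x) in fu *.
set B := fun r => N2 (fun x => g r x - v x) in gv *.
have sA : (fun r => Num.sqrt (A r)) @ F --> (0 : R).
  by rewrite -[X in _ --> X]sqrtr0; apply: continuous_cvg fu; exact: sqrt_continuous.
have sB : (fun r => Num.sqrt (B r)) @ F --> (0 : R).
  by rewrite -[X in _ --> X]sqrtr0; apply: continuous_cvg gv; exact: sqrt_continuous.
apply: (@squeeze0 _ (fun r => Num.sqrt (A r) * Num.sqrt (B r) + Num.sqrt (A r) * Num.sqrt (N2 v)
    + Num.sqrt (N2 u) * Num.sqrt (B r))).
  apply: filterS2 hf hg => r hr gr.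
  have d1 := L2B hr hu; have d2 := L2B gr hv.
  rewrite -IntB; [|exact: L2_intgM..].
  have -> : Int (fun x => f r x * g r x - u x * v x) =
    Int (fun x => (f r x - u x) * (g r x - v x) + (f r x - u x) * v x + u x * (g r x - v x)).
    by apply: Int_ext => x _; ring.
  rewrite IntD; [|by apply: intgD; exact: L2_intgM|exact: L2_intgM].
  rewrite IntD; [|exact: L2_intgM..].
  rewrite (le_trans (ler_normD _ _))// lerD//; last exact: Cauchy_Schwarz_sqrt.
  by rewrite (le_trans (ler_normD _ _))// lerD//; exact: Cauchy_Schwarz_sqrt.
rewrite [X in _ --> X](_ : _ = 0 * 0 + 0 * Num.sqrt (N2 v) + Num.sqrt (N2 u) * 0); last by ring.
by apply: cvgD; [apply: cvgD; [exact: cvgM|exact: cvgMl]|exact: cvgMr].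
Qed.

Definition supcvg f u := forall e, 0 < e ->
  \forall r \near F, forall x, I x -> `|f r x - u x| <= e.

(** One factor converges uniformly, since the product of two L^2 limits is only an L^1 limit. The
    increment is split as a b - p q = a (b - q) + (a - p) q. *)
Lemma L2cvgM f g u v (M : R) : (\forall r \near F, measurable_fun I (f r)) ->
  measurable_fun I u -> (forall x, I x -> `|u x| <= M) ->
  supcvg f u -> L2cvg g v ->
  L2cvg (fun r x => f r x * g r x) (fun x => u x * v x).
Proof.
move=> mf m_u uM fu [hg hv gv].
have M0 : 0 <= M.
  have h2 : I 2^-1 by rewrite /= in_itv/= invr_gt0 ltr0n invf_lt1 ?ltr1n.
  exact: le_trans (uM _ h2).
have fb : \forall r \near F, forall x, I x -> `|f r x| <= M + 1.
  have := fu 1 ltr01; apply: filterS => r H x Ix.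
  rewrite -[f r x](subrK (u x)) (le_trans (ler_normD _ _))// addrC lerD//.
    exact: uM.
  exact: H.
have hfg : \forall r \near F, L2 (fun x => f r x * g r x).
  by apply: filterS3 mf fb hg => r h1 h2 h3; exact: L2_boundedM h1 h2 h3.
have huv : L2 (fun x => u x * v x) by exact: L2_boundedM uM hv.
split => //; apply/cvgrPdist_le => e e0.
(* [e1] and [e3] make each half of the final bound at most [e / 2]; the minimum with 1 in [e2] gives
   [e2 ^+ 2 <= e1]. *)
pose e1 := e / (4 * (N2 v + 1)).
have v1 : 0 < N2 v + 1 by rewrite ltr_wpDl// N2_ge0.
have e10 : 0 < e1 by rewrite divr_gt0// mulr_gt0.
pose e2 := Num.min 1 e1.
have e20 : 0 < e2 by rewrite lt_min ltr01.
pose e3 := e / (4 * (M + 1) ^+ 2).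
have M1 : 0 < M + 1 by rewrite ltr_wpDl.
have e30 : 0 < e3 by rewrite divr_gt0// mulr_gt0// exprn_gt0.
have := fu e2 e20; move: gv => /cvgrPdist_le/(_ _ e30) => gv fu2.
near=> r.
have h1 : L2 (g r) by near: r.
have h2 : L2 (fun x => f r x * g r x) by near: r.
have h3 : forall x, I x -> `|f r x| <= M + 1 by near: r.
have h4 : forall x, I x -> `|f r x - u x| <= e2 by near: r.
have h5 : `|0 - N2 (fun x => g r x - v x)| <= e3 by near: r.
rewrite sub0r normrN ger0_norm ?N2_ge0// in h5.
rewrite sub0r normrN ger0_norm ?N2_ge0//.
apply: (@le_trans _ _ (Int (fun x => 2 * (M + 1) ^+ 2 * (g r x - v x) ^+ 2 + 2 * e1 * v x ^+ 2))).
  apply: Int_le.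
  - by apply: L2_sqr; exact: L2B.
  - by apply: intgD; apply: intgZ; apply: L2_sqr => //; exact: L2B.
  - move=> x Ix; have a1 := h3 x Ix; have a2 := h4 x Ix.
    set a := f r x in a1 a2 *; set b := g r x; set p := u x in a2 *; set q := v x.
    have b1 : a ^+ 2 <= (M + 1) ^+ 2.
      by rewrite -(real_normK (num_real a)) lerXn2r ?nnegrE// ltW.
    have b2 : (a - p) ^+ 2 <= e1.
      rewrite -(real_normK (num_real (a - p))) expr2.
      apply: (@le_trans _ _ (1 * e1)); last by rewrite mul1r.
      apply: ler_pM => //; apply: (le_trans a2); rewrite ge_min lexx ?orbT//.
    have -> : a * b - p * q = a * (b - q) + (a - p) * q by ring.
    have := sqr_ge0 (a * (b - q) - (a - p) * q).
    have : a ^+ 2 * (b - q) ^+ 2 <= (M + 1) ^+ 2 * (b - q) ^+ 2 by rewrite ler_wpM2r ?sqr_ge0.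
    have : (a - p) ^+ 2 * q ^+ 2 <= e1 * q ^+ 2 by rewrite ler_wpM2r ?sqr_ge0.
    nra.
rewrite IntD; [|by apply: intgZ; apply: L2_sqr => //; exact: L2B|by apply: intgZ; exact: L2_sqr].
rewrite !IntZ; [|exact: L2_sqr|by apply: L2_sqr; exact: L2B].
have : 2 * (M + 1) ^+ 2 * N2 (fun x => g r x - v x) <= e / 2.
  apply: (@le_trans _ _ (2 * (M + 1) ^+ 2 * e3)).
    by rewrite ler_wpM2l// mulr_ge0// sqr_ge0.
  by rewrite /e3 le_eqVlt; apply/orP; left; apply/eqP; field; rewrite gt_eqF.
have : 2 * e1 * N2 v <= e / 2.
  apply: (@le_trans _ _ (2 * e1 * (N2 v + 1))).
    by rewrite ler_wpM2l ?lerDl// mulr_ge0// ltW.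
  by rewrite /e1 le_eqVlt; apply/orP; left; apply/eqP; field; rewrite gt_eqF.
lra.
Unshelve. all: by end_near. Qed.

End cvg.

Definition dL2 t f u := L2cvg (F := 0^') (fun h x => (f (t + h) x - f t x) / h) u.

Lemma is_derive_increment (y : R -> R) t l :
  (fun h => (y (t + h) - y t) / h) @ 0^' --> l -> is_derive t 1 y l.
Proof.
move=> H; have H' : (fun h => h^-1 *: ((y \o shift t) (h *: 1) - y t)) @ 0^' --> l.
  apply: cvg_trans _ H; apply: near_eq_cvg; near=> h.
  by rewrite /= /GRing.scale/= mulr1 mulrC (addrC h).
by apply: DeriveDef; [apply/cvg_ex; exists l|apply/cvg_lim].
Unshelve. all: by end_near. Qed.

(** The squared increment is [h ^+ 2] times the squared norm of the difference quotient, which has a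
    finite limit. *)
Lemma dL2_cont t f u : L2 (f t) -> dL2 t f u ->
  L2cvg (F := 0^') (fun h => f (t + h)) (f t).
Proof.
move=> ht d; have [hd hu dcv] := d.
have h0 : \forall h \near 0^', L2 (f (t + h)).
  near=> h; have hn0 : h != 0 by near: h; exact: nbhs_dnbhs_neq.
  have hdh : L2 (fun x => (f (t + h) x - f t x) / h) by near: h.
  apply: L2_ext (L2D (L2Z h hdh) ht) => x _.
  by rewrite mulrC mulfVK// subrK.
split => //.
have ip := L2cvg_ip (FF := dnbhs_filter (0 : R)) d d.
have c0 : (fun h : R => h ^+ 2) @ 0^' --> (0 : R).
  have : (fun h : R => h ^+ 2) @ (0 : R) --> (0 ^+ 2 : R) by exact: exprn_continuous.
  by rewrite expr0n/= => ?; apply: cvg_within_filter.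
have := cvgM c0 ip; rewrite mul0r => /(_ (dnbhs_filter _)); apply: cvg_near_eq.
near=> h; have hn0 : h != 0 by near: h; exact: nbhs_dnbhs_neq.
have hdh : L2 (fun x => (f (t + h) x - f t x) / h) by near: h.
rewrite /= -IntZ; last exact: L2_intgM.
by apply: Int_ext => x _; field.
Unshelve. all: by end_near. Qed.

Lemma dL2_ip t f g u v : L2 (f t) -> L2 (g t) -> dL2 t f u -> dL2 t g v ->
  is_derive t 1 (fun r => Int (fun x => f r x * g r x))
    (Int (fun x => u x * g t x + f t x * v x)).
Proof.
move=> hf hg df dg; apply: is_derive_increment.
have cg := dL2_cont hg dg; have cf := dL2_cont hf df.
have [_ hu _] := df; have [_ hv _] := dg.
rewrite IntD; [|exact: L2_intgM..].
have := cvgD (L2cvg_ip (FF := dnbhs_filter (0 : R)) df cg) (L2cvg_ip (FF := dnbhs_filter (0 : R)) (L2cvg_cst (FF := dnbhs_filter (0 : R)) hf) dg).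
move=> /(_ (dnbhs_filter _)); apply: cvg_near_eq; near=> h.
have hn0 : h != 0 by near: h; exact: nbhs_dnbhs_neq.
have h1 : L2 (f (t + h)) by near: h; case: cf.
have h2 : L2 (g (t + h)) by near: h; case: cg.
have h3 : L2 (fun x => (f (t + h) x - f t x) / h) by near: h; case: df.
have h4 : L2 (fun x => (g (t + h) x - g t x) / h) by near: h; case: dg.
rewrite -[LHS]/(Int (fun x => (f (t + h) x - f t x) / h * g (t + h) x) +
  Int (fun x => f t x * ((g (t + h) x - g t x) / h))).
rewrite -IntD; [|exact: L2_intgM..].
rewrite -IntB; [|exact: L2_intgM..].
rewrite mulrC -IntZ; last by apply: intgB; exact: L2_intgM.
by apply: Int_ext => x _; field.
Unshelve. all: by end_near. Qed.

Lemma dL2D t f g u v : dL2 t f u -> dL2 t g v ->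
  dL2 t (fun r x => f r x + g r x) (fun x => u x + v x).
Proof.
move=> df dg; apply: L2cvg_near (L2cvgD df dg).
by apply: nearW => h x _; rewrite -mulrDl; congr (_ / _); ring.
Qed.

Lemma dL2Z (c : R) t f u : dL2 t f u ->
  dL2 t (fun r x => c * f r x) (fun x => c * u x).
Proof.
move=> df; apply: L2cvg_near (L2cvgZ c df).
by apply: nearW => h x _; rewrite mulrA mulrBr.
Qed.

Lemma dL2_shift (a : R) t f u : dL2 (t + a) f u -> dL2 t (fun r => f (r + a)) u.
Proof.
by apply: L2cvg_near; apply: nearW => h x _; rewrite addrAC.
Qed.

Lemma dL2M t f g u v (M : R) : L2 (f t) -> L2 (g t) -> dL2 t f u -> dL2 t g v ->
  measurable_fun I (f t) -> (forall x, I x -> `|f t x| <= M) ->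
  measurable_fun I (g t) -> (forall x, I x -> `|g t x| <= M) ->
  supcvg (F := 0^') (fun h => g (t + h)) (g t) ->
  dL2 t (fun r x => f r x * g r x) (fun x => u x * g t x + f t x * v x).
Proof.
move=> hf hg df dg mf fM mg gM gs.
have mgh : \forall h \near 0^', measurable_fun I (g (t + h)).
  by have [h _ _] := dL2_cont hg dg; apply: filterS h => h; exact: L2_measurable.
have c1 := L2cvgM (FF := dnbhs_filter (0 : R)) mgh mg gM gs df.
have fs : supcvg (F := 0^') (fun=> f t) (f t).
  by move=> e e0; apply: nearW => h x _; rewrite subrr normr0 ltW.
have mf' : \forall h \near (0 : R)^', measurable_fun I (f t) by exact: nearW.
have c2 := L2cvgM (FF := dnbhs_filter (0 : R)) mf' mf fM fs dg.
have := L2cvgD (FF := dnbhs_filter (0 : R)) c1 c2; rewrite /dL2.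
have -> : (fun x => g t x * u x + f t x * v x) = (fun x => u x * g t x + f t x * v x).
  by apply/funext => x; rewrite mulrC.
by apply: L2cvg_near; apply: nearW => h x _; ring.
Qed.

(** The function y(t) exp(l t) does not increase. The rate [l] may have any sign; 0 is used for the
    conservation of the mean. *)
Lemma gronwall (y y' : R -> R) (l T : R) :
  (forall t, T <= t -> is_derive t 1 y (y' t)) ->
  (forall t, T <= t -> y' t <= - l * y t) ->
  forall t, T <= t -> y t <= y T * expR (- l * (t - T)).
Proof.
move=> dy le t Tt.
pose g r := y r * expR (l * r).
have dg r : T <= r -> is_derive r 1 g ((y' r + l * y r) * expR (l * r)).
  move=> Tr; have d1 := dy r Tr.
  have dl : is_derive r (1 : R) (fun r : R => l * r) l.
    by have := is_deriveZf l (is_derive_id r (1 : R)); rewrite mulr1.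
  have d2 : is_derive r (1 : R) (fun r : R => expR (l * r)) (expR (l * r) * l).
    exact: (@is_derive1_comp _ expR (fun r : R => l * r) r _ _ (is_derive_expR _) dl).
  by apply: is_derive_eq (is_deriveMf d1 d2) _; ring.
suff : g t <= g T.
  rewrite /g -ler_pdivlMr ?expR_gt0// => /le_trans; apply.
  rewrite -mulrA -expRN -expRD.
  by rewrite le_eqVlt; apply/orP; left; apply/eqP; congr (_ * expR _); ring.
have [->//|tT] := eqVneq t T.
have Tt' : T < t by rewrite lt_neqAle eq_sym tT.
have gd r : r \in `[T, t] -> is_derive r 1 g ((y' r + l * y r) * expR (l * r)).
  by rewrite in_itv/= => /andP[Tr _]; exact: dg.
apply: (@ler0_derive1_le_cc _ g T t); rewrite ?in_itv/= ?lexx//.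
- by move=> r /subset_itv_oo_cc /gd d; exact: ex_derive.
- move=> r /subset_itv_oo_cc ri; have d := gd r ri.
  rewrite derive1E derive_val mulr_le0_ge0 ?expR_ge0//.
  by move: ri; rewrite in_itv/= => /andP[/le]; lra.
- apply: derivable_within_continuous => r /gd d; exact: ex_derive.
- by rewrite Tt.
Qed.

End L2_calculus.

(** * Bounded functions, integration by parts and antiderivatives of mean zero *)

Section toolkit.
Variable R : realType.
Implicit Types (u v w : R -> R) (t x : R).

Local Notation mu := (@lebesgue_measure R).
Local Notation I := (`]0, 1[%classic : set R).
Local Notation Int f := (Rintegral mu I f).
Local Notation N2 f := (Int (fun x => f x ^+ 2)).

#[local] Existing Instance ae_filter.

(** Unlike L^2 this class is closed under products, so the integrability of any polynomial in such
    functions is settled by the tactic [bdd]. *)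
Definition bdd u := measurable_fun I u /\ exists M, forall x, I x -> `|u x| <= M.

Lemma I01 x : I x -> 0 <= x <= 1.
Proof. by move=> /in_I[x0 x1]; rewrite !ltW. Qed.

Lemma bdd_cst (a : R) : bdd (fun=> a).
Proof. by split; [exact: measurable_cst|exists `|a|]. Qed.

Lemma bddD u v : bdd u -> bdd v -> bdd (fun x => u x + v x).
Proof.
move=> [mu_ [M uM]] [mv [N vN]]; split; first exact: measurable_funD.
by exists (M + N) => x Ix; rewrite (le_trans (ler_normD _ _))// lerD ?uM ?vN.
Qed.

Lemma bddM u v : bdd u -> bdd v -> bdd (fun x => u x * v x).
Proof.
move=> [mu_ [M uM]] [mv [N vN]]; split; first exact: measurable_funM.
by exists (M * N) => x Ix; rewrite normrM ler_pM ?uM ?vN.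
Qed.

Lemma bddN u : bdd u -> bdd (fun x => - u x).
Proof.
move=> [mu_ [M uM]]; split; first exact: measurableT_comp.
by exists M => x Ix; rewrite normrN uM.
Qed.

Lemma bddX u n : bdd u -> bdd (fun x => u x ^+ n).
Proof.
move=> [mu_ [M uM]]; split; first exact: measurable_funX.
by exists (M ^+ n) => x Ix; rewrite normrX lerXn2r ?nnegrE ?uM// (le_trans _ (uM x Ix)).
Qed.

Lemma bdd_norm u : bdd u -> bdd (fun x => `|u x|).
Proof.
move=> [mu_ [M uM]]; split; first exact: measurableT_comp.
by exists M => x Ix; rewrite normr_id uM.
Qed.

Lemma bdd_sum n (u : nat -> R -> R) : (forall i, (i < n)%N -> bdd (u i)) ->
  bdd (fun x => \sum_(i < n) u i x).
Proof.
elim: n => [|n IH] h.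
  by have := bdd_cst 0; congr bdd; apply/funext => x; rewrite big_ord0.
have := bddD (IH (fun i ni => h i (ltnW ni))) (h n (ltnSn n)).
by congr bdd; apply/funext => x; rewrite big_ord_recr.
Qed.

Lemma bdd_L2 u : bdd u -> L2 u.
Proof. by move=> [m_u [M uM]]; exact: L2_bounded uM. Qed.

Lemma bdd_intg u : bdd u -> intg u.
Proof. by move=> /bdd_L2; exact: L2_intg. Qed.

Lemma bdd_L2M u v : bdd u -> L2 v -> L2 (fun x => u x * v x).
Proof. by move=> [m_u [M uM]]; exact: L2_boundedM uM. Qed.

Lemma ac_bdd u v : ac u v -> bdd u.
Proof.
move=> h; split; first exact: ac_measurable h.
by have [M uM] := ac_bounded h; exists M => x /I01; exact: uM.
Qed.

Lemma pd_bdd u v : pderiv u v -> bdd u. Proof. by move=> [/ac_bdd]. Qed.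

Lemma pd_L2 u v : pderiv u v -> L2 v. Proof. by move=> [[]]. Qed.

Lemma Int_sum n (u : nat -> R -> R) : (forall i, (i < n)%N -> intg (u i)) ->
  Int (fun x => \sum_(i < n) u i x) = \sum_(i < n) Int (u i).
Proof.
move=> hu; suff : intg (fun x => \sum_(i < n) u i x) /\
  Int (fun x => \sum_(i < n) u i x) = \sum_(i < n) Int (u i) by case.
elim: n hu => [|n IH] hu.
  rewrite big_ord0; split.
    by apply: intg_ext (intg_cst 0) => x _; rewrite big_ord0.
  by rewrite -[RHS]Int_cst; apply: Int_ext => x _; rewrite big_ord0.
have [i E] := IH (fun i ni => hu i (ltnW ni)); have hn := hu n (ltnSn n).
split; first by apply: intg_ext (intgD i hn) => x _; rewrite big_ord_recr.
rewrite big_ord_recr/= -E -IntD//.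
by apply: Int_ext => x _; rewrite big_ord_recr.
Qed.

(** The common form of all integrations by parts below: [f] is the explicit periodic function whose
    derivative is discarded, and the last hypothesis is a pointwise algebraic identity. *)
Lemma Int_total (Phi A F f : R -> R) : measurable_fun I Phi -> intg A ->
  pderiv f F -> aeq Phi (fun x => A x + F x) -> Int Phi = Int A.
Proof.
move=> mP iA pf E; have iF := L2_intg (pd_L2 pf).
rewrite (Int_aeq mP _ E); last by apply: intg_measurable; exact: intgD.
by rewrite IntD// (pderiv_Int0 pf) addr0.
Qed.

(** Normalised to mean zero, so that [ac_sup] and [ac_poincare] apply; it is periodic when [u] has
    mean zero. *)
Definition antid u x := prim u x - Int (prim u).

Lemma antid_ac u : L2 u -> ac (antid u) u.
Proof.
move=> hu; split => // x _; rewrite /antid prim0; ring.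
Qed.

Lemma antid_mean u : L2 u -> Int (antid u) = 0.
Proof.
move=> hu; have i := L2_intg (ac_L2 (prim_ac hu)).
by rewrite IntB// ?Int_cst ?subrr//; exact: intg_cst.
Qed.

Lemma antid_pderiv u : L2 u -> Int u = 0 -> pderiv (antid u) u.
Proof.
by move=> hu u0; split; [exact: antid_ac|rewrite /antid prim0 prim1 u0].
Qed.

Lemma antid_sup u x : L2 u -> 0 <= x <= 1 -> antid u x ^+ 2 <= N2 u.
Proof. by move=> hu; apply: ac_sup; [exact: antid_ac|exact: antid_mean]. Qed.

Lemma antid_N2 u : L2 u -> N2 (antid u) <= N2 u.
Proof. by move=> hu; apply: ac_poincare; [exact: antid_ac|exact: antid_mean]. Qed.

Lemma antidD u v : L2 u -> L2 v -> forall x,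
  antid (fun y => u y + v y) x = antid u x + antid v x.
Proof.
move=> hu hv x; have iu := L2_intg hu; have iv := L2_intg hv.
rewrite /antid primD//.
have -> : Int (prim (fun y => u y + v y)) = Int (fun x => prim u x + prim v x).
  by apply: Int_ext => y _; rewrite primD.
rewrite IntD; [ring|exact: L2_intg (ac_L2 (prim_ac _))..].
Qed.

Lemma antidZ (a : R) u : L2 u -> forall x,
  antid (fun y => a * u y) x = a * antid u x.
Proof.
move=> hu x; have iu := L2_intg hu.
rewrite /antid primZ//.
have -> : Int (prim (fun y => a * u y)) = Int (fun x => a * prim u x).
  by apply: Int_ext => y _; rewrite primZ.
rewrite IntZ; [ring|exact: L2_intg (ac_L2 (prim_ac _))].
Qed.

Lemma antid_aeq u v x : L2 u -> L2 v -> aeq u v -> antid u x = antid v x.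
Proof.
move=> hu hv uv; rewrite /antid (prim_aeq x _ _ uv); [|exact: L2_measurable..].
congr (_ - _); apply: Int_ext => y _; apply: prim_aeq => //; exact: L2_measurable.
Qed.

Lemma antid_pd u v x : pderiv u v -> Int u = 0 -> 0 <= x <= 1 -> antid v x = u x.
Proof.
move=> [hu _] u0 x01; have [hv uE] := hu.
have ip := L2_intg (ac_L2 (prim_ac hv)).
have : Int (fun x => u 0 + prim v x) = 0.
  by rewrite -[RHS]u0; apply: Int_ext => y Iy; rewrite (uE y)// I01.
rewrite IntD//; last exact: intg_cst.
by rewrite Int_cst /antid (uE x)// => /eqP; rewrite addr_eq0 => /eqP ->; rewrite addrC.
Qed.

(** [antid] is linear and does not increase the L^2 norm, so it commutes with the time
    derivative. *)
Lemma dL2_antid t f u : L2 (f t) -> dL2 t f u -> dL2 t (fun r => antid (f r)) (antid u).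
Proof.
move=> hf df; have [hfc _ _] := dL2_cont hf df; have [hd hu dcv] := df.
have E h x : L2 (f (t + h)) ->
    (antid (f (t + h)) x - antid (f t) x) / h = antid (fun y => (f (t + h) y - f t y) / h) x.
  move=> hh.
  have -> : (fun y => (f (t + h) y - f t y) / h) = (fun y => h^-1 * (f (t + h) y + (-1) * f t y)).
    by apply/funext => y; rewrite mulrC mulN1r.
  rewrite antidZ; last by apply: L2D => //; exact: L2Z.
  by rewrite antidD//; [rewrite antidZ// mulrC mulN1r|exact: L2Z].
split; [|exact: ac_L2 (antid_ac hu)|].
  apply: filterS2 hfc hd => h h1 h2; apply: L2_ext (ac_L2 (antid_ac h2)) => x _.
  by rewrite E.
apply: squeeze0 dcv; apply: filterS2 hfc hd => h h1 h2.
rewrite ger0_norm ?N2_ge0//.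
have hdu : L2 (fun x => (f (t + h) x - f t x) / h + (-1) * u x) by apply: L2D => //; exact: L2Z.
have -> : N2 (fun x => (antid (f (t + h)) x - antid (f t) x) / h - antid u x) =
    N2 (antid (fun x => (f (t + h) x - f t x) / h + (-1) * u x)).
  by apply: Int_ext => x _; rewrite E// antidD ?antidZ ?mulN1r//; exact: L2Z.
apply: (le_trans (antid_N2 hdu)); rewrite le_eqVlt; apply/orP; left; apply/eqP.
by apply: Int_ext => x _; rewrite mulN1r.
Qed.

Lemma supcvg_le (F : set_system R) (FF : Filter F) (f : R -> R -> R) u (B : R -> R) :
  (\forall r \near F, forall x, I x -> (f r x - u x) ^+ 2 <= B r) ->
  B @ F --> (0 : R) -> supcvg (F := F) f u.
Proof.
move=> fB /cvgrPdist_le B0 e e0; have e2 : 0 < e ^+ 2 by rewrite exprn_gt0.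
apply: filterS2 fB (B0 _ e2) => r H; rewrite sub0r normrN => Br x Ix.
rewrite -(@ler_pXn2r _ 2) ?nnegrE ?(ltW e0)// real_normK ?num_real//.
by rewrite (le_trans (H x Ix))// (le_trans (ler_norm _)).
Qed.

(** [antid] turns L^2 convergence into uniform convergence, which is what [dL2M] asks of a
    factor. *)
Lemma supcvg_antid t f : (\forall h \near 0^', L2 (f (t + h))) -> L2 (f t) ->
  L2cvg (F := 0^') (fun h => f (t + h)) (f t) ->
  supcvg (F := 0^') (fun h => antid (f (t + h))) (antid (f t)).
Proof.
move=> hf hft [_ _ cv]; apply: supcvg_le cv.
apply: filterS hf => h hh x /I01 x01.
have E : antid (f (t + h)) x - antid (f t) x = antid (fun y => f (t + h) y + (-1) * f t y) x.
  by rewrite antidD ?antidZ ?mulN1r//; exact: L2Z.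
have hd : L2 (fun y => f (t + h) y + (-1) * f t y) by apply: L2D => //; exact: L2Z.
rewrite E (le_trans (antid_sup hd x01))//.
rewrite le_eqVlt; apply/orP; left; apply/eqP.
by apply: Int_ext => y _; rewrite mulN1r.
Qed.

Lemma chainB s (g h : nat -> R -> R) : chain s g -> chain s h ->
  chain s (fun n x => g n x - h n x).
Proof.
move=> hg hh; have := chainD hg (chainZ (-1) hh).
by congr chain; apply/funext => n; apply/funext => x; rewrite mulN1r.
Qed.

(* Spatial part of the damped KdV equation and its derivatives, with [f] the
   derivatives of the unknown and [g] those of the nonlinear flux. *)
Definition kdv_rhs (d m c k : R) (f g : nat -> R -> R) n x :=
  - (d * f n.+3 x + m * f n.+1 x + c * g n.+1 x + k * f n x).

Lemma chain_rhs d m c k s f g : (3 <= s)%N -> chain s f -> chain s g ->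
  chain (s - 3) (kdv_rhs d m c k f g).
Proof.
move=> s3 hf hg.
have h3 : chain (s - 3) (fun n => f n.+3).
  by apply: (@chain_shiftn _ _ f 3); rewrite subnKC.
have h1 : chain (s - 3) (fun n => f n.+1).
  by apply: (@chain_shiftn _ _ f 1); apply: chain_le hf; rewrite -{2}(subnKC s3) leq_add2r.
have g1 : chain (s - 3) (fun n => g n.+1).
  by apply: (@chain_shiftn _ _ g 1); apply: chain_le hg; rewrite -{2}(subnKC s3) leq_add2r.
have h0 : chain (s - 3) f by apply: chain_le hf; exact: leq_subr.
have := chainZ (-1) (chainD (chainD (chainD (chainZ d h3) (chainZ m h1)) (chainZ c g1)) (chainZ k h0)).
by congr chain; apply/funext => n; apply/funext => x; rewrite mulN1r.
Qed.

End toolkit.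
Ltac bdd := repeat first [assumption | exact: bdd_cst | apply: bddN | apply: bddM
  | apply: bddX | apply: bdd_norm | apply: bddD].

(** * Decay for the scalar equation *)

Section scalar_decay.
Variable R : realType.
Implicit Types (t x h e : R).

Local Notation mu := (@lebesgue_measure R).
Local Notation I := (`]0, 1[%classic : set R).
Local Notation Int f := (Rintegral mu I f).
Local Notation N2 f := (Int (fun x => f x ^+ 2)).

#[local] Existing Instance ae_filter.

(** The unknown [z] is a deviation from the mean: [m] is the drift that the mean produces through
    the nonlinearity, and [c] multiplies (z^2)_x. Times are positive so that two-sided time
    increments make sense. *)
Variables (d m c k : R) (s : nat) (z zt : R -> nat -> R -> R).
Hypotheses (d0 : 0 < d) (k0 : 0 < k) (s3 : (3 <= s)%N).
Hypothesis zC : forall t, 0 < t -> chain s (z t).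
Hypothesis ztC : forall t, 0 < t -> chain (s - 3) (zt t).
Hypothesis z_mean : forall t, 0 < t -> Int (z t 0%N) = 0.
Hypothesis z_cont : forall t n, 0 < t -> (n <= s)%N ->
  L2cvg (F := 0^') (fun h => z (t + h) n) (z t n).
Hypothesis z_diff : forall t n, 0 < t -> (n <= s - 3)%N ->
  dL2 t (fun r => z r n) (zt t n).
Hypothesis z_eq : forall t, 0 < t ->
  aeq (zt t 0%N) (kdv_rhs d m c k (z t) (fun n => leib n (z t) (z t)) 0).

Lemma near_add_gt0 t : 0 < t -> \forall h \near (0 : R)^', 0 < t + h.
Proof.
move=> t0; apply: cvg_within; apply/nbhs_ballP; exists t => //= h.
by rewrite /ball/= sub0r normrN ltr_norml => /andP[+ _]; lra.
Qed.

Lemma zP t n : 0 < t -> (n < s)%N -> pderiv (z t n) (z t n.+1).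
Proof. by move=> t0 ns; have [_ h] := zC t0; exact: h. Qed.

Lemma zL2 t n : 0 < t -> (n <= s)%N -> L2 (z t n).
Proof. by move=> t0 ns; exact: chain_L2 (zC t0) ns. Qed.

Lemma ztL2 t n : 0 < t -> (n <= s - 3)%N -> L2 (zt t n).
Proof. by move=> t0 ns; exact: chain_L2 (ztC t0) ns. Qed.

Lemma z_bdd t n : 0 < t -> (n < s)%N -> bdd (z t n).
Proof. by move=> t0 ns; exact: pd_bdd (zP t0 ns). Qed.

Lemma z_mean_n t n : 0 < t -> (n <= s)%N -> Int (z t n) = 0.
Proof. by case: n => [|n] t0 ns; [exact: z_mean|exact: pderiv_Int0 (zP t0 ns)]. Qed.

Lemma z_sup t n x : 0 < t -> (n < s)%N -> I x -> z t n x ^+ 2 <= N2 (z t n.+1).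
Proof.
move=> t0 ns /I01 x01; apply: ac_sup (proj1 (zP t0 ns)) _ x01.
exact: z_mean_n (ltnW ns).
Qed.

Lemma z_poincare t n j : 0 < t -> (n <= j <= s)%N -> N2 (z t n) <= N2 (z t j).
Proof.
move=> t0 /andP[nj js]; elim: j nj js => [|j IH].
  by rewrite leqn0 => /eqP ->.
rewrite leq_eqVlt => /predU1P[->//|nj] js.
apply: (le_trans (IH nj (ltnW js))).
apply: ac_poincare (proj1 (zP t0 js)) _; exact: z_mean_n (ltnW js).
Qed.

Lemma z_diff0 t : 0 < t -> dL2 t (fun r => z r 0%N) (zt t 0%N).
Proof. by move=> t0; exact: z_diff. Qed.

Lemma ztL20 t : 0 < t -> L2 (zt t 0%N). Proof. by move=> t0; exact: ztL2. Qed.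

Lemma z_eqE t x : zt t 0%N x = kdv_rhs d m c k (z t) (fun n => leib n (z t) (z t)) 0 x ->
  zt t 0%N x = - (d * z t 3 x + m * z t 1 x + 2 * c * (z t 0%N x * z t 1 x) + k * z t 0%N x).
Proof. by move=> ->; rewrite /kdv_rhs/=; ring. Qed.

(** Both sides are chains of order [s - 3], so their agreement at order 0 passes to all
    derivatives. *)
Lemma z_eqn t n : 0 < t -> (n <= s - 3)%N ->
  aeq (zt t n) (kdv_rhs d m c k (z t) (fun n => leib n (z t) (z t)) n).
Proof.
move=> t0 ns; apply: chain_unique (ztC t0) _ (z_eq t0) ns.
apply: chain_rhs => //; first exact: zC.
by apply: chain_leib; [exact: leq_trans s3|exact: zC|exact: zC].
Qed.

(** After multiplication by 2 z, dispersion, drift and nonlinearity are derivatives of periodic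
    functions; only the damping survives, so the rate is exact. *)
Lemma energy0 t : 0 < t ->
  is_derive t 1 (fun r => N2 (z r 0%N)) (- (2 * k) * N2 (z t 0%N)).
Proof.
move=> t0; have dz := z_diff0 t0; have hz := zL2 t0 (leq0n s).
have p0 := zP t0 (leq_trans (isT : (0 < 3)%N) s3).
have p1 := zP t0 (leq_trans (isT : (1 < 3)%N) s3).
have p2 := zP t0 (leq_trans (isT : (2 < 3)%N) s3).
have b0 := pd_bdd p0.
have -> : (fun r => N2 (z r 0%N)) = (fun r => Int (fun x => z r 0%N x * z r 0%N x)).
  by apply/funext => r; apply: Int_ext => x _; rewrite expr2.
apply: is_derive_eq (dL2_ip hz hz dz dz) _.
rewrite -IntZ; last exact: L2_sqr.
apply: (Int_total (f := fun x => (-2) * (d * (z t 0%N x * z t 2 x + (- (1 / 2)) * (z t 1 x * z t 1 x))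
    + ((m / 2) * (z t 0%N x * z t 0%N x) + (2 * c / 3) * (z t 0%N x * (z t 0%N x * z t 0%N x)))))).
- have mt := L2_measurable (ztL20 t0); have mz := L2_measurable hz.
  by apply: measurable_funD; apply: measurable_funM.
- by apply: intgZ; exact: L2_sqr.
- apply: pderivZ; apply: pderivD.
    by apply: pderivZ; apply: pderivD; [exact: (pderivM p0 p2)|apply: pderivZ; exact: (pderivM p1 p1)].
  by apply: pderivD; apply: pderivZ; [exact: (pderivM p0 p0)|exact: (pderivM p0 (pderivM p0 p0))].
- by apply: filterS (z_eq t0) => x + Ix => /(_ Ix)/z_eqE ->; field.
Qed.

Lemma decay0 t : 1 <= t -> N2 (z t 0%N) <= N2 (z 1 0%N) * expR (- (2 * k) * (t - 1)).
Proof.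
apply: (@gronwall _ (fun r => N2 (z r 0%N)) (fun r => - (2 * k) * N2 (z r 0%N))) => r r1 //.
by apply: energy0; exact: lt_le_trans r1.
Qed.

Lemma energy1 t : 0 < t ->
  is_derive t 1 (fun r => N2 (z r 1%N)) (- 2 * Int (fun x => zt t 0%N x * z t 2 x)).
Proof.
move=> t0; have dz := z_diff0 t0.
have s2 : (2 < s)%N by []. have s1 : (1 < s)%N by exact: ltnW. have s0 : (0 < s)%N by exact: ltnW.
apply: is_derive_increment.
have cz2 := z_cont t0 (ltnW s2); have hz2 := zL2 t0 (ltnW s2).
have H := L2cvg_ip (FF := dnbhs_filter (0 : R)) dz
  (L2cvgD (FF := dnbhs_filter (0 : R)) cz2 (L2cvg_cst (FF := dnbhs_filter (0 : R)) hz2)).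
have {H} := cvgN H => /(_ (dnbhs_filter _)).
rewrite [X in _ --> X -> _](_ : _ = - 2 * Int (fun x => zt t 0%N x * z t 2 x)); last first.
  rewrite mulNr; congr (- _); rewrite -IntZ; last exact: L2_intgM (ztL20 t0) hz2.
  by apply: Int_ext => x _; ring.
apply: cvg_near_eq; near=> h.
have th0 : 0 < t + h by near: h; exact: near_add_gt0.
have hn0 : h != 0 by near: h; exact: nbhs_dnbhs_neq.
have p0 := zP t0 s0; have p1 := zP t0 s1; have q0 := zP th0 s0; have q1 := zP th0 s1.
have i (a : R) (b : R) : 0 < a -> 0 < b -> intg (fun x => z a 0%N x * z b 2 x).
  by move=> a0 b0; apply: L2_intgM; apply: zL2 => //; exact: ltnW.
have E : N2 (z (t + h) 1%N) - N2 (z t 1%N) =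
   Int (fun x => - ((z (t + h) 0%N x - z t 0%N x) * (z (t + h) 2 x + z t 2 x))).
  rewrite -IntB; [|by apply: L2_sqr; exact: zL2..].
  pose f x := (z (t + h) 0%N x + -1 * z t 0%N x) * (z (t + h) 1%N x + z t 1%N x).
  apply: (Int_total (f := f)).
  - apply: intg_measurable; apply: intgB; apply: L2_sqr; exact: zL2.
  - apply: intgN; apply: L2_intgM; [apply: L2B|apply: L2D]; apply: zL2 => //; exact: ltnW.
  - apply: pderivM; [apply: pderivD|apply: pderivD]; try eassumption.
    apply: pderivZ; eassumption.
  - by apply: aeq_ext => x _; ring.
rewrite E mulrC -IntZ.
  rewrite -[LHS]/(- Int (fun x => (z (t + h) 0%N x - z t 0%N x) / h * (z (t + h) 2 x + z t 2 x))).
  rewrite -IntN.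
    by apply: Int_ext => x _; field.
  apply: L2_intgM.
    apply: L2_ext (L2Z h^-1 (L2B (zL2 th0 (leq0n s)) (zL2 t0 (leq0n s)))) => x _; exact: mulrC.
  by apply: L2D; apply: zL2 => //; exact: ltnW.
by apply: intgN; apply: L2_intgM; [apply: L2B|apply: L2D]; apply: zL2 => //; exact: ltnW.
Unshelve. all: by end_near. Qed.

Lemma supcvg_z t : 0 < t -> supcvg (F := 0^') (fun h => z (t + h) 0%N) (z t 0%N).
Proof.
move=> t0; have s1 : (1 <= s)%N by exact: leq_trans s3.
have [_ _ cv] := z_cont t0 s1; apply: supcvg_le cv.
apply: filterS (near_add_gt0 t0) => h th x /I01 x01.
have hB := chainB (zC th) (zC t0).
have [hd _] := (proj2 hB) 0%N s1.
apply: (ac_sup hd) x01; rewrite IntB ?z_mean ?subrr//; apply: L2_intg; exact: zL2.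
Qed.

Lemma dzz t : 0 < t -> dL2 t (fun r x => z r 0%N x * z r 0%N x)
  (fun x => zt t 0%N x * z t 0%N x + z t 0%N x * zt t 0%N x).
Proof.
move=> t0; have dz := z_diff0 t0; have hz := zL2 t0 (leq0n s).
have [m_z [M zM]] := z_bdd t0 (leq_trans (isT : (0 < 3)%N) s3).
exact: (dL2M hz hz dz dz m_z zM m_z zM (supcvg_z t0)).
Qed.

(** Its variational derivative is minus the flux d z_xx + c z^2, whose x-derivative, with the drift
    and the damping, drives the equation. *)
Definition hamiltonian t :=
  d / 2 * N2 (z t 1%N) - c / 3 * Int (fun x => z t 0%N x * (z t 0%N x * z t 0%N x)).

(** The flux times its own x-derivative is exact, and so is the drift contribution; what remains is
    the damping paired with the variational derivative. *)
Lemma energyH t : 0 < t -> is_derive t 1 hamiltonian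
  (- (k * d) * N2 (z t 1%N) + k * c * Int (fun x => z t 0%N x * (z t 0%N x * z t 0%N x))).
Proof.
move=> t0; have dz := z_diff0 t0; have hz := zL2 t0 (leq0n s).
have p0 := zP t0 (leq_trans (isT : (0 < 3)%N) s3).
have p1 := zP t0 (leq_trans (isT : (1 < 3)%N) s3).
have p2 := zP t0 (leq_trans (isT : (2 < 3)%N) s3).
have b0 := pd_bdd p0; have b1 := pd_bdd p1; have b2 := pd_bdd p2.
have h20 : L2 (fun x => z t 0%N x * z t 0%N x) by apply: bdd_L2; bdd.
have hzt := ztL20 t0.
have d3 := dL2_ip hz h20 dz (dzz t0).
have := is_deriveDf (is_deriveZf (d / 2) (energy1 t0)) (is_deriveZf (- (c / 3)) d3).
have -> : (fun y => d / 2 * N2 (z y 1%N) + - (c / 3) *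
    Int (fun x => z y 0%N x * (z y 0%N x * z y 0%N x))) = hamiltonian.
  by apply/funext => r; rewrite /hamiltonian mulNr.
move=> D; apply: is_derive_eq D _.
have i1 : intg (fun x => zt t 0%N x * z t 2 x).
  by apply: L2_intgM => //; exact: bdd_L2.
have i2 : intg (fun x => zt t 0%N x * (z t 0%N x * z t 0%N x) +
    z t 0%N x * (zt t 0%N x * z t 0%N x + z t 0%N x * zt t 0%N x)).
  apply: intgD; first exact: L2_intgM.
  apply: L2_intgM => //; apply: L2D; last exact: bdd_L2M.
  by apply: L2_ext (bdd_L2M b0 hzt) => x _; rewrite mulrC.
have E : d / 2 * (- 2 * Int (fun x => zt t 0%N x * z t 2 x)) +
    - (c / 3) * Int (fun x => zt t 0%N x * (z t 0%N x * z t 0%N x) +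
      z t 0%N x * (zt t 0%N x * z t 0%N x + z t 0%N x * zt t 0%N x)) =
  Int (fun x => - d * (zt t 0%N x * z t 2 x) +
    - (c / 3) * (zt t 0%N x * (z t 0%N x * z t 0%N x) +
      z t 0%N x * (zt t 0%N x * z t 0%N x + z t 0%N x * zt t 0%N x))).
  by rewrite [RHS]IntD; [rewrite !IntZ//; field|exact: intgZ|exact: intgZ].
rewrite {}E.
have -> : - (k * d) * N2 (z t 1%N) + k * c * Int (fun x => z t 0%N x * (z t 0%N x * z t 0%N x)) =
   Int (fun x => - (k * d) * z t 1%N x ^+ 2 + k * c * (z t 0%N x * (z t 0%N x * z t 0%N x))).
  rewrite IntD; [|by apply: bdd_intg; bdd..].
  by rewrite !IntZ//; apply: bdd_intg; bdd.
(* Half the square of the flux d z_xx + c z^2, the two drift terms with [m], and [k * d] z z_x from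
   integrating z z_xx by parts. *)
pose f x := (d ^+ 2 / 2) * (z t 2 x * z t 2 x) + ((d * m / 2) * (z t 1%N x * z t 1%N x)
  + (c * d * (z t 0%N x * (z t 0%N x * z t 2 x)) + (c * m / 3 * (z t 0%N x * (z t 0%N x * z t 0%N x))
  + (c ^+ 2 / 2 * (z t 0%N x * (z t 0%N x * (z t 0%N x * z t 0%N x))) + k * d * (z t 0%N x * z t 1%N x))))).
apply: (Int_total (f := f)).
- by apply: intg_measurable; apply: intgD; do ?apply: intgZ.
- by apply: bdd_intg; bdd.
- apply: pderivD; first exact/pderivZ/(pderivM p2 p2).
  apply: pderivD; first exact/pderivZ/(pderivM p1 p1).
  apply: pderivD; first exact/pderivZ/(pderivM p0 (pderivM p0 p2)).
  apply: pderivD; first exact/pderivZ/(pderivM p0 (pderivM p0 p0)).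
  apply: pderivD; first exact/pderivZ/(pderivM p0 (pderivM p0 (pderivM p0 p0))).
  exact/pderivZ/(pderivM p0 p1).
- by apply: filterS (z_eq t0) => x + Ix => /(_ Ix)/z_eqE ->; field.
Qed.

(** The cubic term is at most sup |z| times the L^2 energy; [z_sup] and Young's inequality bound it
    by a fraction of the H^1 part plus a multiple of the squared energy, which decays at the rate
    [4 * k]. The rate [k] is half of the expected one and only serves [N1_small]. *)
Lemma decay1 : exists C, forall t, 1 <= t -> N2 (z t 1%N) <= C * expR (- k * (t - 1)).
Proof.
pose L1 := N2 (z 1 0%N).
pose B t := 2 * (c / 3) ^+ 2 / d * L1 ^+ 2 * expR (- (4 * k) * (t - 1)).
have dB t : is_derive t (1 : R) B (- (4 * k) * B t).
  have dl : is_derive t (1 : R) (fun r : R => - (4 * k) * (r - 1)) (- (4 * k)).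
    have := is_deriveZf (- (4 * k)) (is_deriveDf (is_derive_id t (1 : R)) (is_derive_cst (- 1 : R) t (1 : R))).
    by rewrite addr0 mulr1.
  have dE := @is_derive1_comp _ expR (fun r : R => - (4 * k) * (r - 1)) t _ _ (is_derive_expR _) dl.
  apply: is_derive_eq (is_deriveZf (2 * (c / 3) ^+ 2 / d * L1 ^+ 2) dE) _.
  by rewrite /B; ring.
have X0 : 0 <= 2 * (c / 3) ^+ 2 / d.
  by apply: divr_ge0; [apply: mulr_ge0 => //; exact: sqr_ge0|exact: ltW].
(* Any factor of [B] from 1 on would do: it keeps [Y] above [3 * d / 8 * N2 (z t 1)], and the fast
   decay of [B] pays for its presence in Y' <= - k Y. *)
pose Y t := hamiltonian t + 4 / 3 * B t.
have bound t : 1 <= t ->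
    `|c / 3 * Int (fun x => z t 0%N x * (z t 0%N x * z t 0%N x))| <= d / 8 * N2 (z t 1%N) + B t.
  move=> t1; have t0 : 0 < t by exact: lt_le_trans t1.
  have b0 := z_bdd t0 (leq_trans (isT : (0 < 3)%N) s3).
  set a := Int _; set S := N2 _; pose r := Num.sqrt S; pose L := N2 (z t 0%N).
  have S0 : 0 <= S by exact: N2_ge0.
  have rS : r ^+ 2 = S by rewrite sqr_sqrtr.
  have r0 : 0 <= r by exact: sqrtr_ge0.
  have L0 : 0 <= L by exact: N2_ge0.
  have aL : `|a| <= r * L.
    rewrite -IntZ; last by apply: bdd_intg; bdd.
    apply: le_trans (Int_norm _) _; first by apply: bdd_intg; bdd.
    apply: Int_le; [by apply: bdd_intg; bdd..|].
    move=> x Ix; rewrite normrM -expr2 [X in _ * X]ger0_norm ?sqr_ge0//.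
    rewrite ler_wpM2r ?sqr_ge0// /r -sqrtr_sqr; apply: ler_wsqrtr.
    by apply: z_sup => //; exact: leq_trans s3.
  have LB : 2 * (c / 3) ^+ 2 / d * L ^+ 2 <= B t.
    rewrite /B -[leRHS]mulrA ler_wpM2l//.
    have -> : expR (- (4 * k) * (t - 1)) = expR (- (2 * k) * (t - 1)) ^+ 2.
      by rewrite -expRM_natl; congr expR; ring.
    rewrite -exprMn lerXn2r ?nnegrE//; last exact: decay0.
    by apply: mulr_ge0; [exact: N2_ge0|exact: expR_ge0].
  apply: le_trans (lerD (lexx _) LB).
  rewrite normrM; apply: le_trans (ler_wpM2l (normr_ge0 _) aL) _.
  rewrite -rS -(real_normK (num_real (c / 3))).
  have := normr_ge0 (c / 3); set b := `|c / 3| => b0'.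
  have : 0 <= (d * r - 4 * (b * L)) ^+ 2 / (8 * d).
    by apply: divr_ge0; [exact: sqr_ge0|apply: mulr_ge0 => //; exact: ltW].
  have -> : (d * r - 4 * (b * L)) ^+ 2 / (8 * d) =
    d / 8 * r ^+ 2 + 2 * b ^+ 2 / d * L ^+ 2 - b * (r * L) by field; rewrite gt_eqF.
  by rewrite subr_ge0.
have dY t : 1 <= t -> is_derive t 1 Y
   (- (k * d) * N2 (z t 1%N) + k * c * Int (fun x => z t 0%N x * (z t 0%N x * z t 0%N x))
     + 4 / 3 * (- (4 * k) * B t)).
  move=> t1; apply: is_deriveDf; first by apply: energyH; exact: lt_le_trans t1.
exists (8 / (3 * d) * Y 1) => t t1.
have : Y t <= Y 1 * expR (- k * (t - 1)).
  apply: (gronwall dY _ t1) => r r1.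
  have := bound r r1; rewrite ler_norml /Y /hamiltonian.
  set a := Int (fun x => _ * (_ * _)); set S := N2 _; set b := B r => /andP[h1 h2].
  have := ler_wpM2l (ltW k0) h1; have := ler_wpM2l (ltW k0) h2.
  have : k * (c / 3 * a) = k * c * a / 3 by ring.
  have : 0 <= k * (d * S) by rewrite !mulr_ge0 ?N2_ge0// ltW.
  nra.
have := bound t t1; rewrite ler_norml {1}/Y /hamiltonian.
set a := Int (fun x => _ * (_ * _)); set S := N2 _; set b := B t; set e := expR _; set y := Y 1 => /andP[h1 h2] h3.
have d3 : 0 < 3 * d / 8 by rewrite divr_gt0// mulr_gt0.
rewrite -(ler_pM2l d3).
have -> : 3 * d / 8 * (8 / (3 * d) * y * e) = y * e by field; rewrite gt_eqF.
apply: le_trans h3.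
have b0 : 0 <= b.
  by apply: mulr_ge0; [apply: mulr_ge0 => //; exact: sqr_ge0|exact: expR_ge0].
lra.
Qed.

Lemma near_pinfty_gt0 : \forall t \near +oo, 0 < t :> R.
Proof. exact: nbhs_pinfty_gt. Qed.

Lemma expR_small C l e : 0 < l -> 0 < e ->
  \forall t \near +oo, C * expR (- l * t) <= e.
Proof.
move=> l0 e0; near=> t.
have t0 : 0 < t by near: t; exact: nbhs_pinfty_gt.
have lt0 : 0 < l * t by rewrite mulr_gt0.
apply: (@le_trans _ _ (`|C| * (l * t)^-1)).
  rewrite (le_trans (ler_wpM2r (expR_ge0 _) (ler_norm C)))// ler_wpM2l//.
  rewrite mulNr expRN lef_pV2 ?posrE ?expR_gt0//.
  by apply: le_trans (expR_ge1Dx _); rewrite lerDr.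
rewrite ler_pdivrMr// mulrA -ler_pdivrMl ?mulr_gt0//.
Unshelve. all: by end_near. Qed.

(** Meant for squared norms: rates below [2 * k] here are rates below [k] for the norm. *)
Definition decays (f : R -> R) := forall l, 0 < l -> l < 2 * k ->
  exists C, \forall t \near +oo, f t <= C * expR (- l * t).

Lemma decays_small f e : decays f -> 0 < e -> \forall t \near +oo, f t <= e.
Proof.
move=> df e0; have k2 : k < 2 * k by rewrite ltr_pMl// ltr1n.
have [C HC] := df k k0 k2.
have := expR_small C k0 e0; apply: filterS2 HC => t; exact: le_trans.
Qed.

Lemma decays_le f g : (\forall t \near +oo, f t <= g t) -> decays g -> decays f.
Proof.
move=> fg dg l l0 lk; have [C HC] := dg l l0 lk; exists C.
by apply: filterS2 fg HC => t; exact: le_trans.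
Qed.

Lemma decaysD f g : decays f -> decays g -> decays (fun t => f t + g t).
Proof.
move=> df dg l l0 lk; have [C HC] := df l l0 lk; have [D HD] := dg l l0 lk.
by exists (C + D); apply: filterS2 HC HD => t h1 h2; rewrite mulrDl lerD.
Qed.

Lemma decaysZ a f : 0 <= a -> decays f -> decays (fun t => a * f t).
Proof.
move=> a0 df l l0 lk; have [C HC] := df l l0 lk.
by exists (a * C); apply: filterS HC => t h1; rewrite -mulrA ler_wpM2l.
Qed.

Lemma decays_N0 : decays (fun t => N2 (z t 0%N)).
Proof.
move=> l l0 lk; exists (N2 (z 1 0%N) * expR (2 * k)); near=> t.
have t1 : 1 <= t by near: t; exact: nbhs_pinfty_ge.
apply: (le_trans (decay0 t1)); rewrite -mulrA ler_wpM2l ?N2_ge0//.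
rewrite -expRD ler_expR.
have : l * t <= 2 * k * t by rewrite ler_wpM2r ?(ltW lk)// (le_trans _ t1).
lra.
Unshelve. all: by end_near. Qed.

Lemma N1_small e : 0 < e -> \forall t \near +oo, N2 (z t 1%N) <= e.
Proof.
move=> e0; have [C HC] := decay1.
near=> t.
have t1 : 1 <= t by near: t; exact: nbhs_pinfty_ge.
apply: (le_trans (HC t t1)).
have -> : C * expR (- k * (t - 1)) = C * expR k * expR (- k * t).
  by rewrite -mulrA -expRD; congr (_ * expR _); ring.
by near: t; exact: expR_small.
Unshelve. all: by end_near. Qed.

(** * Time increments *)

Section time_increment.
Variable h : R.
Hypothesis h0 : 0 < h.

(** Here [dlt t n] is the n-th derivative of the increment w, [avg t n] that of the coefficient q,
    and [adlt t] below is W. *)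
Definition dlt t n x := z (t + h) n x - z t n x.
Definition avg t n x := 1 / 2 * (z (t + h) n x + z t n x).
Definition dltt t n x := zt (t + h) n x - zt t n x.

Let th t : 0 < t -> 0 < t + h. Proof. by move=> t0; exact: addr_gt0. Qed.

Lemma dlt_chain t : 0 < t -> chain s (dlt t).
Proof. by move=> t0; apply: chainB; apply: zC => //; exact: th. Qed.

Lemma avg_chain t : 0 < t -> chain s (avg t).
Proof. by move=> t0; apply: chainZ; apply: chainD; apply: zC => //; exact: th. Qed.

Lemma dlt_mean t n : 0 < t -> (n <= s)%N -> Int (dlt t n) = 0.
Proof.
move=> t0 ns; rewrite IntB ?z_mean_n ?subrr//; try exact: th.
  by apply: L2_intg; apply: zL2 => //; exact: th.
by apply: L2_intg; exact: zL2.
Qed.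

Lemma dlt_diff t n : 0 < t -> (n <= s - 3)%N ->
  dL2 t (fun r => dlt r n) (dltt t n).
Proof.
move=> t0 ns.
have D1 : dL2 t (fun r => z (r + h) n) (zt (t + h) n).
  by apply: (dL2_shift (f := fun r => z r n)); apply: z_diff => //; exact: th.
have := dL2D D1 (dL2Z (-1) (z_diff t0 ns)).
have -> : (fun r x => z (r + h) n x + -1 * z r n x) = (fun r => dlt r n).
  by apply/funext => r; apply/funext => x; rewrite mulN1r.
by have -> : (fun x => zt (t + h) n x + -1 * zt t n x) = dltt t n
  by apply/funext => x; rewrite mulN1r.
Qed.

Lemma avg_diff t n : 0 < t -> (n <= s - 3)%N ->
  dL2 t (fun r => avg r n) (fun x => 1 / 2 * (zt (t + h) n x + zt t n x)).
Proof.
move=> t0 ns; apply: dL2Z; apply: dL2D; last exact: z_diff.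
by apply: (dL2_shift (f := fun r => z r n)); apply: z_diff => //; exact: th.
Qed.

Lemma dltt_chain t : 0 < t -> chain (s - 3) (dltt t).
Proof. by move=> t0; apply: chainB; apply: ztC => //; exact: th. Qed.

(* z(t+h)^2 - z(t)^2 = 2 avg dlt *)
Lemma dltt_eqn t n : 0 < t -> (n <= s - 3)%N ->
  aeq (dltt t n) (kdv_rhs d m (2 * c) k (dlt t) (fun n => leib n (avg t) (dlt t)) n).
Proof.
move=> t0 ns; apply: (@chain_unique _ (s - 3)) ns; first exact: dltt_chain.
  apply: chain_rhs => //; first exact: dlt_chain.
  by apply: chain_leib; [exact: leq_trans s3|exact: avg_chain|exact: dlt_chain].
apply: filterS2 (z_eq (th t0)) (z_eq t0) => x e1 e2 Ix.
by rewrite /dltt e1// e2// /kdv_rhs/= /dlt /avg; field.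
Qed.

(** The average of two squares is the square of the average plus a quarter of the squared
    difference, hence the extra term in w w_x. *)
Lemma avg_eq t : 0 < t -> aeq (fun x => 1 / 2 * (zt (t + h) 0%N x + zt t 0%N x))
  (fun x => - (d * avg t 3 x + m * avg t 1 x
     + 2 * c * (avg t 0%N x * avg t 1 x + 1 / 4 * (dlt t 0%N x * dlt t 1 x)) + k * avg t 0%N x)).
Proof.
move=> t0; apply: filterS2 (z_eq (th t0)) (z_eq t0) => x e1 e2 Ix.
by rewrite e1// e2// /kdv_rhs/= /dlt /avg; field.
Qed.

Definition adlt t := antid (dlt t 0%N).

Let s0 : (0 < s)%N. Proof. exact: leq_trans s3. Qed.
Let s1 : (1 < s)%N. Proof. exact: leq_trans s3. Qed.
Let s2 : (2 < s)%N. Proof. exact: s3. Qed.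

Lemma dlt_L2 t n : 0 < t -> (n <= s)%N -> L2 (dlt t n).
Proof. by move=> t0; apply: chain_L2; exact: dlt_chain. Qed.

Lemma dlt_pd t n : 0 < t -> (n < s)%N -> pderiv (dlt t n) (dlt t n.+1).
Proof. by move=> t0; exact: (proj2 (dlt_chain t0)). Qed.

Lemma avg_pd t n : 0 < t -> (n < s)%N -> pderiv (avg t n) (avg t n.+1).
Proof. by move=> t0; exact: (proj2 (avg_chain t0)). Qed.

Lemma dltt_L2 t n : 0 < t -> (n <= s - 3)%N -> L2 (dltt t n).
Proof. by move=> t0; apply: chain_L2; exact: dltt_chain. Qed.

Lemma dlt_poincare t n j : 0 < t -> (n <= j <= s)%N -> N2 (dlt t n) <= N2 (dlt t j).
Proof.
move=> t0 /andP[nj js]; elim: j nj js => [|j IH].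
  by rewrite leqn0 => /eqP ->.
rewrite leq_eqVlt => /predU1P[->//|nj] js.
apply: (le_trans (IH nj (ltnW js))).
apply: ac_poincare (proj1 (dlt_pd t0 js)) _; exact: dlt_mean (ltnW js).
Qed.

Lemma adlt_pd t : 0 < t -> pderiv (adlt t) (dlt t 0%N).
Proof. by move=> t0; apply: antid_pderiv; [exact: dlt_L2|exact: dlt_mean]. Qed.

Lemma adlt_mean t : 0 < t -> Int (adlt t) = 0.
Proof. by move=> t0; apply: antid_mean; exact: dlt_L2. Qed.

Definition mixed t := Int (fun x => avg t 0%N x * dlt t 0%N x).

(** The equation of w integrated once in x. The mean-zero normalisation of [antid] fixes the
    constant of integration, and [mixed t] is the mean that must be subtracted from the product q
    w. *)
Lemma antid_dltt t x : 0 < t -> 0 <= x <= 1 ->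
  antid (dltt t 0%N) x = - (d * dlt t 2 x + m * dlt t 0%N x
    + 2 * c * (avg t 0%N x * dlt t 0%N x - mixed t) + k * adlt t x).
Proof.
move=> t0 x01.
have p0 := dlt_pd t0 s0; have p1 := dlt_pd t0 s1; have p2 := dlt_pd t0 s2.
have q0 := avg_pd t0 s0; have pW := adlt_pd t0.
have b0 := pd_bdd p0; have b1 := pd_bdd p1; have b2 := pd_bdd p2; have bq := pd_bdd q0.
have bW := pd_bdd pW.
pose V x := - 1 * (d * dlt t 2 x + (m * dlt t 0%N x +
   (2 * c * (avg t 0%N x * dlt t 0%N x + - mixed t) + k * adlt t x))).
have pV := pderivZ (- 1) (pderivD (pderivZ d p2) (pderivD (pderivZ m p0)
  (pderivD (pderivZ (2 * c) (pderivD (pderivM q0 p0) (pderiv_cst (- mixed t)))) (pderivZ k pW)))).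
rewrite (antid_aeq x (dltt_L2 t0 (leq0n _)) (pd_L2 pV)); last first.
  apply: filterS (dltt_eqn t0 (leq0n _)) => y + Iy => /(_ Iy) ->.
  by rewrite /kdv_rhs/=; ring.
rewrite (antid_pd pV) //; first by ring.
rewrite IntZ; last by apply: bdd_intg; bdd.
rewrite IntD; [|by apply: bdd_intg; bdd..].
rewrite IntD; [|by apply: bdd_intg; bdd..].
rewrite IntD; [|by apply: bdd_intg; bdd..].
rewrite !IntZ; try (by apply: bdd_intg; bdd).
rewrite IntD; [|by apply: bdd_intg; bdd..].
rewrite Int_cst -/(mixed t) subrr mulr0 adlt_mean// !dlt_mean// ?(ltnW s2)//.
by rewrite !mulr0 !addr0 mulr0.
Qed.

(* The energy balance of w = [dlt t 0] contains the integral of q_x w^2, where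
   q = [avg t 0], and q_x is not yet known to be small. Dispersion acting on the
   correction term q W^2, W_x = w, yields a multiple of the same integral, and
   [gam] is the coefficient for which the two cancel. *)
Definition gam := 2 * c / (3 * d).

Definition modified t := Int (fun x => dlt t 0%N x * dlt t 0%N x)
  - gam * Int (fun x => avg t 0%N x * (adlt t x * adlt t x)).

Lemma supcvg_adlt t : 0 < t -> supcvg (F := 0^') (fun e => adlt (t + e)) (adlt t).
Proof.
move=> t0; have hw := dlt_L2 t0 (leq0n s).
have cw := dL2_cont hw (dlt_diff t0 (leq0n _)).
by apply: (@supcvg_antid _ t (fun r => dlt r 0%N)) => //; case: cw.
Qed.

Lemma adlt_diff t : 0 < t -> dL2 t adlt (antid (dltt t 0%N)).
Proof.
by move=> t0; apply: dL2_antid; [exact: dlt_L2|exact: dlt_diff].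
Qed.

(** The integrand of the derivative of [modified], up to derivatives of periodic functions: the
    damping of w^2, and terms with an undifferentiated factor q or w, which is uniformly small. *)
Definition modified_rate t x :=
  - (2 * k) * (dlt t 0%N x * dlt t 0%N x)
  + 3 * k * gam * (avg t 0%N x * (adlt t x * adlt t x))
  + 2 * c * gam * (avg t 0%N x * (avg t 0%N x * (adlt t x * dlt t 0%N x))
      - 1 / 4 * (dlt t 0%N x * (dlt t 0%N x * (dlt t 0%N x * adlt t x)))
      - 2 * mixed t * (avg t 0%N x * adlt t x)).

Lemma modified_derive t : 0 < t -> is_derive t 1 modified (Int (modified_rate t)).
Proof.
move=> t0.
have p0 := dlt_pd t0 s0; have p1 := dlt_pd t0 s1; have p2 := dlt_pd t0 s2.
have q0 := avg_pd t0 s0; have q1 := avg_pd t0 s1; have q2 := avg_pd t0 s2.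
have pW := adlt_pd t0.
have b0 := pd_bdd p0; have b1 := pd_bdd p1; have b2 := pd_bdd p2.
have bq := pd_bdd q0; have bW := pd_bdd pW.
have hw := dlt_L2 t0 (leq0n s); have dw := dlt_diff t0 (leq0n (s - 3)).
have hq := bdd_L2 bq; have dq := avg_diff t0 (leq0n (s - 3)).
have hW := bdd_L2 bW; have dW := adlt_diff t0.
have [mW [M WM]] := bW.
have dWW := dL2M hW hW dW dW mW WM mW WM (supcvg_adlt t0).
have hWW : L2 (fun x => adlt t x * adlt t x) by apply: bdd_L2; bdd.
have := is_deriveDf (dL2_ip hw hw dw dw) (is_deriveZf (- gam) (dL2_ip hq hWW dq dWW)).
have -> : (fun y => Int (fun x => dlt y 0%N x * dlt y 0%N x) + - gam *
    Int (fun x => avg y 0%N x * (adlt y x * adlt y x))) = modified.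
  by apply/funext => r; rewrite /modified mulNr.
move=> D; apply: is_derive_eq D _.
have hwt := dltt_L2 t0 (leq0n (s - 3)).
have hqt : L2 (fun x => 1 / 2 * (zt (t + h) 0%N x + zt t 0%N x)).
  by apply: L2Z; apply: L2D; apply: ztL20 => //; exact: th.
have hWt : L2 (antid (dltt t 0%N)) := ac_L2 (antid_ac hwt).
have i1 : intg (fun x => dltt t 0%N x * dlt t 0%N x + dlt t 0%N x * dltt t 0%N x).
  by apply: intgD; exact: L2_intgM.
have i2 : intg (fun x => 1 / 2 * (zt (t + h) 0%N x + zt t 0%N x) * (adlt t x * adlt t x) +
    avg t 0%N x * (antid (dltt t 0%N) x * adlt t x + adlt t x * antid (dltt t 0%N) x)).
  apply: intgD; first exact: L2_intgM.
  apply: L2_intgM => //; apply: L2D; last exact: bdd_L2M.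
  by apply: L2_ext (bdd_L2M bW hWt) => x _; rewrite mulrC.
rewrite -IntZ// -IntD//; last exact: intgZ.
(* The block with [gam * d] has the derivative [gam * d] (q_xxx W^2 + 2 q W w_xx - 3 q_x w^2). Its
   last term cancels the - 2 c q_x w^2 left by the energy, as 3 [gam] d = 2 c. *)
pose f x := - 2 * (d * (dlt t 0%N x * dlt t 2 x + - (1 / 2) * (dlt t 1%N x * dlt t 1%N x))
    + m / 2 * (dlt t 0%N x * dlt t 0%N x))
  + (- (2 * c) * (avg t 0%N x * (dlt t 0%N x * dlt t 0%N x))
  + (gam * d * (avg t 2 x * (adlt t x * adlt t x) + (2 * (avg t 0%N x * (adlt t x * dlt t 1%N x))
      + (- 2 * (avg t 1%N x * (adlt t x * dlt t 0%N x)) + - 1 * (avg t 0%N x * (dlt t 0%N x * dlt t 0%N x)))))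
  + (gam * m * (avg t 0%N x * (adlt t x * adlt t x))
  + 2 * c * gam * (1 / 2 * (avg t 0%N x * (avg t 0%N x * (adlt t x * adlt t x)))
      + 1 / 8 * (dlt t 0%N x * (dlt t 0%N x * (adlt t x * adlt t x))))))).
apply: (Int_total (f := f)).
- by apply: intg_measurable; apply: intgD => //; exact: intgZ.
- by apply: bdd_intg; rewrite /modified_rate; bdd.
- apply: pderivD.
    apply: pderivZ; apply: pderivD; last exact/pderivZ/(pderivM p0 p0).
    apply: pderivZ; apply: pderivD; [exact: (pderivM p0 p2)|exact/pderivZ/(pderivM p1 p1)].
  apply: pderivD; first exact/pderivZ/(pderivM q0 (pderivM p0 p0)).
  apply: pderivD.
    apply: pderivZ; apply: pderivD; first exact: (pderivM q2 (pderivM pW pW)).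
    apply: pderivD; first exact/pderivZ/(pderivM q0 (pderivM pW p1)).
    apply: pderivD; first exact/pderivZ/(pderivM q1 (pderivM pW p0)).
    exact/pderivZ/(pderivM q0 (pderivM p0 p0)).
  apply: pderivD; first exact/pderivZ/(pderivM q0 (pderivM pW pW)).
  apply: pderivZ; apply: pderivD; apply: pderivZ.
    exact: (pderivM q0 (pderivM q0 (pderivM pW pW))).
  exact: (pderivM p0 (pderivM p0 (pderivM pW pW))).
- apply: filterS2 (dltt_eqn t0 (leq0n _)) (avg_eq t0) => x e1 e2 Ix.
  rewrite e1// e2// antid_dltt ?I01// /modified_rate /gam /kdv_rhs/=.
  field; by rewrite gt_eqF.
Qed.

(** The first term bounds the damping of q W^2. In the second, 8 is twice 3 + 1, from the bound e (3
    N + w^2) on the bracket of [modified_rate], whose integral is 4 e N. *)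
Definition rate_cst := 3 * k * `|gam| + 8 * `|c * gam|.

Section small_increment.
Variables (e t : R).
Hypotheses (e0 : 0 < e) (e1 : e <= 1) (t0 : 0 < t).
Hypothesis zle : forall x, I x -> `|z t 0%N x| <= e.
Hypothesis zhle : forall x, I x -> `|z (t + h) 0%N x| <= e.

Let avg_le x : I x -> `|avg t 0%N x| <= e.
Proof.
move=> Ix; rewrite /avg normrM ger0_norm//.
by have := ler_normD (z (t + h) 0%N x) (z t 0%N x); have := zle Ix; have := zhle Ix; lra.
Qed.

Let dlt_le x : I x -> `|dlt t 0%N x| <= 2 * e.
Proof.
move=> Ix; rewrite /dlt.
by have := ler_normB (z (t + h) 0%N x) (z t 0%N x); have := zle Ix; have := zhle Ix; lra.
Qed.

Let N := N2 (dlt t 0%N).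

Let N0 : 0 <= N. Proof. exact: N2_ge0. Qed.

Let adlt_le x : I x -> adlt t x ^+ 2 <= N.
Proof. by move=> /I01; apply: antid_sup; exact: dlt_L2. Qed.

Let bq : bdd (avg t 0%N). Proof. exact: pd_bdd (avg_pd t0 s0). Qed.
Let bw : bdd (dlt t 0%N). Proof. exact: pd_bdd (dlt_pd t0 s0). Qed.
Let bW : bdd (adlt t). Proof. exact: pd_bdd (adlt_pd t0). Qed.

Let mixed_le : mixed t ^+ 2 <= e ^+ 2 * N.
Proof.
apply: (le_trans (Cauchy_Schwarz (bdd_L2 bq) (bdd_L2 bw))).
rewrite ler_wpM2r// -[leRHS]Int_cst.
apply: Int_le; [exact/L2_sqr/bdd_L2|exact: intg_cst|].
move=> x Ix; rewrite -(real_normK (num_real (avg t 0%N x))) lerXn2r ?nnegrE ?(ltW e0)//.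
exact: avg_le.
Qed.

Let X1 x : I x -> `|avg t 0%N x * (adlt t x * adlt t x)| <= e * N.
Proof.
move=> Ix; rewrite normrM -expr2 [X in _ * X]ger0_norm ?sqr_ge0//.
by apply: ler_pM => //; [exact: sqr_ge0|exact: avg_le|exact: adlt_le].
Qed.

Lemma modified_N2 : `|modified t - N| <= `|gam| * (e * N).
Proof.
rewrite /modified.
have -> : Int (fun x => dlt t 0%N x * dlt t 0%N x) = N.
  by apply: Int_ext => x _; rewrite expr2.
rewrite addrAC subrr add0r normrN normrM ler_wpM2l//.
apply: (le_trans (Int_norm _)); first by apply: bdd_intg; bdd.
rewrite -[leRHS]Int_cst; apply: Int_le; [by apply: bdd_intg; bdd|exact: intg_cst|].
exact: X1.
Qed.

Let X23 x a b : I x -> `|a| <= e -> `|b| <= e ->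
  `|a * (b * (adlt t x * dlt t 0%N x))| <= e * (1 / 2 * (N + dlt t 0%N x ^+ 2)).
Proof.
move=> Ix ae be; rewrite !normrM.
have W2 := adlt_le Ix.
apply: ler_pM => //.
apply: (@le_trans _ _ (1 * (`|adlt t x| * `|dlt t 0%N x|))).
  by rewrite ler_wpM2r ?mulr_ge0// (le_trans be).
rewrite mul1r -(real_normK (num_real (dlt t 0%N x))).
move: W2; rewrite -(real_normK (num_real (adlt t x))).
by have := sqr_ge0 (`|adlt t x| - `|dlt t 0%N x|); nra.
Qed.

Lemma modified_rate_le : Int (modified_rate t) <= (- (2 * k) + rate_cst * e) * N.
Proof.
pose B x := (- (2 * k) + 2 * `|c * gam| * e) * dlt t 0%N x ^+ 2
  + (3 * k * `|gam| + 6 * `|c * gam|) * e * N.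
have -> : (- (2 * k) + rate_cst * e) * N = Int B.
  rewrite IntD; [|by apply: bdd_intg; bdd|exact: intg_cst].
  rewrite Int_cst IntZ; last by apply: bdd_intg; bdd.
  by rewrite -/N /rate_cst; ring.
apply: Int_le; [by apply: bdd_intg; rewrite /modified_rate; bdd|by apply: bdd_intg; rewrite /B; bdd|].
move=> x Ix; rewrite /modified_rate /B.
have x1 := X1 Ix.
have q1 := avg_le Ix; have w1 := dlt_le Ix.
have x2 := X23 Ix q1 q1.
have wh : `|1 / 2 * dlt t 0%N x| <= e by rewrite normrM ger0_norm//; lra.
have x3 := X23 Ix wh wh.
have x4 : `|mixed t * (avg t 0%N x * adlt t x)| <= e * N.
  have h1 : `|mixed t * adlt t x| <= e * N.
    rewrite -(@ler_pXn2r _ 2) ?nnegrE ?mulr_ge0 ?(ltW e0)//.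
    rewrite real_normK ?num_real// exprMn.
    apply: (@le_trans _ _ (e ^+ 2 * N * N)).
      by apply: ler_pM; rewrite ?sqr_ge0//; exact: adlt_le.
    by rewrite exprMn -mulrA -expr2.
  rewrite mulrCA normrM; apply: (@le_trans _ _ (1 * (e * N))); last by rewrite mul1r.
  by apply: ler_pM => //; exact: le_trans e1.
have G1 : 3 * k * gam * (avg t 0%N x * (adlt t x * adlt t x)) <= 3 * k * `|gam| * (e * N).
  apply: (le_trans (ler_norm _)); rewrite normrM; apply: ler_pM => //.
  by rewrite !normrM ger0_norm// [`|k|]gtr0_norm.
set Z := avg t 0%N x * (avg t 0%N x * _) - _ - _.
have ZE : Z = avg t 0%N x * (avg t 0%N x * (adlt t x * dlt t 0%N x))
   - (1 / 2 * dlt t 0%N x) * ((1 / 2 * dlt t 0%N x) * (adlt t x * dlt t 0%N x))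
   - 2 * (mixed t * (avg t 0%N x * adlt t x)) by rewrite /Z; field.
have G2 : 2 * c * gam * Z <= 2 * `|c * gam| * (e * (3 * N + dlt t 0%N x ^+ 2)).
  apply: (le_trans (ler_norm _)).
  have -> : 2 * c * gam * Z = 2 * (c * gam * Z) by ring.
  rewrite -[leRHS]mulrA normrM ger0_norm// [`|c * gam * Z|]normrM.
  apply: ler_wpM2l => //; apply: ler_wpM2l => //.
  rewrite ZE; apply: (le_trans (ler_normB _ _)); apply: (le_trans (lerD (ler_normB _ _) (lexx _))).
  rewrite [X in _ + X]normrM [`|2|]ger0_norm//.
  lra.
have -> : dlt t 0%N x * dlt t 0%N x = dlt t 0%N x ^+ 2 by rewrite expr2.
lra.
Qed.

End small_increment.

(** For [|gam| * e] at most 1/2, [modified] lies between 1/2 and 3/2 of the squared norm, whence the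
    factor 3. No constant depends on [h]. *)
Lemma dlt_decay l T e : 0 < l -> l < 2 * k -> 0 < e -> e <= 1 -> 0 < T ->
  `|gam| * e <= 1 / 2 -> (rate_cst + l * `|gam|) * e <= 2 * k - l ->
  (forall t x, T <= t -> I x -> `|z t 0%N x| <= e) ->
  forall t, T <= t -> N2 (dlt t 0%N) <= 3 * N2 (dlt T 0%N) * expR (- l * (t - T)).
Proof.
move=> l0 lk e0 e1 T0 ge re zle t Tt.
have pos r : T <= r -> 0 < r by exact: lt_le_trans.
have zle1 r : T <= r -> forall x, I x -> `|z (r + h) 0%N x| <= e.
  by move=> Tr x; apply: zle; rewrite (le_trans Tr)// lerDl ltW.
have bnd r : T <= r -> `|modified r - N2 (dlt r 0%N)| <= `|gam| * (e * N2 (dlt r 0%N)).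
  move=> Tr; apply: modified_N2; [exact: pos|by move=> x; exact: zle|exact: zle1].
have dM r : T <= r -> is_derive r 1 modified (Int (modified_rate r)).
  by move=> Tr; exact: modified_derive (pos r Tr).
have key : modified t <= modified T * expR (- l * (t - T)).
  apply: (gronwall dM _ Tt) => r Tr.
  have Hr := modified_rate_le e0 e1 (pos r Tr) (fun x => @zle r x Tr) (zle1 r Tr).
  apply: (le_trans Hr); have := bnd r Tr; rewrite ler_norml => /andP[_].
  have := N2_ge0 (dlt r 0%N); set n := N2 _ => n0; set M := modified r => b.
  have : l * (M - n) <= l * (`|gam| * (e * n)) by rewrite ler_wpM2l// ltW.
  have : (rate_cst + l * `|gam|) * e * n <= (2 * k - l) * n by rewrite ler_wpM2r.
  lra.
have := bnd t Tt; have := bnd T (lexx T); rewrite !ler_norml.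
have := N2_ge0 (dlt t 0%N); have := N2_ge0 (dlt T 0%N).
move: key; set n := N2 (dlt t 0%N); set nT := N2 (dlt T 0%N); set E := expR _.
set M := modified t; set MT := modified T => key nT0 n0 /andP[_ h1] /andP[h2 _].
have E0 : 0 <= E by exact: expR_ge0.
have : `|gam| * e * n <= 1 / 2 * n by rewrite ler_wpM2r.
have g1 : `|gam| * e * nT <= 1 / 2 * nT by rewrite ler_wpM2r.
have : MT * E <= 3 / 2 * nT * E by rewrite ler_wpM2r//; lra.
lra.
Qed.

(** The top Leibniz term q w_(n+1), paired with w_n, is half the derivative of q w_n^2 minus q_x
    w_n^2 / 2; this gives the last summand, and the middle one holds the other Leibniz terms. *)
Definition higher_rate t n x :=
  - (2 * k) * dlt t n x ^+ 2
  + - (4 * c) * (dlt t n x * (leib n.+1 (avg t) (dlt t) x - avg t 0%N x * dlt t n.+1 x))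
  + 2 * c * (avg t 1%N x * dlt t n x ^+ 2).

Let leib_bdd t n : 0 < t -> (n <= s - 3)%N -> bdd (leib n.+1 (avg t) (dlt t)).
Proof.
move=> t0 ns; apply: pd_bdd; apply: leib_pderiv.
  apply: chain_le (avg_chain t0); rewrite -[leqRHS](subnK s3) addn3 !ltnS.
  exact: leq_trans ns _.
apply: chain_le (dlt_chain t0); rewrite -[leqRHS](subnK s3) addn3 !ltnS.
exact: leq_trans ns _.
Qed.

Let nlt n : (n <= s - 3)%N -> [/\ (n < s)%N, (n.+1 < s)%N & (n.+2 < s)%N].
Proof.
move=> ns; have : (n.+2 < s)%N by rewrite -(subnK s3) addn3 !ltnS.
by move=> h2; split => //; apply: ltnW => //; exact: ltnW.
Qed.

Lemma higher_derive t n : 0 < t -> (n <= s - 3)%N ->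
  is_derive t 1 (fun r => N2 (dlt r n)) (Int (higher_rate t n)).
Proof.
move=> t0 ns; have [n0 n1 n2] := nlt ns.
have p0 := dlt_pd t0 n0; have p1 := dlt_pd t0 n1; have p2 := dlt_pd t0 n2.
have q0 := avg_pd t0 s0; have q1 := avg_pd t0 s1.
have b0 := pd_bdd p0; have b1 := pd_bdd p1; have bq := pd_bdd q0; have bq1 := pd_bdd q1.
have bl := leib_bdd t0 ns.
have hw := bdd_L2 b0; have dw := dlt_diff t0 ns; have hwt := dltt_L2 t0 ns.
have -> : (fun r => N2 (dlt r n)) = (fun r => Int (fun x => dlt r n x * dlt r n x)).
  by apply/funext => r; apply: Int_ext => x _; rewrite expr2.
apply: is_derive_eq (dL2_ip hw hw dw dw) _.
pose f x := - (2 * d) * (dlt t n x * dlt t n.+2 x + - (1 / 2) * (dlt t n.+1 x * dlt t n.+1 x))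
  + (- m * (dlt t n x * dlt t n x) + - (2 * c) * (avg t 0%N x * (dlt t n x * dlt t n x))).
apply: (Int_total (f := f)).
- by apply: intg_measurable; apply: intgD; exact: L2_intgM.
- by apply: bdd_intg; rewrite /higher_rate; bdd.
- apply: pderivD.
    apply: pderivZ; apply: pderivD; [exact: (pderivM p0 p2)|exact/pderivZ/(pderivM p1 p1)].
  apply: pderivD; first exact/pderivZ/(pderivM p0 p0).
  exact/pderivZ/(pderivM q0 (pderivM p0 p0)).
- apply: filterS (dltt_eqn t0 ns) => x e1 Ix.
  rewrite e1// /higher_rate /kdv_rhs; by move: (leib n.+1 _ _ x) => L; field.
Qed.

(** The power of 2 comes from [leib_top], and [n.+1] counts the derivatives of w in its sum, each
    bounded by the n-th one through Poincare; the last term bounds the summand with [avg t 1]. *)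
Definition higher_cst n := 4 * `|c| * 2 ^+ n.+1 * n.+1%:R + 2 * `|c|.

Lemma higher_rate_le e t n : 0 <= e -> 0 < t -> (n <= s - 3)%N ->
  (forall j x, (0 < j <= n.+1)%N -> I x -> `|avg t j x| <= e) ->
  Int (higher_rate t n) <= (- (2 * k) + higher_cst n * e) * N2 (dlt t n).
Proof.
move=> e0 t0 ns qe; have [n0 n1 n2] := nlt ns.
have bj j : (j < n.+1)%N -> bdd (dlt t j).
  by move=> jn; exact: pd_bdd (dlt_pd t0 (leq_trans jn n0)).
have b0 := bj n (ltnSn n); have b1 := pd_bdd (dlt_pd t0 n1).
have bq := pd_bdd (avg_pd t0 s0); have bq1 := pd_bdd (avg_pd t0 s1).
have bl := leib_bdd t0 ns.
pose Sm x := \sum_(j < n.+1) (1 / 2 * (dlt t n x ^+ 2 + dlt t j x ^+ 2)).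
have bS : bdd Sm.
  apply: (@bdd_sum _ n.+1 (fun j x => 1 / 2 * (dlt t n x ^+ 2 + dlt t j x ^+ 2))).
  by move=> j jn; have bjj := bj j jn; bdd.
pose B x := (- (2 * k) + 2 * `|c| * e) * dlt t n x ^+ 2 + 4 * `|c| * 2 ^+ n.+1 * e * Sm x.
apply: (@le_trans _ _ (Int B)).
  apply: Int_le; [by apply: bdd_intg; rewrite /higher_rate; bdd|by apply: bdd_intg; rewrite /B; bdd|].
  move=> x Ix; rewrite /higher_rate /B.
  have := @leib_top R n.+1 (avg t) (dlt t) x e e0 (fun j jn => qe j x jn Ix).
  set L := leib _ _ _ _ - _ => Lb.
  have w0 := normr_ge0 (dlt t n x).
  have LS : `|dlt t n x * L| <= 2 ^+ n.+1 * (e * Sm x).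
    rewrite normrM; apply: (le_trans (ler_wpM2l w0 Lb)).
    rewrite mulrCA ler_wpM2l ?exprn_ge0// mulrCA ler_wpM2l// /Sm mulr_sumr.
    apply: ler_sum => j _; rewrite -(real_normK (num_real (dlt t n x))).
    rewrite -(real_normK (num_real (dlt t j x))).
    by have := sqr_ge0 (`|dlt t n x| - `|dlt t j x|); nra.
  have T1 : - (4 * c) * (dlt t n x * L) <= 4 * `|c| * (2 ^+ n.+1 * (e * Sm x)).
    apply: (le_trans (ler_norm _)); rewrite normrM normrN normrM ger0_norm//.
    by apply: ler_wpM2l => //; rewrite mulr_ge0.
  have T2 : 2 * c * (avg t 1%N x * dlt t n x ^+ 2) <= 2 * `|c| * (e * dlt t n x ^+ 2).
    apply: (le_trans (ler_norm _)); rewrite normrM [`|2 * c|]normrM ger0_norm//.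
    apply: ler_wpM2l; first by rewrite mulr_ge0.
    rewrite normrM [X in _ * X]ger0_norm ?sqr_ge0// ler_wpM2r ?sqr_ge0//.
    exact: qe.
  lra.
rewrite IntD; [|by apply: bdd_intg; bdd..].
rewrite !IntZ; [|by apply: bdd_intg; bdd..].
have SN : Int Sm <= n.+1%:R * N2 (dlt t n).
  rewrite (@Int_sum _ n.+1 (fun j x => 1 / 2 * (dlt t n x ^+ 2 + dlt t j x ^+ 2))); last first.
    by move=> j jn; have bjj := bj j jn; apply: bdd_intg; bdd.
  rewrite mulr_natl -[n.+1 in leRHS]card_ord -sumr_const; apply: ler_sum => j _.
  have bjj := bj j (ltn_ord j).
  rewrite IntZ; last by apply: bdd_intg; bdd.
  rewrite IntD; [|by apply: bdd_intg; bdd..].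
  suff : N2 (dlt t j) <= N2 (dlt t n) by lra.
  by apply: dlt_poincare => //; rewrite -ltnS ltn_ord (ltnW n0).
rewrite /higher_cst; have N0 := N2_ge0 (dlt t n).
have : 4 * `|c| * 2 ^+ n.+1 * e * Int Sm <= 4 * `|c| * 2 ^+ n.+1 * e * (n.+1%:R * N2 (dlt t n)).
  by apply: ler_wpM2l => //; rewrite !mulr_ge0// exprn_ge0.
lra.
Qed.

(** The plain energy suffices, in contrast with [modified]: the derivatives of q that occur, q_x
    included, are now uniformly small. *)
Lemma higher_decay l T e n : 0 <= e -> 0 < T -> (n <= s - 3)%N ->
  higher_cst n * e <= 2 * k - l ->
  (forall t j x, T <= t -> (0 < j <= n.+1)%N -> I x -> `|z t j x| <= e) ->
  forall t, T <= t -> N2 (dlt t n) <= N2 (dlt T n) * expR (- l * (t - T)).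
Proof.
move=> e0 T0 ns ce ze t Tt.
have pos r : T <= r -> 0 < r by exact: lt_le_trans.
have dM r : T <= r -> is_derive r 1 (fun r => N2 (dlt r n)) (Int (higher_rate r n)).
  by move=> Tr; exact: higher_derive (pos r Tr) ns.
apply: (gronwall dM _ Tt) => r Tr.
apply: (le_trans (higher_rate_le e0 (pos r Tr) ns _)) => [j x jn Ix|].
  rewrite /avg normrM ger0_norm//.
  have := ler_normD (z (r + h) j x) (z r j x).
  have := ze r j x Tr jn Ix.
  have Th : T <= r + h by rewrite (le_trans Tr)// lerDl ltW.
  have := ze (r + h) j x Th jn Ix; lra.
by apply: ler_wpM2r; [exact: N2_ge0|lra].
Qed.

End time_increment.

(** * From increments to the time derivative, and the gain of space derivatives *)

Lemma zt_N2_le t T n K : 0 < t -> 0 < T -> (n <= s - 3)%N ->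
  (forall h, 0 < h -> N2 (dlt h t n) <= K * N2 (dlt h T n)) ->
  N2 (zt t n) <= K * N2 (zt T n).
Proof.
move=> t0 T0 ns H.
(* The limit is taken from the right, because the bounds on the increments assume [0 < h]. *)
have L r : 0 < r -> (fun h => h ^- 2 * N2 (dlt h r n)) @ (0 : R)^'+ --> N2 (zt r n).
  move=> r0; have dz := z_diff r0 ns.
  have := L2cvg_ip (FF := dnbhs_filter (0 : R)) dz dz.
  have -> : Int (fun x => zt r n x * zt r n x) = N2 (zt r n).
    by apply: Int_ext => x _; rewrite expr2.
  move=> /cvg_dnbhs_at_right cv.
  apply: cvg_near_eq cv; near=> h.
  have h0 : 0 < h by near: h; exact: nbhs_right_gt.
  have rh : 0 < r + h by exact: addr_gt0.
  rewrite -IntZ; last by apply: L2_sqr; apply: chain_L2 (dlt_chain h0 r0) _; exact: leq_trans ns (leq_subr _ _).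
  by apply: Int_ext => x _; rewrite /dlt; field; rewrite gt_eqF.
have LK : (fun h => K * (h ^- 2 * N2 (dlt h T n))) @ (0 : R)^'+ --> K * N2 (zt T n).
  exact: cvgMr (L T T0).
apply: (ler_cvg_to (L t t0) LK).
near=> h; have h0 : 0 < h by near: h; exact: nbhs_right_gt.
rewrite mulrCA ler_wpM2l ?invr_ge0 ?sqr_ge0//; exact: H.
Unshelve. all: by end_near. Qed.

Lemma near_from (P : R -> Prop) : (\forall t \near +oo, P t) ->
  exists2 T, 0 < T & forall t, T <= t -> P t.
Proof.
move=> [M [_ HM]]; exists (Num.max M 0 + 1); first by rewrite ltr_wpDl// le_max lexx orbT.
move=> t Tt; apply: HM; apply: lt_le_trans Tt.
by rewrite ltr_pwDr// le_max lexx.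
Qed.

Lemma sup_small n e : (n < s)%N -> 0 < e ->
  (\forall t \near +oo, N2 (z t n.+1) <= e ^+ 2) ->
  \forall t \near +oo, forall x, I x -> `|z t n x| <= e.
Proof.
move=> ns e0; apply: filterS2 near_pinfty_gt0 => t t0 Ht x Ix.
rewrite -(@ler_pXn2r _ 2) ?nnegrE ?(ltW e0)// real_normK ?num_real//.
exact: le_trans (z_sup t0 ns Ix) Ht.
Qed.

Lemma small_param (a b : R) : 0 <= a -> 0 < b -> exists e, [/\ 0 < e, e <= 1 & a * e <= b].
Proof.
move=> a0 b0; exists (Num.min 1 (b / (a + 1))).
have a1 : 0 < a + 1 by rewrite ltr_wpDl.
split; first by rewrite lt_min ltr01 divr_gt0.
  by rewrite ge_min lexx.
apply: (@le_trans _ _ ((a + 1) * (b / (a + 1)))).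
  apply: ler_pM => //; first by rewrite le_min ler01 divr_ge0// ltW.
    by rewrite lerDl.
  by rewrite ge_min lexx orbT.
by rewrite mulrC divfK// gt_eqF.
Qed.

Lemma decays_of_ineq (f : R -> R) :
  (forall l, 0 < l -> l < 2 * k -> exists T K, 0 < T /\
    forall t, T <= t -> f t <= K * expR (- l * (t - T))) -> decays f.
Proof.
move=> H l l0 lk; have [T [K [T0 HT]]] := H l l0 lk.
exists (K * expR (l * T)); near=> t.
have Tt : T <= t by near: t; apply: nbhs_pinfty_ge; exact: num_real.
apply: (le_trans (HT t Tt)); rewrite -mulrA -expRD.
by rewrite le_eqVlt; apply/orP; left; apply/eqP; congr (_ * expR _); ring.
Unshelve. all: by end_near. Qed.

Lemma decays_zt0 : decays (fun t => N2 (zt t 0%N)).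
Proof.
apply: decays_of_ineq => l l0 lk.
(* One [e] meets both smallness conditions of [dlt_decay]: the sum of their coefficients dominates
   each of them, and the minimum below is under both right-hand sides. *)
have A0 : 0 <= `|gam| + (rate_cst + l * `|gam|).
  by rewrite /rate_cst !addr_ge0// !mulr_ge0// ltW.
have b0 : 0 < Num.min (1 / 2) (2 * k - l) by rewrite lt_min subr_gt0 lk divr_gt0.
have [e [e0 e1 Ae]] := small_param A0 b0.
have e20 : 0 < e ^+ 2 by rewrite exprn_gt0.
have [T T0 HT] := near_from (sup_small (leq_trans (isT : (0 < 3)%N) s3) e0 (N1_small e20)).
exists T, (3 * N2 (zt T 0%N)); split => // t Tt.
have t0 : 0 < t by exact: lt_le_trans Tt.
rewrite mulrAC; apply: zt_N2_le => // h h0.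
rewrite mulrAC; apply: (dlt_decay h0 l0 lk e0 e1 T0) => //.
- apply: (le_trans _ (_ : Num.min (1 / 2) (2 * k - l) <= _)); last by rewrite ge_min lexx.
  apply: le_trans Ae; rewrite ler_wpM2r ?(ltW e0)// lerDl /rate_cst !addr_ge0// !mulr_ge0// ltW//.
- apply: (le_trans _ (_ : Num.min (1 / 2) (2 * k - l) <= _)); last by rewrite ge_min lexx orbT.
  by apply: le_trans Ae; rewrite ler_wpM2r ?(ltW e0)// lerDr.
- by move=> r x Tr Ix; exact: HT.
Qed.

(** Decay of the derivative of order [n.+2] makes all those up to order [n.+1] uniformly small, as
    [higher_decay] requires. *)
Lemma decays_ztn n : (0 < n)%N -> (n <= s - 3)%N ->
  decays (fun t => N2 (z t n.+2)) -> decays (fun t => N2 (zt t n)).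
Proof.
move=> n0 ns dn; apply: decays_of_ineq => l l0 lk.
have [n1 n2] : (n.+1 < s)%N /\ (n.+2 < s)%N.
  have h2 : (n.+2 < s)%N by rewrite -(subnK s3) addn3 !ltnS.
  by split => //; exact: ltnW.
have A0 : 0 <= higher_cst n by rewrite /higher_cst addr_ge0// !mulr_ge0// exprn_ge0.
have b0 : 0 < 2 * k - l by rewrite subr_gt0.
have [e [e0 e1 Ae]] := small_param A0 b0.
have e20 : 0 < e ^+ 2 by rewrite exprn_gt0.
have [T T0 HT] := near_from (decays_small dn e20).
exists T, (N2 (zt T n)); split => // t Tt.
have t0 : 0 < t by exact: lt_le_trans Tt.
rewrite mulrC; apply: zt_N2_le => // h h0.
rewrite mulrC; apply: (higher_decay h0 (ltW e0) T0 ns Ae) => //.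
move=> r j x Tr /andP[j0 jn] Ix; have r0 : 0 < r by exact: lt_le_trans Tr.
rewrite -(@ler_pXn2r _ 2) ?nnegrE ?(ltW e0)// real_normK ?num_real//.
apply: (le_trans (z_sup r0 (leq_ltn_trans jn n1) Ix)).
apply: le_trans (HT r Tr); apply: z_poincare => //.
by rewrite ltnS jn ltnW.
Qed.

Lemma N2_sum4 (u1 u2 u3 u4 : R -> R) : L2 u1 -> L2 u2 -> L2 u3 -> L2 u4 ->
  N2 (fun x => u1 x + u2 x + u3 x + u4 x) <= 4 * (N2 u1 + N2 u2 + N2 u3 + N2 u4).
Proof.
move=> h1 h2 h3 h4; have h12 := L2D h1 h2.
have h34 := L2D h3 h4.
have -> : N2 (fun x => u1 x + u2 x + u3 x + u4 x) = N2 (fun x => (u1 x + u2 x) + (u3 x + u4 x)).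
  by apply: Int_ext => x _; rewrite !addrA.
apply: (le_trans (N2D_le h12 h34)).
have := N2D_le h1 h2; have := N2D_le h3 h4; lra.
Qed.

Lemma N2Z (a : R) (u : R -> R) : L2 u -> N2 (fun x => a * u x) = a ^+ 2 * N2 u.
Proof. by move=> hu; rewrite -IntZ; [apply: Int_ext => x _; rewrite exprMn|exact: L2_sqr]. Qed.

Lemma N3_eq t n : 0 < t -> (n <= s - 3)%N ->
  d ^+ 2 * N2 (z t n.+3) <= 4 * (N2 (zt t n) + m ^+ 2 * N2 (z t n.+1)
    + c ^+ 2 * N2 (leib n.+1 (z t) (z t)) + k ^+ 2 * N2 (z t n)).
Proof.
move=> t0 ns.
have h2 : (n.+2 < s)%N by rewrite -(subnK s3) addn3 !ltnS.
have hz3 := zL2 t0 h2; have hz1 := zL2 t0 (ltnW (ltnW h2)); have hz0 := zL2 t0 (ltnW (ltnW (ltnW h2))).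
have hzt := ztL2 t0 ns.
have hl : L2 (leib n.+1 (z t) (z t)).
  have hc : chain n.+1 (z t) by apply: chain_le (zC t0); exact/ltnW/ltnW.
  exact: pd_L2 (leib_pderiv hc hc).
rewrite -N2Z// -(N2Z m hz1) -(N2Z c hl) -(N2Z k hz0).
apply: le_trans (N2_sum4 hzt (L2Z m hz1) (L2Z c hl) (L2Z k hz0)).
rewrite le_eqVlt; apply/orP; left; apply/eqP; apply: Int_aeq.
- by apply: measurable_funX; apply: L2_measurable; exact: L2Z.
- by apply: measurable_funX; apply: L2_measurable; do 3 (apply: L2D; last exact: L2Z).
- by apply: filterS (z_eqn t0 ns) => x + Ix => /(_ Ix) ->; rewrite /kdv_rhs; ring.
Qed.

Lemma leib_L2 n (f g : nat -> R -> R) : (forall j, (j <= n)%N -> bdd (f j)) ->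
  (forall j, (j <= n)%N -> L2 (g j)) -> L2 (leib n f g).
Proof.
elim: n f g => [|n IH] f g hf hg; first by apply: bdd_L2M; [exact: hf|exact: hg].
apply: L2D; apply: IH => j jn.
- exact: (hf j.+1).
- exact/hg/leqW.
- exact/hf/leqW.
- exact: (hg j.+1).
Qed.

Lemma leib_N2 n (f g : nat -> R -> R) B : (forall j, (j <= n)%N -> bdd (f j)) ->
  (forall j, (j <= n)%N -> L2 (g j)) ->
  (forall j x, (j <= n)%N -> I x -> `|f j x| <= 1) ->
  (forall j, (j <= n)%N -> N2 (g j) <= B) ->
  N2 (leib n f g) <= 4 ^+ n * B.
Proof.
elim: n f g => [|n IH] f g hf hg f1 gB.
  have h0 := hf _ (leqnn 0); have g0 := hg _ (leqnn 0).
  rewrite expr0 mul1r; apply: (le_trans _ (gB _ (leqnn 0))).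
  apply: Int_le; [by apply: L2_sqr; exact: bdd_L2M|exact: L2_sqr|].
  move=> x Ix /=; rewrite exprMn ler_piMl ?sqr_ge0//.
  by rewrite -(real_normK (num_real (f 0%N x))) exprn_ile1// f1.
have N1 : N2 (leib n (fun j => f j.+1) g) <= 4 ^+ n * B.
  by apply: IH => j; [exact: (hf j.+1)|move=> /leqW; exact: hg|
    move=> x; exact: (f1 j.+1)|move=> /leqW; exact: gB].
have N2' : N2 (leib n f (fun j => g j.+1)) <= 4 ^+ n * B.
  by apply: IH => j; [move=> /leqW; exact: hf|exact: (hg j.+1)|
    move=> x /leqW; exact: f1|exact: (gB j.+1)].
apply: (le_trans (N2D_le _ _)).
- by apply: leib_L2 => j; [exact: (hf j.+1)|move=> /leqW; exact: hg].
- by apply: leib_L2 => j; [move=> /leqW; exact: hf|exact: (hg j.+1)].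
by rewrite exprS; lra.
Qed.

(** The equation bounds z_xxx by z', z_x and z, but z_x is so far known only with the poor rate of
    [decay1]. It is therefore interpolated between z, which has the full rate, and z_xxx, whose
    small share is absorbed. *)
Lemma decays_N3 : decays (fun t => N2 (z t 3)).
Proof.
pose K1 := m ^+ 2 + 4 * c ^+ 2.
have K10 : 0 <= K1.
  by apply: addr_ge0; [exact: sqr_ge0|apply: mulr_ge0 => //; exact: sqr_ge0].
have d20 : 0 < d ^+ 2 by rewrite exprn_gt0.
(* Makes [4 * (K1 * eta)] at most [d ^+ 2 / 2], so that half of the left-hand side absorbs the share
   of z_xxx. *)
pose eta := d ^+ 2 / (8 * (K1 + 1)).
have K11 : 0 < 8 * (K1 + 1) by rewrite mulr_gt0// ltr_wpDl.
have eta0 : 0 < eta by rewrite divr_gt0.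
have s0 : (0 < s)%N by exact: leq_trans s3.
have s1 : (1 < s)%N by exact: leq_trans s3.
have ineq : \forall t \near +oo, N2 (z t 3) <=
    8 / d ^+ 2 * N2 (zt t 0%N) + (2 / d ^+ 2 * (4 * k ^+ 2 + K1 / eta)) * N2 (z t 0%N).
  near=> t.
  have t0 : 0 < t by near: t; exact: near_pinfty_gt0.
  have zle : forall x, I x -> `|z t 0%N x| <= 1.
    near: t; apply: sup_small => //; rewrite expr1n; exact: N1_small.
  have hz0 := zL2 t0 (ltnW s0); have hz1 := zL2 t0 (ltnW s1); have hz2 := zL2 t0 s1.
  have b0 := z_bdd t0 s0.
  have E := N3_eq t0 (leq0n (s - 3)).
  have L : N2 (leib 1 (z t) (z t)) <= 4 * N2 (z t 1%N).
    rewrite -IntZ; last exact: L2_sqr.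
    apply: Int_le.
    - by apply: L2_sqr; apply: L2_ext (L2Z 2 (bdd_L2M b0 hz1)) => x _ /=; ring.
    - by apply: intgZ; exact: L2_sqr.
    - move=> x Ix /=; have z1 := zle x Ix.
      have -> : (z t 1%N x * z t 0%N x + z t 0%N x * z t 1%N x) ^+ 2
         = 4 * (z t 0%N x ^+ 2 * z t 1%N x ^+ 2) by ring.
      rewrite ler_wpM2l// ler_piMl ?sqr_ge0//.
      by rewrite -(real_normK (num_real (z t 0%N x))) exprn_ile1.
  have interp : N2 (z t 1%N) <= eta * N2 (z t 3) + 1 / (4 * eta) * N2 (z t 0%N).
    have P : N2 (z t 1%N) = Int (fun x => - (z t 0%N x * z t 2 x)).
      apply: (Int_total (f := fun x => z t 0%N x * z t 1%N x)).
      - by apply: measurable_funX; exact: L2_measurable.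
      - by apply: intgN; exact: L2_intgM.
      - exact: (pderivM (zP t0 s0) (zP t0 s1)).
      - by apply: aeq_ext => x _; ring.
    have P3 : N2 (z t 2) <= N2 (z t 3) by apply: z_poincare => //.
    apply: (@le_trans _ _ (eta * N2 (z t 2) + 1 / (4 * eta) * N2 (z t 0%N))); last first.
      by rewrite lerD2r ler_wpM2l// ltW.
    rewrite P -!IntZ; [|exact: L2_sqr..].
    rewrite -IntD; [|by apply: intgZ; exact: L2_sqr..].
    apply: Int_le; [by apply: intgN; exact: L2_intgM|by apply: intgD; apply: intgZ; exact: L2_sqr|].
    move=> x _; rewrite -subr_ge0.
    have -> : eta * z t 2 x ^+ 2 + 1 / (4 * eta) * z t 0%N x ^+ 2 - - (z t 0%N x * z t 2 x)
       = (2 * eta * z t 2 x + z t 0%N x) ^+ 2 / (4 * eta) by field; rewrite gt_eqF.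
    by rewrite divr_ge0 ?sqr_ge0// mulr_ge0// ltW.
  move: E L interp (N2_ge0 (z t 3)) (N2_ge0 (z t 0%N)) (N2_ge0 (z t 1%N)).
  set A3 := N2 (z t 3); set A1 := N2 (z t 1%N); set A0 := N2 (z t 0%N); set At := N2 (zt t 0%N).
  set AL := N2 (leib _ _ _) => E L interp A30 A00 A10.
  have cL : c ^+ 2 * AL <= c ^+ 2 * (4 * A1) by rewrite ler_wpM2l ?sqr_ge0.
  have KI : K1 * A1 <= K1 * (eta * A3 + 1 / (4 * eta) * A0) by rewrite ler_wpM2l.
  have Keta : 4 * (K1 * eta) <= d ^+ 2 / 2.
    have -> : d ^+ 2 / 2 = 4 * ((K1 + 1) * eta) by rewrite /eta; field; rewrite gt_eqF// ltr_wpDl.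
    by rewrite ler_pM2l// ler_wpM2r ?lerDl// ltW.
  have KA : 4 * (K1 * eta) * A3 <= d ^+ 2 / 2 * A3 by rewrite ler_wpM2r.
  rewrite -(ler_pM2l d20).
  have -> : d ^+ 2 * (8 / d ^+ 2 * At + 2 / d ^+ 2 * (4 * k ^+ 2 + K1 / eta) * A0)
     = 8 * At + (8 * k ^+ 2 + 2 * (K1 / eta)) * A0 by field; rewrite !gt_eqF.
  have K4 : K1 * (1 / (4 * eta) * A0) = K1 / eta * A0 / 4 by field; rewrite gt_eqF.
  rewrite mulrDr K4 in KI.
  have Ks : K1 * A1 = m ^+ 2 * A1 + c ^+ 2 * (4 * A1) by rewrite /K1; ring.
  rewrite [X in _ <= 8 * At + X]mulrDl -[2 * (K1 / eta) * A0]mulrA.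
  move: (K1 / eta * A0) KI => Q KI.
  lra.
apply: decays_le ineq _; apply: decaysD; apply: decaysZ.
- by apply: divr_ge0 => //; exact: sqr_ge0.
- exact: decays_zt0.
- apply: mulr_ge0; first by apply: divr_ge0 => //; exact: sqr_ge0.
  apply: addr_ge0; first by apply: mulr_ge0 => //; exact: sqr_ge0.
  by apply: divr_ge0 => //; exact: ltW.
- exact: decays_N0.
Unshelve. all: by end_near. Qed.

(** The n-th derivative of the equation gives z_(n+3) from the n-th derivative of z' and from
    derivatives of order at most [n.+2], all of which decay at the full rate, so no interpolation
    occurs. *)
Lemma decays_step n : (0 < n)%N -> (n <= s - 3)%N ->
  decays (fun t => N2 (z t n.+2)) -> decays (fun t => N2 (z t n.+3)).
Proof.
move=> n0 ns dn.
have [n1 n2] : (n.+1 < s)%N /\ (n.+2 < s)%N.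
  have h2 : (n.+2 < s)%N by rewrite -(subnK s3) addn3 !ltnS.
  by split => //; exact: ltnW.
have d20 : 0 < d ^+ 2 by rewrite exprn_gt0.
pose K := m ^+ 2 + c ^+ 2 * 4 ^+ n.+1 + k ^+ 2.
have K0 : 0 <= K.
  apply: addr_ge0; last exact: sqr_ge0.
  by apply: addr_ge0; [exact: sqr_ge0|apply: mulr_ge0; [exact: sqr_ge0|exact: exprn_ge0]].
have ineq : \forall t \near +oo, N2 (z t n.+3) <=
    4 / d ^+ 2 * N2 (zt t n) + 4 / d ^+ 2 * K * N2 (z t n.+2).
  near=> t.
  have t0 : 0 < t by near: t; exact: near_pinfty_gt0.
  have small : N2 (z t n.+2) <= 1 by near: t; exact: decays_small.
  have P j : (j <= n.+2)%N -> N2 (z t j) <= N2 (z t n.+2).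
    by move=> jn; apply: z_poincare => //; rewrite jn ltnW.
  have L : N2 (leib n.+1 (z t) (z t)) <= 4 ^+ n.+1 * N2 (z t n.+2).
    apply: leib_N2.
    - by move=> j jn; apply: z_bdd => //; exact: leq_ltn_trans n1.
    - by move=> j jn; apply: zL2 => //; apply: (leq_trans jn); exact: ltnW.
    - move=> j x jn Ix; rewrite -(@ler_pXn2r _ 2) ?nnegrE// real_normK ?num_real// expr1n.
      apply: (le_trans (z_sup t0 (leq_ltn_trans jn n1) Ix)); apply: le_trans small.
      exact: P.
    - by move=> j jn; apply: P; exact: leqW.
  have E := N3_eq t0 ns.
  rewrite -(ler_pM2l d20); apply: (le_trans E).
  have -> : d ^+ 2 * (4 / d ^+ 2 * N2 (zt t n) + 4 / d ^+ 2 * K * N2 (z t n.+2)) =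
    4 * (N2 (zt t n) + K * N2 (z t n.+2)) by field; rewrite gt_eqF.
  rewrite ler_pM2l// -!addrA lerD2l /K !mulrDl -!addrA.
  apply: lerD; first by rewrite ler_wpM2l ?sqr_ge0// P.
  apply: lerD; first by rewrite -mulrA ler_wpM2l ?sqr_ge0.
  by rewrite ler_wpM2l ?sqr_ge0// P// -addn2 leq_addr.
apply: decays_le ineq _; apply: decaysD; apply: decaysZ.
- by apply: divr_ge0 => //; exact: sqr_ge0.
- exact: decays_ztn.
- by apply: mulr_ge0 => //; apply: divr_ge0 => //; exact: sqr_ge0.
- exact: dn.
Unshelve. all: by end_near. Qed.

Lemma decays_top : decays (fun t => N2 (z t s)).
Proof.
suff H n : (n <= s - 3)%N -> decays (fun t => N2 (z t n.+3)).
  by have := H _ (leqnn _); rewrite -addn3 subnK.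
elim: n => [|n IH] ns; first exact: decays_N3.
by apply: decays_step => //; exact/IH/ltnW.
Qed.

Theorem scalar_decay n : (n <= s)%N -> decays (fun t => N2 (z t n)).
Proof.
move=> ns; apply: decays_le decays_top.
by apply: filterS near_pinfty_gt0 => t t0; apply: z_poincare => //; rewrite ns leqnn.
Qed.

End scalar_decay.

(** * Decoupling of the system *)

Section decoupling.
Variable R : realType.
Implicit Types (a b x y : R).

(** For p = a u + b v, these match the coefficients of u_xxx, v_xxx, u u_x, (u v)_x and v v_x in [a]
    times the first equation plus [b] times the second with those of d p_xxx + c p p_x. *)
Definition decouples (a1 a2 a3 a b d c : R) := [/\ a + b * a3 = d * a, a * a3 + b = d * b,
  a + b * a2 = c * a ^+ 2, a * a2 + b * a1 = c * (a * b) & a * a1 + b = c * b ^+ 2].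

(** A quadratic form of trace zero in the plane has a nonzero isotropic vector; the witness solves
    the quadratic equation for b / a. *)
Lemma null_direction x y : exists a b,
  0 < a ^+ 2 + b ^+ 2 /\ x * (a * b) + y * (b ^+ 2 - a ^+ 2) = 0.
Proof.
have [->|y0] := eqVneq y 0.
  by exists 1, 0; rewrite !mulr0 mul0r addr0 expr1n expr0n addr0 ltr01.
exists (2 * y), (Num.sqrt (x ^+ 2 + 4 * y ^+ 2) - x).
set q := Num.sqrt _; have qE : q ^+ 2 = x ^+ 2 + 4 * y ^+ 2.
  by rewrite sqr_sqrtr//; apply: addr_ge0; [exact: sqr_ge0|apply: mulr_ge0 => //; exact: sqr_ge0].
split.
  apply: ltr_pwDl; last exact: sqr_ge0.
  by rewrite lt_neqAle sqr_ge0 andbT eq_sym sqrf_eq0 mulf_neq0// pnatr_eq0.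
have -> : x * (2 * y * (q - x)) + y * ((q - x) ^+ 2 - (2 * y) ^+ 2) =
  y * (q ^+ 2 - (x ^+ 2 + 4 * y ^+ 2)) by ring.
by rewrite qE subrr mulr0.
Qed.

(** The two forms are proportional, so an isotropic vector of a nonzero one serves both. *)
Lemma common_null_direction (x1 y1 x2 y2 : R) : x1 * y2 = x2 * y1 -> exists a b,
  [/\ 0 < a ^+ 2 + b ^+ 2, x1 * (a * b) + y1 * (b ^+ 2 - a ^+ 2) = 0 &
      x2 * (a * b) + y2 * (b ^+ 2 - a ^+ 2) = 0].
Proof.
move=> par; have [x10|x10] := eqVneq x1 0; last first.
  have [a [b [ab0 h]]] := null_direction x1 y1; exists a, b; split=> //.
  apply: (mulfI x10); transitivity (x2 * (x1 * (a * b) + y1 * (b ^+ 2 - a ^+ 2))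
    + (x1 * y2 - x2 * y1) * (b ^+ 2 - a ^+ 2)); first by ring.
  by rewrite h par subrr; ring.
have [y10|y10] := eqVneq y1 0; last first.
  have [a [b [ab0 h]]] := null_direction x1 y1; exists a, b; split=> //.
  apply: (mulfI y10); transitivity (y2 * (x1 * (a * b) + y1 * (b ^+ 2 - a ^+ 2))
    - (x1 * y2 - x2 * y1) * (a * b)); first by ring.
  by rewrite h par subrr; ring.
have [a [b [ab0 h]]] := null_direction x2 y2; exists a, b; split=> //.
by rewrite x10 y10 !mul0r addr0.
Qed.

(** The symmetric matrix with entries [w1], [w2], [w3] kills the vector (b, -a), so it is a multiple
    of the projection onto (a, b); [c] is found by evaluating its quadratic form at (a, b). *)
Lemma rank_one a b (w1 w2 w3 : R) : 0 < a ^+ 2 + b ^+ 2 -> w1 * b = w2 * a ->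
  w2 * b = w3 * a -> exists c, [/\ w1 = c * a ^+ 2, w2 = c * (a * b) & w3 = c * b ^+ 2].
Proof.
move=> ab0 h1 h2; have n0 : a ^+ 2 + b ^+ 2 != 0 by rewrite gt_eqF.
exists ((w1 * a ^+ 2 + 2 * w2 * (a * b) + w3 * b ^+ 2) / (a ^+ 2 + b ^+ 2) ^+ 2).
have h3 : w3 * a ^+ 2 = w1 * b ^+ 2.
  by rewrite !expr2 !mulrA -h2 h1; ring.
have E (w v : R) : w * (a ^+ 2 + b ^+ 2) ^+ 2 =
    (w1 * a ^+ 2 + 2 * w2 * (a * b) + w3 * b ^+ 2) * v ->
  w = (w1 * a ^+ 2 + 2 * w2 * (a * b) + w3 * b ^+ 2) / (a ^+ 2 + b ^+ 2) ^+ 2 * v.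
  move=> H; apply: (mulIf (expf_neq0 2 n0)); by rewrite H; field.
split; apply: E.
- have -> : (w1 * a ^+ 2 + 2 * w2 * (a * b) + w3 * b ^+ 2) * a ^+ 2 =
    w1 * a ^+ 4 + 2 * (w2 * a) * (a ^+ 2 * b) + (w3 * a ^+ 2) * b ^+ 2 by ring.
  by rewrite -h1 h3; ring.
- have -> : (w1 * a ^+ 2 + 2 * w2 * (a * b) + w3 * b ^+ 2) * (a * b) =
    (w1 * b) * a ^+ 3 + 2 * w2 * (a ^+ 2 * b ^+ 2) + (w3 * a) * b ^+ 3 by ring.
  by rewrite h1 -h2; ring.
- have -> : (w1 * a ^+ 2 + 2 * w2 * (a * b) + w3 * b ^+ 2) * b ^+ 2 =
    (w1 * b ^+ 2) * a ^+ 2 + 2 * (w2 * b) * (a * b ^+ 2) + w3 * b ^+ 4 by ring.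
  by rewrite -h3 h2; ring.
Qed.

(** For [a3 = 0] the hypotheses of [rank_one] are two trace-zero quadratic equations in (a, b). They
    are proportional exactly by the condition on [a1] and [a2], and they are the same for the
    orthogonal vector (-b, a). *)
Lemma decoupling (a1 a2 a3 : R) : a1 ^+ 2 + a2 ^+ 2 = a1 + a2 -> `|a3| < 1 ->
  (a1 - 1) * a3 = 0 -> (a2 - 1) * a3 = 0 -> exists a b d1 d2 c1 c2,
  [/\ 0 < a ^+ 2 + b ^+ 2, 0 < d1, 0 < d2, decouples a1 a2 a3 a b d1 c1 &
      decouples a1 a2 a3 (- b) a d2 c2].
Proof.
move=> h12; rewrite ltr_norml => /andP[h3 h3'] h13 h23.
have [a30|a30] := eqVneq a3 0; last first.
  have a11 : a1 = 1 by apply/eqP; rewrite -subr_eq0; move/eqP: h13; rewrite mulf_eq0 (negbTE a30) orbF.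
  have a21 : a2 = 1 by apply/eqP; rewrite -subr_eq0; move/eqP: h23; rewrite mulf_eq0 (negbTE a30) orbF.
  (* For [a1 = a2 = 1] the components are u + v and v - u, the latter with a linear equation;
     [|a3| < 1] makes both dispersions positive. *)
  exists 1, 1, (1 + a3), (1 - a3), 2, 0; rewrite a11 a21.
  by split; [lra|lra|lra|split; ring|split; ring].
have par : (1 - a1) * a1 = (a2 - 1) * a2.
  by apply/eqP; rewrite -subr_eq0; apply/eqP; rewrite -[RHS](subrr (a1 + a2)) -{2}h12; ring.
have [a [b [ab0 e1 e2]]] := common_null_direction par.
have [c1 [p1 p2 p3]] : exists c, [/\ a + b * a2 = c * a ^+ 2, a * a2 + b * a1 = c * (a * b)
    & a * a1 + b = c * b ^+ 2].
  by apply: rank_one => //; lra.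
have [c2 [q1 q2 q3]] : exists c, [/\ (- b) + a * a2 = c * (- b) ^+ 2,
    (- b) * a2 + a * a1 = c * ((- b) * a) & (- b) * a1 + a = c * a ^+ 2].
  by apply: rank_one; [rewrite sqrrN addrC|lra..].
exists a, b, 1, 1, c1, c2; split => //.
  by split => //; rewrite a30; ring.
by split => //; rewrite a30; ring.
Qed.

End decoupling.

(** * Conservation of the mean and passage to the deviation *)

Section damped_kdv.
Variable R : realType.
Implicit Types (g : nat -> R -> R) (t x : R).

Local Notation mu := (@lebesgue_measure R).
Local Notation I := (`]0, 1[%classic : set R).
Local Notation Int f := (Rintegral mu I f).
Local Notation N2 f := (Int (fun x => f x ^+ 2)).

#[local] Existing Instance ae_filter.

Definition dev g n x := g n x - chain_cst (Int (g 0%N)) n x.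

Lemma dev_chain s g : chain s g -> chain s (dev g).
Proof. by move=> hg; apply: chainB => //; exact: chain_cstP. Qed.

Lemma dev_mean g : intg (g 0%N) -> Int (dev g 0%N) = 0.
Proof. by move=> ig; rewrite IntB ?Int_cst ?subrr//; exact: intg_cst. Qed.

Variables (d c k : R) (s : nat) (P Pt : R -> nat -> R -> R).
Hypotheses (d0 : 0 < d) (k0 : 0 < k) (s3 : (3 <= s)%N).
Hypothesis PC : forall t, 0 < t -> chain s (P t).
Hypothesis PtC : forall t, 0 < t -> chain (s - 3) (Pt t).
Hypothesis P_cont : forall t n, 0 < t -> (n <= s)%N ->
  L2cvg (F := 0^') (fun h => P (t + h) n) (P t n).
Hypothesis P_diff : forall t n, 0 < t -> (n <= s - 3)%N ->
  dL2 t (fun r => P r n) (Pt t n).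
Hypothesis P_eq : forall t, 0 < t -> aeq (Pt t 0%N) (fun x =>
  - (d * P t 3 x + c * (P t 0%N x * P t 1%N x) + k * dev (P t) 0%N x)).

Lemma mean_derive t : 0 < t -> is_derive t 1 (fun r => Int (P r 0%N)) 0.
Proof.
move=> t0; have h0 := chain_L2 (PC t0) (leq0n s).
have dcst : dL2 t (fun _ _ : R => 1) (fun=> 0).
  apply: L2cvg_near (L2cvg_cst (FF := dnbhs_filter (0 : R)) (L2_cst (0 : R))).
  by apply: nearW => h x _; rewrite subrr mul0r.
have := dL2_ip h0 (L2_cst (1 : R)) (P_diff t0 (leq0n _)) dcst.
have -> : (fun r => Int (fun x => P r 0%N x * 1)) = fun r => Int (P r 0%N).
  by apply/funext => r; apply: Int_ext => x _; rewrite mulr1.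
move=> D; apply: is_derive_eq D _.
have p j : (j < s)%N -> pderiv (P t j) (P t j.+1) by exact: (proj2 (PC t0)).
have p0 := p 0%N (leq_trans (isT : (0 < 3)%N) s3).
have p2 := p 2%N s3.
have idev : intg (dev (P t) 0%N) by apply: L2_intg; exact: chain_L2 (dev_chain (PC t0)) _.
transitivity (Int (fun x => - k * dev (P t) 0%N x)); last first.
  by rewrite IntZ// dev_mean ?mulr0//; exact: L2_intg.
apply: (Int_total (f := fun x => - d * P t 2 x + (- (c / 2)) * (P t 0%N x * P t 0%N x))).
- have mt := L2_measurable (chain_L2 (PtC t0) (leq0n _)); have m0 := L2_measurable h0.
  by apply: measurable_funD; apply: measurable_funM.
- exact: intgZ.
- by apply: pderivD; [exact: (pderivZ _ p2)|exact: (pderivZ _ (pderivM p0 p0))].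
- by apply: filterS (P_eq t0) => x + Ix => /(_ Ix) ->; field.
Qed.

(** [gronwall] with rate 0, applied to the mean and to its opposite, gives the two inequalities. *)
Lemma mean_cst t : 0 < t -> Int (P t 0%N) = Int (P 1 0%N).
Proof.
have le a b : 0 < a -> a <= b -> Int (P b 0%N) = Int (P a 0%N).
  move=> a0 ab.
  have D r : a <= r -> is_derive r 1 (fun r => Int (P r 0%N)) 0.
    by move=> ar; apply: mean_derive; exact: lt_le_trans ar.
  apply/eqP; rewrite eq_le; apply/andP; split.
    have := gronwall (l := 0) D _ ab; rewrite oppr0 mul0r expR0 mulr1; apply.
    by move=> r _; rewrite mul0r.
  have DN r : a <= r -> is_derive r 1 (fun r => - Int (P r 0%N)) 0.
    by move=> ar; apply: is_derive_eq (is_deriveN (D r ar)) _; exact: oppr0.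
  have := gronwall (l := 0) DN _ ab; rewrite oppr0 mul0r expR0 mulr1 lerN2; apply.
  by move=> r _; rewrite mul0r.
by move=> t0; have [t1|/ltW t1] := leP t 1; [rewrite (le t 1)|rewrite (le 1 t)].
Qed.

(** With P equal to its mean plus z, c P P_x becomes (c / 2) (z^2)_x plus the drift [m] z_x, and [m]
    is independent of time by [mean_cst]. *)
Lemma dev_decay n : (n <= s)%N -> decays k (fun t => N2 (dev (P t) n)).
Proof.
pose m := c * Int (P 1 0%N).
apply: (@scalar_decay _ d m (c / 2) k s (fun t => dev (P t)) Pt) => //.
- by move=> t t0; exact/dev_chain/PC.
- by move=> t t0; apply: dev_mean; apply: L2_intg; exact: chain_L2 (PC t0) (leq0n s).
- move=> t j t0 js.
  have := L2cvgD (FF := dnbhs_filter (0 : R)) (P_cont t0 js)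
    (L2cvg_cst (FF := dnbhs_filter (0 : R)) (L2Z (-1) (chain_L2 (chain_cstP s (Int (P t 0%N))) js))).
  have -> : (fun x => P t j x + -1 * chain_cst (Int (P t 0%N)) j x) = dev (P t) j.
    by apply/funext => x; rewrite mulN1r.
  apply: L2cvg_near; apply: filterS (near_add_gt0 t0) => h th x _.
  by rewrite /dev (mean_cst th) (mean_cst t0) mulN1r.
- move=> t j t0 js; apply: L2cvg_near (P_diff t0 js).
  apply: filterS (near_add_gt0 t0) => h th x _; congr (_ / _).
  by rewrite /dev (mean_cst th) (mean_cst t0); ring.
- move=> t t0; apply: filterS (P_eq t0) => x + Ix => /(_ Ix) ->.
  by rewrite /kdv_rhs /dev/= (mean_cst t0) /m; field.
Qed.

End damped_kdv.

(** * Derivatives of the solution *)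

Section solution_levels.
Variable R : realType.
Implicit Types (t x : R) (u : R -> R -> R) (U : R -> nat -> R -> R).

Local Notation mu := (@lebesgue_measure R).
Local Notation I := (`]0, 1[%classic : set R).
Local Notation Int f := (Rintegral mu I f).
Local Notation N2 f := (Int (fun x => f x ^+ 2)).

#[local] Existing Instance ae_filter.

Definition levels s u U := forall t, 0 <= t ->
  [/\ L2 (u t), chain s (U t) & aeq (u t) (U t 0%N)].

Lemma C0_levels s u : C0_Hsp s u -> exists U, levels s u U.
Proof.
move=> hu; have H t : exists g, 0 <= t -> [/\ L2 (u t), chain s g & aeq (u t) (g 0%N)].
  have [t0|t0] := leP 0 t; last by exists (fun _ _ => 0).
  by have [h [g [cg ug]]] := in_Hsp_chain (proj1 (hu t t0)); exists g.
by have [U HU] := choice H; exists U.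
Qed.

Lemma Hnorm_cvg (F : set_system R) (FF : Filter F) s (w : R -> R -> R) (W : R -> nat -> R -> R) n :
  (\forall r \near F, [/\ L2 (w r), chain s (W r) & aeq (w r) (W r 0%N)]) ->
  (fun r => Hnorm s (w r)) @ F --> (0 : R) -> (n <= s)%N ->
  (fun r => N2 (W r n)) @ F --> (0 : R).
Proof.
move=> hw cv ns; have cv2 := cvgM cv cv; rewrite mul0r in cv2.
apply: squeeze0 (cv2 _); apply: filterS hw => r [hw hW wW].
rewrite ger0_norm ?N2_ge0//= (Hnorm_chain hW (L2_measurable hw) wW) -expr2 sqr_sqrtr; last first.
  by apply: sumr_ge0 => j _; exact: N2_ge0.
rewrite (bigD1 (Ordinal (ns : (n < s.+1)%N)))//= lerDl.
by apply: sumr_ge0 => j _; exact: N2_ge0.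
Qed.

(** At a positive time, small increments of both signs stay in the half-line, so the limits in the
    definition of a solution become two-sided. *)
Lemma shift_within t : 0 < t ->
  (fun h => t + h) @ (0 : R)^' --> within `[0, +oo[ t^'.
Proof.
move=> t0 A /= H; have [e /= e0 He] := H.
change (\forall h \near (0 : R)^', A (t + h)); near=> h; apply: He => /=.
- rewrite /ball/= opprD addNKr normrN; near: h.
  apply: cvg_within; apply/nbhs_ballP; exists e => //= h.
  by rewrite /ball/= sub0r normrN.
- by rewrite -subr_eq0 addrAC subrr add0r; near: h; exact: nbhs_dnbhs_neq.
- by rewrite in_itv/= andbT ltW//; near: h; exact: near_add_gt0.
Unshelve. all: by end_near. Qed.

Lemma levels_cont s u U t n : C0_Hsp s u -> levels s u U -> 0 < t -> (n <= s)%N ->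
  L2cvg (F := 0^') (fun h => U (t + h) n) (U t n).
Proof.
move=> hu hU t0 ns; have [_ ct _] := hU t (ltW t0).
have near_ge0 : \forall h \near (0 : R)^', 0 <= t + h.
  by apply: filterS (near_add_gt0 t0) => h /ltW.
split.
- by apply: filterS near_ge0 => h th; have [_ ch _] := hU _ th; exact: chain_L2 ch ns.
- exact: chain_L2 ct ns.
apply: (@Hnorm_cvg _ _ s (fun h => u (t + h) \- u t) (fun h j x => U (t + h) j x - U t j x)) => //.
  apply: filterS near_ge0 => h th.
  have [l1 c1 e1] := hU _ th; have [l2 c2 e2] := hU _ (ltW t0).
  split; [exact: L2B|exact: chainB|exact: (aeq_comp2 (fun a b => a - b))].
have cv := proj2 (hu t (ltW t0)).
apply: (cvg_comp _ (fun r => Hnorm s (u r \- u t)) _ cv).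
apply: cvg_trans (shift_within t0) _.
by move=> A; exact: (cvg_within (F := nbhs t)).
Qed.

Lemma levels_diff s s' u u' U U' t n : C1_Hsp s' u u' -> (s' <= s)%N ->
  levels s u U -> levels s' u' U' -> 0 < t -> (n <= s')%N ->
  dL2 t (fun r => U r n) (U' t n).
Proof.
move=> [_ _ hu] ss' hU hU' t0 ns; have [l2 c2' e2] := hU t (ltW t0).
have [l3 c3 e3] := hU' t (ltW t0).
have c2 : chain s' (U t) by exact: chain_le c2'.
have near_ge0 : \forall h \near (0 : R)^', 0 <= t + h.
  by apply: filterS (near_add_gt0 t0) => h /ltW.
have quot h : 0 <= t + h -> chain s' (fun j x => (U (t + h) j x - U t j x) / h).
  move=> th; have [_ c1 _] := hU _ th.
  have := chainZ h^-1 (chainB (chain_le ss' c1) c2).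
  by congr chain; apply/funext => j; apply/funext => x; rewrite mulrC.
split.
- by apply: filterS near_ge0 => h /quot cq; exact: (chain_L2 cq ns).
- exact: chain_L2 c3 ns.
apply: (@Hnorm_cvg _ _ s' (fun h x => (u (t + h) x - u t x) / (t + h - t) - u' t x)
  (fun h j x => (U (t + h) j x - U t j x) / h - U' t j x)) => //.
  apply: filterS near_ge0 => h th; have [l1 c1 e1] := hU _ th.
  have E : t + h - t = h by rewrite addrAC subrr add0r.
  split.
  - apply: L2B => //; apply: L2_ext (L2Z h^-1 (L2B l1 l2)) => x _.
    by rewrite E mulrC.
  - by apply: chainB => //; exact: quot.
  - by apply: filterS3 e1 e2 e3 => x h1 h2 h3 Ix; rewrite h1// h2// h3// E.
apply: (cvg_comp _ (fun r => Hnorm s' (fun x => (u r x - u t x) / (r - t) - u' t x)) _ (hu t (ltW t0))).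
exact: shift_within.
Qed.

Lemma levels_mean s u U t : levels s u U -> 0 <= t -> mean (u t) = Int (U t 0%N).
Proof.
move=> hU t0; have [l c e] := hU t t0.
by apply: Int_aeq => //; apply: L2_measurable => //; exact: chain_L2 c _.
Qed.

Lemma levels_Hnorm s u U t : levels s u U -> 0 <= t ->
  Hnorm s (fun x => u t x - mean (u t)) = Num.sqrt (\sum_(n < s.+1) N2 (dev (U t) n)).
Proof.
move=> hU t0; have [l c e] := hU t t0.
rewrite (@Hnorm_chain _ s (dev (U t)))//.
- exact: dev_chain.
- by apply: L2_measurable; apply: L2B => //; exact: L2_cst.
- by apply: filterS e => x + Ix => ->//; rewrite (levels_mean hU t0).
Qed.

Lemma levels_wderiv s u U t n : levels s u U -> 0 <= t -> (n <= s)%N ->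
  aeq (wderiv n (u t)) (U t n).
Proof.
by move=> hU t0 ns; have [l c e] := hU t t0; exact: (proj2 (chain_wderiv c (L2_measurable l) e ns)).
Qed.

Lemma levels_wderivM s u v U V t : (0 < s)%N -> levels s u U -> levels s v V -> 0 <= t ->
  aeq (wderiv 1 (u t \* v t)) (fun x => U t 1%N x * V t 0%N x + U t 0%N x * V t 1%N x).
Proof.
move=> s0 hU hV t0; have [l c e] := hU t t0; have [l' c' e'] := hV t t0.
apply: (proj2 (chain_wderiv (chain_leib s0 c c') _ _ s0)).
- by apply: measurable_funM; exact: L2_measurable.
- exact: (aeq_comp2 (fun a b => a * b)).
Qed.

End solution_levels.

(** * Decay of the rotated components and return to the original unknowns *)

Section decay_of_solutions.
Variable R : realType.
Implicit Types (f g : nat -> R -> R) (t x : R) (u v : R -> R -> R).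

Local Notation mu := (@lebesgue_measure R).
Local Notation I := (`]0, 1[%classic : set R).
Local Notation Int f := (Rintegral mu I f).
Local Notation N2 f := (Int (fun x => f x ^+ 2)).

#[local] Existing Instance ae_filter.

Lemma dev_lin (a b : R) f g n x : intg (f 0%N) -> intg (g 0%N) ->
  dev (fun j x => a * f j x + b * g j x) n x = a * dev f n x + b * dev g n x.
Proof.
move=> i j; rewrite /dev IntD; [|exact: intgZ..].
by rewrite !IntZ//; case: n => [|n] /=; ring.
Qed.

Lemma N2_lin_le (a b : R) (u v : R -> R) : L2 u -> L2 v ->
  N2 (fun x => a * u x + b * v x) <= 2 * a ^+ 2 * N2 u + 2 * b ^+ 2 * N2 v.
Proof.
move=> hu hv; apply: (le_trans (N2D_le (L2Z a hu) (L2Z b hv))).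
by rewrite !N2Z// !mulrA.
Qed.

Lemma decays_sum (k : R) m (E : nat -> R -> R) : (forall n, (n < m)%N -> decays k (E n)) ->
  decays k (fun t => \sum_(n < m) E n t).
Proof.
elim: m => [|m IH] dE.
  move=> l _ _; exists 0; apply: nearW => t; by rewrite big_ord0 mul0r.
have := decaysD (IH (fun n nm => dE n (ltnW nm))) (dE m (ltnSn m)).
by congr decays; apply/funext => t; rewrite big_ord_recr.
Qed.

Lemma decays_sqrt (k k' e : R) (E : R -> R) : 0 < k -> k' < k -> 0 < e -> decays k E ->
  \forall t \near +oo, Num.sqrt (E t) <= e * expR (- k' * t).
Proof.
(* [k'] may be negative, while [decays] speaks of positive rates only. *)
move=> k0 kk e0 dE; pose K := Num.max 0 (2 * k').
have K2 : K < 2 * k by rewrite gt_max mulr_gt0//= ltr_pM2l.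
have [K0 Kk'] : 0 <= K /\ 2 * k' <= K by rewrite !le_max !lexx orbT.
(* Halfway between [K] and [2 * k]: the gap between [l] and [2 * k'] leaves a factor that tends to
   0. *)
pose l := (K + 2 * k) / 2.
have [l0 lk kl] : [/\ 0 < l, l < 2 * k & 0 < l - 2 * k'] by rewrite /l; split; lra.
have [C HC] := dE l l0 lk; have e20 : 0 < e ^+ 2 by rewrite exprn_gt0.
apply: filterS2 HC (expR_small C kl e20) => t h1 h2.
have ee : 0 <= e * expR (- k' * t) by apply: mulr_ge0; [exact: ltW|exact: expR_ge0].
rewrite -[leRHS]ger0_norm// -sqrtr_sqr; apply: ler_wsqrtr; apply: (le_trans h1).
rewrite exprMn -expRM_natl.
have -> : - l * t = - (l - 2 * k') * t + 2 * (- k' * t) by ring.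
by rewrite expRD mulrA ler_wpM2r// expR_ge0.
Qed.

Section rotated_component.
Variables (k a1 a2 a3 a b d c : R) (s : nat) (u v u' v' : R -> R -> R).
Variables (U V U' V' : R -> nat -> R -> R).
Hypotheses (k0 : 0 < k) (d0 : 0 < d) (s3 : (3 <= s)%N).
Hypothesis dec : decouples a1 a2 a3 a b d c.
Hypotheses (hu : C0_Hsp s u) (hv : C0_Hsp s v).
Hypotheses (hu' : C1_Hsp (s - 3) u u') (hv' : C1_Hsp (s - 3) v v').
Hypotheses (lU : levels s u U) (lV : levels s v V).
Hypotheses (lU' : levels (s - 3) u' U') (lV' : levels (s - 3) v' V').
Hypothesis equ : forall t, 0 <= t -> aeq (fun x =>
  u' t x + u t x * wderiv 1 (u t) x + wderiv 3 (u t) x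
  + a3 * wderiv 3 (v t) x + a1 * (v t x * wderiv 1 (v t) x)
  + a2 * wderiv 1 (u t \* v t) x + k * (u t x - mean (u t))) (fun=> 0).
Hypothesis eqv : forall t, 0 <= t -> aeq (fun x =>
  v' t x + v t x * wderiv 1 (v t) x + wderiv 3 (v t) x
  + a3 * wderiv 3 (u t) x + a2 * (u t x * wderiv 1 (u t) x)
  + a1 * wderiv 1 (u t \* v t) x + k * (v t x - mean (v t))) (fun=> 0).

Lemma component_decay n : (n <= s)%N ->
  decays k (fun t => N2 (dev (fun j x => a * U t j x + b * V t j x) n)).
Proof.
have Uc t : 0 < t -> chain s (U t) by move=> /ltW/lU[].
have Vc t : 0 < t -> chain s (V t) by move=> /ltW/lV[].
apply: (@dev_decay _ d c k s _ (fun t j x => a * U' t j x + b * V' t j x)) => //.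
- by move=> t t0; apply: chainD; apply: chainZ; [exact: Uc|exact: Vc].
- by move=> t /ltW t0; apply: chainD; apply: chainZ; [have [] := lU' t0|have [] := lV' t0].
- move=> t j t0 js.
  exact: (L2cvgD (FF := dnbhs_filter (0 : R)) (L2cvgZ (FF := dnbhs_filter (0 : R)) a (levels_cont hu lU t0 js))
    (L2cvgZ (FF := dnbhs_filter (0 : R)) b (levels_cont hv lV t0 js))).
- move=> t j t0 js; apply: dL2D; apply: dL2Z.
    exact: levels_diff hu' (leq_subr _ _) lU lU' t0 js.
  exact: levels_diff hv' (leq_subr _ _) lV lV' t0 js.
move=> t t0; have t0' := ltW t0.
have iU : intg (U t 0%N) by apply: L2_intg; exact: chain_L2 (Uc t t0) _.
have iV : intg (V t 0%N) by apply: L2_intg; exact: chain_L2 (Vc t t0) _.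
have [_ _ eU] := lU t0'; have [_ _ eV] := lV t0'.
have [_ _ eU'] := lU' t0'; have [_ _ eV'] := lV' t0'.
have s1 : (1 <= s)%N by exact: leq_trans s3.
have eU1 := levels_wderiv lU t0' s1; have eV1 := levels_wderiv lV t0' s1.
have eU3 := levels_wderiv lU t0' s3; have eV3 := levels_wderiv lV t0' s3.
have eUV := levels_wderivM s1 lU lV t0'.
apply: filterS3 (filterI (filterI eU eV) (filterI eU' eV'))
  (filterI (filterI eU1 eV1) (filterI eU3 eV3))
  (filterI eUV (filterI (equ t0') (eqv t0'))).
move=> x [[h1 h2] [h3 h4]] [[h5 h6] [h7 h8]] [h9 [e1 e2]] Ix.
move: (e1 Ix) (e2 Ix); rewrite h1// h2// h3// h4// h5// h6// h7// h8// h9//.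
rewrite (levels_mean lU t0') (levels_mean lV t0') dev_lin// /dev/=.
move: (U t 0%N x) (U t 1%N x) (U t 3 x) (V t 0%N x) (V t 1%N x) (V t 3 x) (U' t 0%N x) (V' t 0%N x).
move: (Int _) (Int _) => mU mV U0 U1 U3 V0 V1 V3 Ut Vt {}e1 {}e2.
have [p1 p2 p3 p4 p5] := dec.
have D : d * (a * U3 + b * V3) = (a + b * a3) * U3 + (a * a3 + b) * V3 by rewrite p1 p2; ring.
have N : c * ((a * U0 + b * V0) * (a * U1 + b * V1)) = (a + b * a2) * (U0 * U1)
    + (a * a2 + b * a1) * (U1 * V0 + U0 * V1) + (a * a1 + b) * (V0 * V1).
  by rewrite p3 p4 p5; ring.
rewrite D N; apply/eqP; rewrite -subr_eq0; apply/eqP.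
(* The zero on the right is written as [a] times the first equation plus [b] times the second. *)
by rewrite -[RHS](mulr0 a) -[in RHS]e1 -[RHS]addr0 -[X in _ = _ + X](mulr0 b) -[in X in _ = _ + X]e2; ring.
Qed.

End rotated_component.

End decay_of_solutions.

Theorem theorem1p2 (R : realType) (k a1 a2 a3 : R) (s : nat)
    (phi psi : R -> R) (u v : R -> R -> R)
    (hk : 0 < k)
    (ha12 : a1 ^+ 2 + a2 ^+ 2 = a1 + a2)
    (ha3 : `|a3| < 1)
    (ha13 : (a1 - 1) * a3 = 0)
    (ha23 : (a2 - 1) * a3 = 0)
    (hs : (3 <= s)%N)
    (hphi : in_Hsp s phi) (hpsi : in_Hsp s psi)
    (huv : kdv_solution k a1 a2 a3 s phi psi u v) :
  forall k' : R, k' < k ->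
    (fun t : R => Hnorm s (fun x => u t x - mean (u t))
                  + Hnorm s (fun x => v t x - mean (v t)))
    =o_ (pinfty_nbhs R) (fun t : R => expR (- k' * t)).
Proof.
move=> k' kk; have [hu hv _ _ [u' [v' [hu' hv' eq]]]] := huv.
have [U lU] := C0_levels hu; have [V lV] := C0_levels hv.
have [U' lU'] : exists U', levels (s - 3) u' U' by case: hu' => _ /C0_levels.
have [V' lV'] : exists V', levels (s - 3) v' V' by case: hv' => _ /C0_levels.
have [a [b [d1 [d2 [c1 [c2 [D0 d10 d20 dec1 dec2]]]]]]] := decoupling ha12 ha3 ha13 ha23.
have equ t t0 := proj1 (eq t t0); have eqv t t0 := proj2 (eq t t0).
have D := component_decay hk d10 hs dec1 hu hv hu' hv' lU lV lU' lV' equ eqv.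
have D' := component_decay hk d20 hs dec2 hu hv hu' hv' lU lV lU' lV' equ eqv.
(* Decay passes to any fixed combination of the two rotated components; the inverse rotation
   provides [p] and [q] for [U] and for [V]. *)
have H (p q : R) (W : R -> nat -> R -> R) : (forall t, 0 < t -> chain s (W t)) ->
    (forall t j x, W t j x = p * (a * U t j x + b * V t j x) + q * (- b * U t j x + a * V t j x)) ->
    decays k (fun t => \sum_(n < s.+1) \int[lebesgue_measure]_(x in `]0, 1[) dev (W t) n x ^+ 2).
  move=> cW WE; apply: (@decays_sum _ k s.+1 (fun n t =>
    \int[lebesgue_measure]_(x in `]0, 1[) dev (W t) n x ^+ 2)) => n; rewrite ltnS => ns.
  apply: decays_le (decaysD (decaysZ _ (D n ns)) (decaysZ _ (D' n ns))).
  - apply: filterS (near_pinfty_gt0 R) => t t0.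
    have cU : chain s (U t) by have [] := lU t (ltW t0).
    have cV : chain s (V t) by have [] := lV t (ltW t0).
    have cP := chainD (chainZ a cU) (chainZ b cV).
    have cQ := chainD (chainZ (- b) cU) (chainZ a cV).
    apply: le_trans (N2_lin_le p q (chain_L2 (dev_chain cP) ns) (chain_L2 (dev_chain cQ) ns)).
    rewrite le_eqVlt; apply/orP; left; apply/eqP; apply: Int_ext => x _.
    rewrite -dev_lin; [|exact: L2_intg (proj1 cP)|exact: L2_intg (proj1 cQ)].
    by congr (dev _ n x ^+ 2); apply/funext => j; apply/funext => y; exact: WE.
  - by apply: mulr_ge0 => //; exact: sqr_ge0.
  - by apply: mulr_ge0 => //; exact: sqr_ge0.
(* The vector (a, b) is not normalised, so [N] is the determinant by which the inverse matrix is
   divided. *)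
pose N := a ^+ 2 + b ^+ 2; have N0 : N != 0 by rewrite gt_eqF.
have HU := H (a / N) (- b / N) U (fun t t0 => let: And3 _ cU _ := lU t (ltW t0) in cU).
have HV := H (b / N) (a / N) V (fun t t0 => let: And3 _ cV _ := lV t (ltW t0) in cV).
apply/eqoP => e e0; have e2 : 0 < e / 2 by rewrite divr_gt0.
have UE t j x : U t j x = a / N * (a * U t j x + b * V t j x) +
  - b / N * (- b * U t j x + a * V t j x) by rewrite /N; field.
have VE t j x : V t j x = b / N * (a * U t j x + b * V t j x) +
  a / N * (- b * U t j x + a * V t j x) by rewrite /N; field.
apply: filterS3 (near_pinfty_gt0 R) (decays_sqrt hk kk e2 (HU UE)) (decays_sqrt hk kk e2 (HV VE)).
move=> t /ltW t0 h1 h2.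
rewrite (levels_Hnorm lU t0) (levels_Hnorm lV t0) ger0_norm ?addr_ge0 ?sqrtr_ge0//.
apply: (le_trans (lerD h1 h2)).
by rewrite -mulrDl -splitr (ger0_norm (expR_ge0 _)).
Qed.
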